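(* Let $F:\mathbb{C}\to\mathbb{C}$ be an entire function, $F\not\equiv 0$, and let $a_+\neq a_-$ be two equilibria of $\dot{x}=F(x)$ such that there is at least one heteroclinic orbit connecting them, i.e. an orbit $\Gamma$ with $w_+(\Gamma)=\{a_+\}$ and $w_-(\Gamma)=\{a_-\}$. Then the heteroclinic region $\mathcal{H}$ of $F$ between $a_+$ and $a_-$ is open.
   Context: Consider the autonomous planar system $\dot{x}=F(x)$, $x\in\mathbb{C}$, $t\in\mathbb{R}$, with flow $\Phi(t,x)$ on the maximal interval of existence; $\Gamma(x)$ is the (full) orbit through $x$. $w_+(\Gamma)$ (resp. $w_-(\Gamma)$) is the positive (resp. negative) limit set of an orbit $\Gamma$, i.e. the set of all limits in $\mathbb{C}$ along sequences of times tending to the right (resp. left) endpoint of the maximal interval of existence. Equilibria are the zeros of $F$. The heteroclinic region between $a_+$ and $a_-$ is $\mathcal{H}:=\mathcal{H}_+\cap\mathcal{H}_-$ with $\mathcal{H}_{+}:=\{x\in\mathbb{C}:w_{+}(\Gamma(x))=\{a_{+}\}\}$ and $\mathcal{H}_{-}:=\{x\in\mathbb{C}:w_{-}(\Gamma(x))=\{a_{-}\}\}$. *)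

(* Defs.v *)
From Stdlib Require Import Reals.
From Coquelicot Require Import Coquelicot.
Open Scope R_scope.

Definition entire (F : C -> C) : Prop :=
  forall z : C, ex_derive (K := C_AbsRing) (V := C_NormedModule) F z.

Definition equilibrium (F : C -> C) (z : C) : Prop := F z = 0%C.

Definition in_interval (a b : Rbar) (t : R) : Prop :=
  Rbar_lt a t /\ Rbar_lt t b.

(* The values of [gamma] outside the open interval (a, b) are irrelevant. *)
Definition is_solution (F : C -> C) (a b : Rbar) (gamma : R -> C) : Prop :=
  forall t : R, in_interval a b t ->
    is_derive (K := R_AbsRing) (V := C_R_NormedModule) gamma t (F (gamma t)).

Definition is_maximal_solution
    (F : C -> C) (a b : Rbar) (gamma : R -> C) : Prop :=
  Rbar_lt a b /\
  is_solution F a b gamma /\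
  forall (a' b' : Rbar) (delta : R -> C),
    Rbar_le a' a -> Rbar_le b b' ->
    is_solution F a' b' delta ->
    (forall t : R, in_interval a b t -> delta t = gamma t) ->
    a' = a /\ b' = b.

Definition flow (F : C -> C) (t : R) (x y : C) : Prop :=
  exists (a b : Rbar) (gamma : R -> C),
    is_maximal_solution F a b gamma /\
    in_interval a b 0 /\ gamma 0 = x /\
    in_interval a b t /\ gamma t = y.

Definition orbit (F : C -> C) (x : C) : C -> Prop :=
  fun y => exists t : R, flow F t x y.

(* Maximal solutions with trace [Gamma] differ by a time translation, so the
   limit sets below do not depend on the parametrization. *)
Definition parametrizes (F : C -> C) (Gamma : C -> Prop)
    (a b : Rbar) (gamma : R -> C) : Prop :=
  is_maximal_solution F a b gamma /\
  forall y : C, Gamma y <-> exists t : R, in_interval a b t /\ gamma t = y.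

Definition is_limit_point (a b e : Rbar) (gamma : R -> C) (p : C) : Prop :=
  exists t : nat -> R,
    (forall n : nat, in_interval a b (t n)) /\
    is_lim_seq t e /\
    filterlim (fun n : nat => gamma (t n)) eventually (locally p).

Definition w_plus (F : C -> C) (Gamma : C -> Prop) : C -> Prop :=
  fun p => exists (a b : Rbar) (gamma : R -> C),
    parametrizes F Gamma a b gamma /\ is_limit_point a b b gamma p.

Definition w_minus (F : C -> C) (Gamma : C -> Prop) : C -> Prop :=
  fun p => exists (a b : Rbar) (gamma : R -> C),
    parametrizes F Gamma a b gamma /\ is_limit_point a b a gamma p.

Definition is_singleton (A : C -> Prop) (p : C) : Prop :=
  forall y : C, A y <-> y = p.

Definition H_plus (F : C -> C) (a_plus : C) : C -> Prop :=
  fun x => is_singleton (w_plus F (orbit F x)) a_plus.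

Definition H_minus (F : C -> C) (a_minus : C) : C -> Prop :=
  fun x => is_singleton (w_minus F (orbit F x)) a_minus.

Definition heteroclinic_region (F : C -> C) (a_plus a_minus : C) : C -> Prop :=
  fun x => H_plus F a_plus x /\ H_minus F a_minus x.

Definition is_orbit (F : C -> C) (Gamma : C -> Prop) : Prop :=
  exists x : C, forall y : C, Gamma y <-> orbit F x y.

Definition heteroclinic_orbit
    (F : C -> C) (a_plus a_minus : C) (Gamma : C -> Prop) : Prop :=
  is_orbit F Gamma /\
  is_singleton (w_plus F Gamma) a_plus /\
  is_singleton (w_minus F Gamma) a_minus.

(* Main.v *)
Require Import Defs.
From Stdlib Require Import Reals Lra Lia Psatz Classical ClassicalEpsilon Ranalysis5.
From Coquelicot Require Import Coquelicot.
Open Scope R_scope.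

(** Why the heteroclinic region is open.

    Let [x] be a point of the region.  An equilibrium is a whole orbit by itself, and the
    two limits differ, so [x] is not an equilibrium.  A curve whose only limit point is [p]
    converges to [p] ([unique_limit_point_converges]), and convergence to an equilibrium
    takes infinite time ([forward_solution]).  Hence the solution through [x] exists for all
    times and tends to [a_plus] forwards and to [a_minus] backwards.  Reversing time
    replaces [F] by [- F], so the task is to show that a solution converging to an
    equilibrium [a], without resting at it, takes all neighbouring solutions along.

    This is seen in the time coordinate, the integral of [dz / F].  Let [m] be the order of
    the zero [a] of [F], which is finite because [F] is not zero, and let [c] be the leading
    coefficient.
    - If [m >= 2], put [V(z) = Re (-1 / ((m - 1) c (z - a) ^ (m - 1)))].  Near [a] the
      derivative of [V] along solutions is close to [1], so a solution that tends to [a]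
      satisfies [V > M] at some time, for any given [M].  For large [M] the set [V > M]
      lies close to [a]; it is open and positively invariant, and [V] tends to infinity
      along every solution in it, which therefore tends to [a].  These sets are the
      attracting petals of the Leau-Fatou flower ([lyapunov_multiple]).
    - If [m = 1] and [Re c < 0], the same holds for [V(z) = - ln |z - a|^2]
      ([lyapunov_sink]).
    - If [m = 1] and [Re c >= 0], only the constant solution converges to [a]: there is a
      holomorphic coordinate linearizing [F], whose modulus does not decrease along
      solutions ([no_convergence_to_source_or_center]).
    Continuous dependence on the initial value then carries a neighbourhood of [x] into the
    petal ([basin], [basin_of_truncation]).  To have solutions that exist for all times
    from the start, [F] is composed with the retraction of the plane onto a large square;
    the truncated field is bounded and Lipschitz, and the solutions under consideration
    never leave the square, where it agrees with [F].

    The order of a zero, the local Lipschitz bound and the linearizing coordinate rest on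
    Cauchy's theory: Goursat's lemma, which gives primitives on squares
    ([is_cderive_square_primitive]), and Cauchy's formula for circles ([cauchy_formula]),
    which represents [F] and its Taylor remainders as integrals over the circle. *)

(** * Continuity and differentiability in the complex plane *)

Ltac as_C := match goal with |- @eq _ ?a ?b => change (@eq C a b) end.

Lemma Cmod_minus_sym (z w : C) : Cmod (z - w) = Cmod (w - z).
Proof. rewrite <- Cmod_opp; f_equal; ring. Qed.

Lemma Cminus_0_r (z : C) : (z - RtoC 0)%C = z.
Proof. ring. Qed.

Lemma Cmod_triangle_minus (z w : C) : Cmod z - Cmod w <= Cmod (z - w).
Proof.
  pose proof (Cmod_triangle (z - w) w) as H.
  replace (z - w + w)%C with z in H by ring; lra.
Qed.

Lemma Cmod_le_Rabs (z : C) : Cmod z <= Rabs (fst z) + Rabs (snd z).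
Proof.
  replace z with (RtoC (fst z) + Ci * RtoC (snd z))%C at 1
    by (destruct z; unfold RtoC, Ci, Cplus, Cmult; simpl; f_equal; ring).
  eapply Rle_trans; [apply Cmod_triangle|].
  rewrite Cmod_mult, Cmod_Ci, !Cmod_R; lra.
Qed.

Lemma Rabs_fst_le_Cmod (z : C) : Rabs (fst z) <= Cmod z.
Proof. eapply Rle_trans; [apply Rmax_l|apply Rmax_Cmod]. Qed.

Lemma Rabs_snd_le_Cmod (z : C) : Rabs (snd z) <= Cmod z.
Proof. eapply Rle_trans; [apply Rmax_r|apply Rmax_Cmod]. Qed.

Lemma Cmod_sqr (z : C) : Cmod z * Cmod z = fst z * fst z + snd z * snd z.
Proof.
  unfold Cmod; rewrite sqrt_sqrt; [ring|].
  nra.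
Qed.

Lemma norm_C_R (z : C) : norm (V := C_R_NormedModule) z = Cmod z.
Proof.
  unfold norm; simpl; unfold prod_norm, Cmod, norm; simpl; unfold abs; simpl.
  f_equal; rewrite !Rmult_1_r, <- !Rabs_mult, !Rabs_pos_eq; nra.
Qed.

(** The product balls of the uniform structure on [C] and the discs of [Cmod]
    define the same neighbourhoods; everything below is phrased with discs. *)
Lemma locally_disc (z : C) (P : C -> Prop) :
  locally (T := C_UniformSpace) z P <->
  exists d, 0 < d /\ forall w, Cmod (w - z) < d -> P w.
Proof.
  split.
  - intros [[d Hd] H]; exists d; split; [exact Hd|].
    intros w Hw; apply H; split; simpl; unfold AbsRing_ball, abs, minus, plus, opp; simpl.
    + eapply Rle_lt_trans; [|exact Hw]; apply (Rabs_fst_le_Cmod (w - z)).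
    + eapply Rle_lt_trans; [|exact Hw]; apply (Rabs_snd_le_Cmod (w - z)).
  - intros [d [Hd H]].
    assert (Hd2 : 0 < d / 2) by lra.
    exists (mkposreal _ Hd2); intros w [H1 H2]; apply H.
    eapply Rle_lt_trans; [apply Cmod_le_Rabs|].
    replace d with (d / 2 + d / 2) by field.
    apply Rplus_lt_compat; [exact H1|exact H2].
Qed.

Lemma locally_R (t : R) (P : R -> Prop) :
  locally t P <-> exists d, 0 < d /\ forall s, Rabs (s - t) < d -> P s.
Proof.
  split.
  - intros [[d Hd] H]; exists d; split; [exact Hd|]; intros s Hs; apply H; exact Hs.
  - intros [d [Hd H]]; exists (mkposreal _ Hd); intros s Hs; apply H; exact Hs.
Qed.

(* Continuity is stated for maps from any uniform space, to serve both for functions of a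
   complex variable and for curves. *)
Section ContinuityInC.
Context {U : UniformSpace}.
Implicit Types (f g : U -> C) (x : U).

Lemma filterlim_Cmod {T : Type} (F : (T -> Prop) -> Prop) {FF : Filter F}
    (f : T -> C) (l : C) :
  filterlim f F (locally (T := C_UniformSpace) l) <->
  forall e, 0 < e -> F (fun y => Cmod (f y - l) < e).
Proof.
  split.
  - intros H e He; apply (H (fun w => Cmod (w - l) < e)).
    apply locally_disc; exists e; split; auto.
  - intros H P HP; apply locally_disc in HP; destruct HP as [d [Hd HP]].
    unfold filtermap; generalize (H d Hd); apply filter_imp; auto.
Qed.

Lemma continuous_Cmod f x :
  continuous (U := C_UniformSpace) f x <->
  forall e, 0 < e -> locally x (fun y => Cmod (f y - f x) < e).
Proof. apply filterlim_Cmod; typeclasses eauto. Qed.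

Lemma continuous_Cpair (f1 f2 : U -> R) x :
  continuous f1 x -> continuous f2 x ->
  continuous (U := C_UniformSpace) (fun y => (f1 y, f2 y) : C) x.
Proof.
  intros H1 H2; apply continuous_Cmod; intros e He.
  assert (He2 : 0 < e / 2) by lra.
  generalize (filter_and _ _
    (proj1 (filterlim_locally _ _) H1 (mkposreal _ He2))
    (proj1 (filterlim_locally _ _) H2 (mkposreal _ He2))).
  apply filter_imp; intros y [A B].
  eapply Rle_lt_trans; [apply Cmod_le_Rabs|]; 
  replace e with (e / 2 + e / 2) by field.
  apply Rplus_lt_compat; [exact A|exact B].
Qed.

Lemma continuous_Cfst f x :
  continuous (U := C_UniformSpace) f x -> continuous (fun y => fst (f y)) x.
Proof.
  intros H; apply filterlim_locally; intros [e He].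
  generalize (proj1 (continuous_Cmod f x) H e He); apply filter_imp; intros y Hy.
  eapply Rle_lt_trans; [apply (Rabs_fst_le_Cmod (f y - f x))|exact Hy].
Qed.

Lemma continuous_Csnd f x :
  continuous (U := C_UniformSpace) f x -> continuous (fun y => snd (f y)) x.
Proof.
  intros H; apply filterlim_locally; intros [e He].
  generalize (proj1 (continuous_Cmod f x) H e He); apply filter_imp; intros y Hy.
  eapply Rle_lt_trans; [apply (Rabs_snd_le_Cmod (f y - f x))|exact Hy].
Qed.

Lemma continuous_Cplus f g x :
  continuous (U := C_UniformSpace) f x -> continuous (U := C_UniformSpace) g x ->
  continuous (U := C_UniformSpace) (fun y => (f y + g y)%C) x.
Proof.
  intros Hf Hg; apply continuous_Cpair.
  - apply (continuous_plus (V := R_NormedModule)); apply continuous_Cfst; assumption.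
  - apply (continuous_plus (V := R_NormedModule)); apply continuous_Csnd; assumption.
Qed.

Lemma continuous_Copp f x :
  continuous (U := C_UniformSpace) f x ->
  continuous (U := C_UniformSpace) (fun y => (- f y)%C) x.
Proof.
  intros Hf; apply continuous_Cpair.
  - apply (continuous_opp (V := R_NormedModule)); apply continuous_Cfst; assumption.
  - apply (continuous_opp (V := R_NormedModule)); apply continuous_Csnd; assumption.
Qed.

Lemma continuous_Cminus f g x :
  continuous (U := C_UniformSpace) f x -> continuous (U := C_UniformSpace) g x ->
  continuous (U := C_UniformSpace) (fun y => (f y - g y)%C) x.
Proof. intros Hf Hg; apply continuous_Cplus; [exact Hf|apply continuous_Copp, Hg]. Qed.

Lemma continuous_Cmult f g x :
  continuous (U := C_UniformSpace) f x -> continuous (U := C_UniformSpace) g x ->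
  continuous (U := C_UniformSpace) (fun y => (f y * g y)%C) x.
Proof.
  intros Hf Hg; apply continuous_Cpair.
  - apply (continuous_minus (V := R_NormedModule));
      apply (continuous_mult (K := R_AbsRing));
      first [apply continuous_Cfst; assumption|apply continuous_Csnd; assumption].
  - apply (continuous_plus (V := R_NormedModule));
      apply (continuous_mult (K := R_AbsRing));
      first [apply continuous_Cfst; assumption|apply continuous_Csnd; assumption].
Qed.

Lemma continuous_Cinv f x :
  continuous (U := C_UniformSpace) f x -> f x <> (RtoC 0) ->
  continuous (U := C_UniformSpace) (fun y => (/ f y)%C) x.
Proof.
  intros Hf Hn.
  assert (Hsq : continuous (fun y => fst (f y) ^ 2 + snd (f y) ^ 2) x).
  { simpl; apply (continuous_plus (V := R_NormedModule));
      (apply (continuous_mult (K := R_AbsRing));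
       [|apply (continuous_mult (K := R_AbsRing)); [|apply continuous_const]]);
      first [apply continuous_Cfst; assumption|apply continuous_Csnd; assumption]. }
  assert (Hp : fst (f x) ^ 2 + snd (f x) ^ 2 <> 0).
  { intros E; apply Hn; apply Cmod_eq_0; unfold Cmod; rewrite E; apply sqrt_0. }
  assert (Hi : continuous (fun y => / (fst (f y) ^ 2 + snd (f y) ^ 2)) x).
  { apply (continuous_comp _ Rinv); [exact Hsq|apply continuous_Rinv, Hp]. }
  apply continuous_Cpair.
  - apply (continuous_mult (K := R_AbsRing)); [apply continuous_Cfst; assumption|exact Hi].
  - apply (continuous_mult (K := R_AbsRing)); [|exact Hi].
    apply (continuous_opp (V := R_NormedModule)), continuous_Csnd; assumption.
Qed.

Lemma continuous_Cdiv f g x :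
  continuous (U := C_UniformSpace) f x -> continuous (U := C_UniformSpace) g x ->
  g x <> (RtoC 0) ->
  continuous (U := C_UniformSpace) (fun y => (f y / g y)%C) x.
Proof. intros; apply continuous_Cmult; [|apply continuous_Cinv]; assumption. Qed.

Lemma continuous_Cpow f x n :
  continuous (U := C_UniformSpace) f x ->
  continuous (U := C_UniformSpace) (fun y => (f y ^ n)%C) x.
Proof.
  intros Hf; induction n as [|n IH]; simpl; [apply continuous_const|].
  apply continuous_Cmult; assumption.
Qed.

Lemma continuous_Cmod_comp f x :
  continuous (U := C_UniformSpace) f x -> continuous (fun y => Cmod (f y)) x.
Proof.
  intros H; apply filterlim_locally; intros [e He].
  generalize (proj1 (continuous_Cmod f x) H e He); apply filter_imp; intros y Hy.
  unfold ball; simpl; unfold AbsRing_ball, abs, minus, plus, opp; simpl.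
  pose proof (Cmod_triangle_minus (f y) (f x)).
  pose proof (Cmod_triangle_minus (f x) (f y)).
  rewrite (Cmod_minus_sym (f x)) in *.
  apply Rabs_def1; lra.
Qed.

Lemma continuous_RtoC (f : U -> R) x :
  continuous f x -> continuous (U := C_UniformSpace) (fun y => RtoC (f y)) x.
Proof. intros; apply continuous_Cpair; [assumption|apply continuous_const]. Qed.

Lemma continuous_neq0 f x :
  continuous (U := C_UniformSpace) f x -> f x <> (RtoC 0) ->
  locally x (fun y => f y <> (RtoC 0)).
Proof.
  intros H Hn; assert (Hp : 0 < Cmod (f x)) by (apply Cmod_gt_0; exact Hn).
  generalize (proj1 (continuous_Cmod f x) H _ Hp); apply filter_imp.
  intros y Hy E; rewrite E in Hy.
  replace (0 - f x)%C with (- f x)%C in Hy by ring.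
  rewrite Cmod_opp in Hy; lra.
Qed.

End ContinuityInC.

(** Carathéodory's form of complex differentiability: products, quotients and
    compositions reduce to algebra and to continuity at a single point.  The identity is
    required for all [w], so [q] is the difference quotient off [z]. *)
Definition is_cderive (f : C -> C) (z d : C) : Prop :=
  exists q : C -> C,
    continuous (T := C_UniformSpace) (U := C_UniformSpace) q z /\ q z = d /\
    forall w, (f w - f z = q w * (w - z))%C.

Definition is_curve_derive (g : R -> C) (t : R) (v : C) : Prop :=
  is_derive (K := R_AbsRing) (V := C_R_NormedModule) g t v.

Lemma is_cderive_of_estimate (f : C -> C) (z d : C) :
  (forall e, 0 < e ->
     locally (T := C_UniformSpace) z
       (fun w => Cmod (f w - f z - d * (w - z)) <= e * Cmod (w - z))) ->
  is_cderive f z d.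
Proof.
  intros H.
  exists (fun w => if Ceq_dec w z then d else ((f w - f z) / (w - z))%C).
  split; [|split].
  - apply continuous_Cmod; intros e He.
    generalize (H (e / 2) ltac:(lra)); apply filter_imp; intros w Hw.
    destruct (Ceq_dec z z) as [_|N]; [|now elim N].
    destruct (Ceq_dec w z) as [->|N].
    + replace (d - d)%C with (RtoC 0) by ring; rewrite Cmod_0; exact He.
    + assert (N' : (w - z)%C <> (RtoC 0)) by (apply Cminus_eq_contra; exact N).
      assert (Hp : 0 < Cmod (w - z)) by (apply Cmod_gt_0; exact N').
      replace ((f w - f z) / (w - z) - d)%C
        with ((f w - f z - d * (w - z)) / (w - z))%C by (field; exact N').
      rewrite Cmod_div by exact N'.
      apply Rle_lt_trans with (e / 2); [|lra].
      apply Rmult_le_reg_r with (Cmod (w - z)); [exact Hp|].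
      unfold Rdiv at 1; rewrite Rmult_assoc, Rinv_l by lra; lra.
  - destruct (Ceq_dec z z) as [_|N]; [reflexivity|now elim N].
  - intros w; destruct (Ceq_dec w z) as [->|N]; [ring|].
    field; apply Cminus_eq_contra; exact N.
Qed.

Lemma is_cderive_of_is_derive (f : C -> C) (z d : C) :
  is_derive (K := C_AbsRing) (V := C_NormedModule) f z d -> is_cderive f z d.
Proof.
  intros [_ H]; apply is_cderive_of_estimate; intros e He.
  specialize (H z (fun P HP => HP) (mkposreal _ He)).
  apply locally_C in H.
  revert H; apply filter_imp; intros w Hw.
  unfold norm, minus, plus, opp, scal in Hw; simpl in Hw.
  unfold abs, mult in Hw; simpl in Hw.
  replace (f w - f z - d * (w - z))%C
    with (f w + - f z + - ((w + - z) * d))%C by ring.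
  exact Hw.
Qed.

Lemma is_cderive_continuous (f : C -> C) (z d : C) :
  is_cderive f z d -> continuous (T := C_UniformSpace) (U := C_UniformSpace) f z.
Proof.
  intros [q [Hq [_ E]]].
  apply (continuous_ext (fun w => q w * (w - z) + f z)%C).
  { intros w; as_C; rewrite <- E; ring. }
  apply continuous_Cplus; [apply continuous_Cmult; [exact Hq|]|apply continuous_const].
  apply continuous_Cminus; [apply continuous_id|apply continuous_const].
Qed.

Lemma is_cderive_const (c z : C) : is_cderive (fun _ => c) z (RtoC 0).
Proof.
  exists (fun _ => (RtoC 0)); split; [apply continuous_const|split; [reflexivity|intros w; ring]].
Qed.

Lemma is_cderive_id (z : C) : is_cderive (fun w => w) z (RtoC 1).
Proof.
  exists (fun _ => (RtoC 1)); split; [apply continuous_const|split; [reflexivity|intros w; ring]].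
Qed.

Lemma is_cderive_plus (f g : C -> C) (z d e : C) :
  is_cderive f z d -> is_cderive g z e ->
  is_cderive (fun w => f w + g w)%C z (d + e)%C.
Proof.
  intros [p [Hp [<- Ep]]] [q [Hq [<- Eq]]].
  exists (fun w => p w + q w)%C; split; [apply continuous_Cplus; assumption|].
  split; [reflexivity|]; intros w.
  replace (f w + g w - (f z + g z))%C with ((f w - f z) + (g w - g z))%C by ring.
  rewrite Ep, Eq; ring.
Qed.

Lemma is_cderive_mult (f g : C -> C) (z d e : C) :
  is_cderive f z d -> is_cderive g z e ->
  is_cderive (fun w => f w * g w)%C z (d * g z + f z * e)%C.
Proof.
  intros Hf Hg; assert (Cg := is_cderive_continuous _ _ _ Hg).
  destruct Hf as [p [Hp [<- Ep]]], Hg as [q [Hq [<- Eq]]].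
  exists (fun w => p w * g w + f z * q w)%C; split.
  { apply continuous_Cplus; apply continuous_Cmult; try assumption; apply continuous_const. }
  split; [reflexivity|]; intros w.
  replace (f w * g w - f z * g z)%C with ((f w - f z) * g w + f z * (g w - g z))%C by ring.
  rewrite Ep, Eq; ring.
Qed.

Lemma is_cderive_comp (f g : C -> C) (z d e : C) :
  is_cderive f (g z) d -> is_cderive g z e ->
  is_cderive (fun w => f (g w)) z (d * e)%C.
Proof.
  intros Hf Hg; assert (Cg := is_cderive_continuous _ _ _ Hg).
  destruct Hf as [p [Hp [<- Ep]]], Hg as [q [Hq [<- Eq]]].
  exists (fun w => p (g w) * q w)%C; split.
  { apply continuous_Cmult; [|assumption]. apply (continuous_comp g p); assumption. }
  split; [reflexivity|]; intros w; rewrite Ep, Eq; ring.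
Qed.

Lemma is_cderive_ext_loc (f g : C -> C) (z d : C) :
  locally (T := C_UniformSpace) z (fun w => f w = g w) ->
  is_cderive f z d -> is_cderive g z d.
Proof.
  intros L [q [Hq [<- E]]]; apply is_cderive_of_estimate; intros e He.
  generalize (filter_and _ _ L (proj1 (continuous_Cmod q z) Hq e He)).
  assert (Ez : f z = g z) by (apply (locally_singleton (T := C_UniformSpace)) in L; exact L).
  apply filter_imp; intros w [Ew Hw]; rewrite <- Ew, <- Ez, E.
  replace (q w * (w - z) - q z * (w - z))%C with ((q w - q z) * (w - z))%C by ring.
  rewrite Cmod_mult; apply Rmult_le_compat_r; [apply Cmod_ge_0|lra].
Qed.

Lemma is_cderive_inv (z : C) : z <> (RtoC 0) -> is_cderive Cinv z (- / (z * z))%C.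
Proof.
  intros Hz.
  apply (is_cderive_ext_loc (fun w => if Ceq_dec w (RtoC 0) then (RtoC 0) else / w)%C).
  { apply locally_disc; exists (Cmod z); split; [apply Cmod_gt_0; exact Hz|].
    intros w Hw; destruct (Ceq_dec w (RtoC 0)) as [->|N]; [|reflexivity].
    replace (0 - z)%C with (- z)%C in Hw by ring; rewrite Cmod_opp in Hw; lra. }
  exists (fun w => if Ceq_dec w (RtoC 0) then (/ (z * z))%C else - / (w * z))%C.
  split; [|split].
  - apply continuous_ext_loc with (fun w => - / (w * z))%C.
    { apply (filter_imp (fun w : C => w <> (RtoC 0))).
      - intros w N; destruct (Ceq_dec w (RtoC 0)); [contradiction|reflexivity].
      - apply (continuous_neq0 (fun w => w)); [apply continuous_id|exact Hz]. }
    apply continuous_Copp, continuous_Cinv.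
    + apply continuous_Cmult; [apply continuous_id|apply continuous_const].
    + apply Cmult_neq_0; exact Hz.
  - destruct (Ceq_dec z (RtoC 0)); [contradiction|reflexivity].
  - intros w; destruct (Ceq_dec z (RtoC 0)); [contradiction|].
    destruct (Ceq_dec w (RtoC 0)) as [->|N]; field; auto.
Qed.

Lemma is_cderive_pow (z : C) n : is_cderive (fun w => w ^ S n)%C z (RtoC (INR (S n)) * z ^ n)%C.
Proof.
  induction n as [|n IH].
  - simpl. replace (1 * 1)%C with (1 * 1 + z * 0)%C by ring.
    apply (is_cderive_mult (fun w => w) (fun _ => (RtoC 1)));
      [apply is_cderive_id|apply is_cderive_const].
  - rewrite S_INR, RtoC_plus.
    replace ((RtoC (INR (S n)) + 1) * z ^ S n)%C
      with (1 * z ^ S n + z * (RtoC (INR (S n)) * z ^ n))%C by (rewrite Cpow_S; ring).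
    apply (is_cderive_mult (fun w => w) (fun w => w ^ S n)%C); [apply is_cderive_id|exact IH].
Qed.

(** * Curves in the plane *)

Lemma is_curve_derive_caratheodory (g : R -> C) (t : R) (v : C) :
  is_curve_derive g t v <->
  exists q : R -> C,
    continuous (U := C_UniformSpace) q t /\ q t = v /\
    forall s, (g s - g t = q s * RtoC (s - t))%C.
Proof.
  split.
  - intros [_ H].
    exists (fun s => if Req_EM_T s t then v else ((g s - g t) / RtoC (s - t))%C).
    split; [|split].
    + apply continuous_Cmod; intros e He.
      assert (He2 : 0 < e / 2) by lra.
      specialize (H t (fun P HP => HP) (mkposreal _ He2)).
      revert H; apply filter_imp; intros s Hs.
      destruct (Req_EM_T t t) as [_|N]; [|now elim N].
      destruct (Req_EM_T s t) as [->|N].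
      * replace (v - v)%C with (RtoC 0) by ring; rewrite Cmod_0; exact He.
      * assert (N' : RtoC (s - t) <> (RtoC 0))
          by (intros E; apply RtoC_inj in E; lra).
        assert (Hp : 0 < Cmod (RtoC (s - t))) by (apply Cmod_gt_0; exact N').
        replace ((g s - g t) / RtoC (s - t) - v)%C
          with ((g s - g t - RtoC (s - t) * v) / RtoC (s - t))%C by (field; exact N').
        rewrite Cmod_div by exact N'.
        apply Rle_lt_trans with (e / 2); [|lra].
        apply Rmult_le_reg_r with (Cmod (RtoC (s - t))); [exact Hp|].
        unfold Rdiv at 1; rewrite Rmult_assoc, Rinv_l by lra; rewrite Rmult_1_r.
        rewrite norm_C_R in Hs; rewrite Cmod_R.
        replace (g s - g t - RtoC (s - t) * v)%C with
         (minus (G := C_R_NormedModule) (minus (G := C_R_NormedModule) (g s) (g t))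
           (scal (V := C_R_NormedModule) (minus s t) v)); [exact Hs|].
        rewrite scal_R_Cmult; reflexivity.
    + destruct (Req_EM_T t t) as [_|N]; [reflexivity|now elim N].
    + intros s; destruct (Req_EM_T s t) as [->|N].
      * rewrite Rminus_diag; ring.
      * field; intros E; apply RtoC_inj in E; lra.
  - intros [q [Hq [<- E]]]; split; [apply is_linear_scal_l|].
    intros x Hx [e He].
    assert (Ex : t = x) by (apply (is_filter_lim_locally_unique (K:=R_AbsRing) (V:=R_NormedModule)); exact Hx).
    subst x.
    generalize (proj1 (continuous_Cmod q t) Hq e He); apply filter_imp; intros s Hs.
    rewrite norm_C_R; simpl pos.
    match goal with |- Cmod ?X <= _ =>
      assert (EX : X = ((q s - q t) * RtoC (s - t))%C) end.
    + rewrite scal_R_Cmult; change (minus s t) with (s - t).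
      transitivity ((g s - g t) - RtoC (s - t) * q t)%C; [reflexivity|as_C; rewrite E; ring].
    + rewrite EX, Cmod_mult, Cmod_R.
      apply Rmult_le_compat_r; [apply Rabs_pos|lra].
Qed.

Lemma is_curve_derive_continuous (g : R -> C) t v :
  is_curve_derive g t v -> continuous (U := C_UniformSpace) g t.
Proof.
  intros H; apply is_curve_derive_caratheodory in H; destruct H as [q [Hq [_ E]]].
  apply (continuous_ext (fun s => q s * RtoC (s - t) + g t)%C).
  { intros s; as_C; rewrite <- E; ring. }
  apply continuous_Cplus; [|apply continuous_const].
  apply continuous_Cmult; [exact Hq|apply continuous_RtoC].
  apply (continuous_minus (V := R_NormedModule)); [apply continuous_id|apply continuous_const].
Qed.

Lemma is_curve_derive_comp (f : C -> C) (g : R -> C) t d v :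
  is_cderive f (g t) d -> is_curve_derive g t v ->
  is_curve_derive (fun s => f (g s)) t (d * v)%C.
Proof.
  intros Hf Hg; assert (Cg := is_curve_derive_continuous _ _ _ Hg).
  apply is_curve_derive_caratheodory in Hg; apply is_curve_derive_caratheodory.
  destruct Hf as [p [Hp [<- Ep]]], Hg as [q [Hq [<- Eq]]].
  exists (fun s => p (g s) * q s)%C; split.
  { apply continuous_Cmult; [|assumption]. apply (continuous_comp g p); assumption. }
  split; [reflexivity|]; intros s; rewrite Ep, Eq; ring.
Qed.

Lemma is_derive_caratheodory (f : R -> R) (t l : R) :
  (exists q : R -> R, continuous q t /\ q t = l /\ forall s, f s - f t = q s * (s - t)) ->
  is_derive f t l.
Proof.
  intros [q [Hq [<- E]]]; split; [apply is_linear_scal_l|].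
  intros x Hx [e He].
  assert (Ex : t = x) by (apply (is_filter_lim_locally_unique (K:=R_AbsRing) (V:=R_NormedModule)); exact Hx).
  subst x.
  generalize (proj1 (filterlim_locally _ _) Hq (mkposreal _ He)); apply filter_imp; intros s Hs.
  unfold norm; simpl; unfold abs, minus, plus, opp, scal; simpl; unfold mult; simpl.
  replace (f s + - f t + - ((s + - t) * q t)) with ((q s - q t) * (s - t))
    by (replace (f s + - f t) with (q s * (s - t)) by (rewrite <- E; ring); ring).
  rewrite Rabs_mult; apply Rmult_le_compat_r; [apply Rabs_pos|].
  apply Rlt_le; exact Hs.
Qed.

Lemma is_curve_derive_fst (g : R -> C) t v :
  is_curve_derive g t v -> is_derive (fun s => fst (g s)) t (fst v).
Proof.
  intros H; apply is_curve_derive_caratheodory in H; destruct H as [q [Hq [<- E]]].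
  apply is_derive_caratheodory; exists (fun s => fst (q s)); split;
    [apply continuous_Cfst, Hq|split; [reflexivity|]].
  intros s; specialize (E s); apply (f_equal fst) in E; simpl in E.
  unfold Rminus; rewrite E; ring.
Qed.

Lemma is_curve_derive_snd (g : R -> C) t v :
  is_curve_derive g t v -> is_derive (fun s => snd (g s)) t (snd v).
Proof.
  intros H; apply is_curve_derive_caratheodory in H; destruct H as [q [Hq [<- E]]].
  apply is_derive_caratheodory; exists (fun s => snd (q s)); split;
    [apply continuous_Csnd, Hq|split; [reflexivity|]].
  intros s; specialize (E s); apply (f_equal snd) in E; simpl in E.
  unfold Rminus; rewrite E; ring.
Qed.

Lemma is_curve_derive_affine (g : R -> C) (a c t : R) v :
  is_curve_derive g (a + c * t) v ->
  is_curve_derive (fun s => g (a + c * s)) t (RtoC c * v)%C.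
Proof.
  intros H; apply is_curve_derive_caratheodory in H; apply is_curve_derive_caratheodory.
  destruct H as [q [Hq [<- E]]].
  exists (fun s => RtoC c * q (a + c * s)%R)%C; split; [|split; [reflexivity|]].
  - apply continuous_Cmult; [apply continuous_const|].
    apply (continuous_comp (fun s => a + c * s) q); [|exact Hq].
    apply (continuous_plus (V := R_NormedModule)); [apply continuous_const|].
    apply (continuous_mult (K := R_AbsRing)); [apply continuous_const|apply continuous_id].
  - intros s; rewrite E.
    replace (a + c * s - (a + c * t)) with (c * (s - t)) by ring.
    rewrite RtoC_mult; ring.
Qed.

Lemma is_curve_derive_line (z v : C) (t : R) :
  is_curve_derive (fun s => (z + RtoC s * v)%C) t v.
Proof.
  apply is_curve_derive_caratheodory; exists (fun _ => v).
  split; [apply continuous_const|split; [reflexivity|]].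
  intros s; rewrite RtoC_minus; ring.
Qed.

(** * Integrals of complex-valued functions *)

Definition CInt (g : R -> C) (a b : R) : C :=
  RInt (V := C_R_CompleteNormedModule) g a b.

Definition curve_continuous (g : R -> C) : Prop :=
  forall t, continuous (T := R_UniformSpace) (U := C_UniformSpace) g t.

Definition C_continuous (f : C -> C) : Prop :=
  forall z, continuous (T := C_UniformSpace) (U := C_UniformSpace) f z.

Section CInt.

Lemma ex_CInt g a b :
  curve_continuous g -> ex_RInt (V := C_R_CompleteNormedModule) g a b.
Proof. intros H; apply ex_RInt_continuous; intros t _; apply H. Qed.

Lemma CInt_point g a : CInt g a a = RtoC 0.
Proof. exact (RInt_point (V := C_R_CompleteNormedModule) a g). Qed.

Lemma CInt_ext g h a b : (forall t, g t = h t) -> CInt g a b = CInt h a b.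
Proof. intros H; apply (RInt_ext (V := C_R_CompleteNormedModule)); intros; apply H. Qed.

Lemma CInt_Chasles g a b c :
  curve_continuous g -> (CInt g a b + CInt g b c)%C = CInt g a c.
Proof.
  intros H; apply (RInt_Chasles (V := C_R_CompleteNormedModule) g a b c);
    apply ex_CInt, H.
Qed.


Lemma CInt_plus g h a b : curve_continuous g -> curve_continuous h ->
  CInt (fun t => g t + h t)%C a b = (CInt g a b + CInt h a b)%C.
Proof.
  intros Hg Hh; apply (RInt_plus (V := C_R_CompleteNormedModule) g h);
    apply ex_CInt; assumption.
Qed.

Lemma CInt_derive G g a b :
  (forall t, is_curve_derive G t (g t)) -> curve_continuous g ->
  CInt g a b = (G b - G a)%C.
Proof.
  intros H Hg; apply (is_RInt_unique (V := C_R_CompleteNormedModule)).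
  apply (is_RInt_derive (V := C_R_CompleteNormedModule) G g); intros t _;
    [apply H|apply Hg].
Qed.

Lemma CInt_primitive g a t :
  curve_continuous g -> is_curve_derive (fun s => CInt g a s) t (g t).
Proof.
  intros H; apply (is_derive_RInt (V := C_R_CompleteNormedModule) g _ a).
  - apply filter_forall; intros s.
    apply (RInt_correct (V := C_R_CompleteNormedModule)), ex_CInt, H.
  - apply H.
Qed.

(** Both sides have the same derivative as functions of the upper bound. *)
Lemma CInt_scal c g a b : curve_continuous g ->
  CInt (fun t => c * g t)%C a b = (c * CInt g a b)%C.
Proof.
  intros H; rewrite (CInt_derive (fun s => c * CInt g a s)%C).
  - rewrite CInt_point; ring.
  - intros t; apply (is_curve_derive_comp (fun z => c * z)%C (fun s => CInt g a s)).
    + exists (fun _ => c); split; [apply continuous_const|split; [reflexivity|]].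
      intros w; ring.
    + apply CInt_primitive, H.
  - intros t; apply continuous_Cmult; [apply continuous_const|apply H].
Qed.

Lemma CInt_minus g h a b : curve_continuous g -> curve_continuous h ->
  CInt (fun t => g t - h t)%C a b = (CInt g a b - CInt h a b)%C.
Proof.
  intros Hg Hh.
  rewrite (CInt_ext _ (fun t => g t + (- (1)) * h t)%C) by (intros; ring).
  rewrite CInt_plus, CInt_scal; [ring|assumption|assumption|].
  intros t; apply continuous_Cmult; [apply continuous_const|apply Hh].
Qed.

Lemma CInt_const c a b : CInt (fun _ => c) a b = (RtoC (b - a) * c)%C.
Proof.
  etransitivity; [exact (RInt_const (V := C_R_CompleteNormedModule) a b c)|].
  apply scal_R_Cmult.
Qed.

Lemma Cmod_CInt_le g a b M : curve_continuous g ->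
  (forall t, Rmin a b <= t <= Rmax a b -> Cmod (g t) <= M) ->
  Cmod (CInt g a b) <= M * Rabs (b - a).
Proof.
  intros Hg.
  assert (main : forall a b, a <= b -> (forall t, a <= t <= b -> Cmod (g t) <= M) ->
     Cmod (CInt g a b) <= M * Rabs (b - a)).
  { clear a b; intros a b ab H.
    rewrite <- norm_C_R, Rabs_pos_eq, Rmult_comm by lra.
    apply (norm_RInt_le_const (V := C_R_NormedModule) g a b); [exact ab| |].
    - intros t Ht; rewrite norm_C_R; apply H, Ht.
    - apply (RInt_correct (V := C_R_CompleteNormedModule)), ex_CInt, Hg. }
  destruct (Rle_dec a b) as [ab|ab].
  - rewrite Rmin_left, Rmax_right by lra; apply main, ab.
  - rewrite Rmin_right, Rmax_left by lra; intros H.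
    replace (CInt g a b) with (- CInt g b a)%C.
    + rewrite Cmod_opp, Rabs_minus_sym; apply main; [lra|exact H].
    + pose proof (CInt_Chasles g a b a Hg) as E; rewrite CInt_point in E.
      replace (CInt g a b) with (CInt g a b + CInt g b a - CInt g b a)%C by ring.
      rewrite E; ring.
Qed.

End CInt.

(** * Subdivision of the unit square *)

(** Cousin's principle: a property of squares that passes from the four quarters to
    the whole, and holds for all small squares around any given point, holds for
    the unit square: otherwise nested bad quarters would shrink to a point. *)
Lemma cousin_square (P : R -> R -> R -> Prop) :
  (forall u v s, P u v (s / 2) -> P (u + s / 2) v (s / 2) ->
     P u (v + s / 2) (s / 2) -> P (u + s / 2) (v + s / 2) (s / 2) -> P u v s) ->
  (forall p q, 0 <= p <= 1 -> 0 <= q <= 1 -> exists d, 0 < d /\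
     forall u v s, u <= p <= u + s -> v <= q <= v + s -> 0 < s < d ->
       0 <= u -> u + s <= 1 -> 0 <= v -> v + s <= 1 -> P u v s) ->
  P 0 0 1.
Proof.
  intros Hquarter Hlocal; apply NNPP; intros Hbad.
  pose (sq := fun (x : R * R) (n : nat) => P (fst x) (snd x) ((/ 2) ^ n)).
  assert (step : forall n x, exists y : R * R, ~ sq x n ->
     ~ sq y (S n) /\ fst x <= fst y <= fst x + (/ 2) ^ S n /\
     snd x <= snd y <= snd x + (/ 2) ^ S n).
  { intros n x.
    assert (Hs : (/ 2) ^ n / 2 = (/ 2) ^ S n) by (simpl; field).
    assert (Hp : 0 < (/ 2) ^ S n) by (apply pow_lt; lra).
    destruct (classic (exists y : R * R, ~ sq y (S n) /\
      fst x <= fst y <= fst x + (/ 2) ^ S n /\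
      snd x <= snd y <= snd x + (/ 2) ^ S n)) as [[y Hy]|N].
    - exists y; intros _; exact Hy.
    - exists x; intros H; exfalso; apply H; apply Hquarter; rewrite Hs.
      + apply NNPP; intros B; apply N.
        exists (fst x, snd x); repeat split; simpl; try exact B; simpl in *; lra.
      + apply NNPP; intros B; apply N.
        exists (fst x + (/ 2) ^ S n, snd x); repeat split; simpl; try exact B; simpl in *; lra.
      + apply NNPP; intros B; apply N.
        exists (fst x, snd x + (/ 2) ^ S n); repeat split; simpl; try exact B; simpl in *; lra.
      + apply NNPP; intros B; apply N.
        exists (fst x + (/ 2) ^ S n, snd x + (/ 2) ^ S n);
          repeat split; simpl; try exact B; simpl in *; lra. }
  pose (next := fun n x => proj1_sig (constructive_indefinite_description _ (step n x))).
  pose (z := fix z n := match n with O => (0, 0) | S k => next k (z k) end).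
  assert (Hz : forall n, ~ sq (z n) n /\
     (fst (z n) <= fst (z (S n)) <= fst (z n) + (/ 2) ^ S n /\
      snd (z n) <= snd (z (S n)) <= snd (z n) + (/ 2) ^ S n)).
  { assert (K : forall n, ~ sq (z n) n ->
      ~ sq (z (S n)) (S n) /\ fst (z n) <= fst (z (S n)) <= fst (z n) + (/ 2) ^ S n /\
      snd (z n) <= snd (z (S n)) <= snd (z n) + (/ 2) ^ S n).
    { intros n; exact (proj2_sig (constructive_indefinite_description _ (step n (z n)))). }
    assert (K0 : forall n, ~ sq (z n) n).
    { induction n as [|n IH]; [exact Hbad|apply K, IH]. }
    intros n; split; [apply K0|apply K, K0]. }
  assert (lim : forall a : nat -> R, a 0%nat = 0 ->
      (forall n, a n <= a (S n) <= a n + (/ 2) ^ S n) ->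
      exists p, 0 <= p <= 1 /\ (forall n, a n <= p <= a n + (/ 2) ^ n) /\
        (forall n, 0 <= a n /\ a n + (/ 2) ^ n <= 1)).
  { intros a a0 Ha.
    assert (up : forall n k, a n <= a (n + k)%nat).
    { intros n; induction k as [|k IH]; [rewrite Nat.add_0_r; lra|].
      rewrite Nat.add_succ_r; specialize (Ha (n + k)%nat); lra. }
    assert (down : forall n k, a (n + k)%nat + (/ 2) ^ (n + k) <= a n + (/ 2) ^ n).
    { intros n; induction k as [|k IH]; [rewrite Nat.add_0_r; lra|].
      rewrite Nat.add_succ_r; specialize (Ha (n + k)%nat); simpl in *; lra. }
    assert (pos : forall n, 0 < (/ 2) ^ n) by (intros; apply pow_lt; lra).
    assert (le : forall n m, a n <= a m + (/ 2) ^ m).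
    { intros n m; destruct (Nat.le_ge_cases n m) as [L|L].
      - replace m with (n + (m - n))%nat by lia.
        specialize (up n (m - n)%nat); specialize (pos (n + (m - n))%nat); lra.
      - replace n with (m + (n - m))%nat by lia.
        specialize (down m (n - m)%nat); specialize (pos (m + (n - m))%nat); lra. }
    destruct (completeness (fun x => exists n, x = a n)) as [p [Hp1 Hp2]].
    - exists (a 0%nat + (/ 2) ^ 0); intros x [n ->]; apply le.
    - exists (a 0%nat), 0%nat; reflexivity.
    - assert (B : forall n, a n <= p <= a n + (/ 2) ^ n).
      { intros n; split; [apply Hp1; now exists n|].
        apply Hp2; intros x [m ->]; apply le. }
      exists p; split; [|split; [exact B|]].
      + specialize (B 0%nat); rewrite a0 in B; simpl in B; lra.
      + intros n; specialize (up 0%nat n); specialize (down 0%nat n); simpl in *; lra. }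
  destruct (lim (fun n => fst (z n))) as [p [Hp [Bp Ip]]]; [reflexivity|apply Hz|].
  destruct (lim (fun n => snd (z n))) as [q [Hq [Bq Iq]]]; [reflexivity|apply Hz|].
  destruct (Hlocal p q Hp Hq) as [d [Hd H]].
  destruct (pow_lt_1_zero (/ 2)) with (y := d) as [N HN];
    [rewrite Rabs_pos_eq; lra|exact Hd|].
  specialize (HN N (Nat.le_refl N)).
  assert (0 < (/ 2) ^ N) by (apply pow_lt; lra).
  rewrite Rabs_pos_eq in HN by lra.
  apply (proj1 (Hz N)); unfold sq; apply H; try apply Bp; try apply Bq;
    try apply Ip; try apply Iq; lra.
Qed.

(** * Goursat's lemma *)

Definition hint (f : C -> C) (y a b : R) : C := CInt (fun x => f (x, y)) a b.
Definition vint (f : C -> C) (x a b : R) : C := CInt (fun y => f (x, y)) a b.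

(** The contour integral of [f] around a rectangle given by opposite corners; no order of
    the bounds is imposed, so that a rectangle may extend in any direction from a corner. *)
Definition rect_int (f : C -> C) (x0 x1 y0 y1 : R) : C :=
  (hint f y0 x0 x1 + Ci * vint f x1 y0 y1 - hint f y1 x0 x1 - Ci * vint f x0 y0 y1)%C.

Section Goursat.
Variable f : C -> C.
Hypothesis f_cont : C_continuous f.

Lemma continuous_hline y : curve_continuous (fun x => f (x, y)).
Proof.
  intros t; apply (continuous_comp (fun x => (x, y) : C_UniformSpace) f); [|apply f_cont].
  apply continuous_Cpair; [apply continuous_id|apply continuous_const].
Qed.

Lemma continuous_vline x : curve_continuous (fun y => f (x, y)).
Proof.
  intros t; apply (continuous_comp (fun y => (x, y) : C_UniformSpace) f); [|apply f_cont].
  apply continuous_Cpair; [apply continuous_const|apply continuous_id].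
Qed.

Lemma rect_int_split_x a b c y0 y1 :
  (rect_int f a b y0 y1 + rect_int f b c y0 y1)%C = rect_int f a c y0 y1.
Proof.
  unfold rect_int, hint.
  rewrite <- (CInt_Chasles _ a b c (continuous_hline y0)).
  rewrite <- (CInt_Chasles _ a b c (continuous_hline y1)); ring.
Qed.

Lemma rect_int_split_y x0 x1 a b c :
  (rect_int f x0 x1 a b + rect_int f x0 x1 b c)%C = rect_int f x0 x1 a c.
Proof.
  unfold rect_int, vint.
  rewrite <- (CInt_Chasles _ a b c (continuous_vline x0)).
  rewrite <- (CInt_Chasles _ a b c (continuous_vline x1)); ring.
Qed.

Lemma rect_int_bound x0 x1 y0 y1 M :
  (forall x y, Rmin x0 x1 <= x <= Rmax x0 x1 -> Rmin y0 y1 <= y <= Rmax y0 y1 ->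
     Cmod (f (x, y)) <= M) ->
  Cmod (rect_int f x0 x1 y0 y1) <= 2 * M * (Rabs (x1 - x0) + Rabs (y1 - y0)).
Proof.
  intros H.
  assert (Ends : forall a b, Rmin a b <= a <= Rmax a b /\ Rmin a b <= b <= Rmax a b).
  { intros a b; pose proof (Rmin_l a b); pose proof (Rmin_r a b);
    pose proof (Rmax_l a b); pose proof (Rmax_r a b); lra. }
  pose proof (Cmod_CInt_le _ x0 x1 M (continuous_hline y0)
    (fun t Ht => H t y0 Ht (proj1 (Ends y0 y1)))) as B1.
  pose proof (Cmod_CInt_le _ x0 x1 M (continuous_hline y1)
    (fun t Ht => H t y1 Ht (proj2 (Ends y0 y1)))) as B2.
  pose proof (Cmod_CInt_le _ y0 y1 M (continuous_vline x0)
    (fun t Ht => H x0 t (proj1 (Ends x0 x1)) Ht)) as B3.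
  pose proof (Cmod_CInt_le _ y0 y1 M (continuous_vline x1)
    (fun t Ht => H x1 t (proj2 (Ends x0 x1)) Ht)) as B4.
  unfold rect_int, hint, vint, Cminus.
  set (A := CInt _ x0 x1) in *.
  set (B := CInt (fun y => f (x1, y)) y0 y1) in *.
  set (E := CInt (fun x => f (x, y1)) x0 x1) in *.
  set (D := CInt (fun y => f (x0, y)) y0 y1) in *.
  pose proof (Cmod_triangle (A + Ci * B + - E) (- (Ci * D))) as T1.
  pose proof (Cmod_triangle (A + Ci * B) (- E)) as T2.
  pose proof (Cmod_triangle A (Ci * B)) as T3.
  rewrite Cmod_opp, Cmod_mult, Cmod_Ci in T1; rewrite Cmod_opp in T2.
  rewrite Cmod_mult, Cmod_Ci in T3; lra.
Qed.

End Goursat.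

Lemma is_curve_derive_hline (x y : R) : is_curve_derive (fun s => (s, y)) x (RtoC 1).
Proof.
  apply (is_derive_ext (V := C_R_NormedModule) (fun s => (0, y) + RtoC s * RtoC 1)%C).
  - intros s; unfold Cplus, Cmult, RtoC; simpl; f_equal; ring.
  - apply is_curve_derive_line.
Qed.

Lemma is_curve_derive_vline (x y : R) : is_curve_derive (fun s => (x, s)) y Ci.
Proof.
  apply (is_derive_ext (V := C_R_NormedModule) (fun s => (x, 0) + RtoC s * Ci)%C).
  - intros s; unfold Cplus, Cmult, RtoC, Ci; simpl; f_equal; ring.
  - apply is_curve_derive_line.
Qed.

Lemma hint_primitive P f y a b : C_continuous f -> (forall z, is_cderive P z (f z)) ->
  hint f y a b = (P (b, y) - P (a, y))%C.
Proof.
  intros Hf HP; apply (CInt_derive (fun x => P (x, y))).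
  - intros x; replace (f (x, y)) with (f (x, y) * RtoC 1)%C by ring.
    apply (is_curve_derive_comp P (fun s => (s, y))); [apply HP|apply is_curve_derive_hline].
  - apply continuous_hline, Hf.
Qed.

Lemma vint_primitive P f x a b : C_continuous f -> (forall z, is_cderive P z (f z)) ->
  (Ci * vint f x a b)%C = (P (x, b) - P (x, a))%C.
Proof.
  intros Hf HP; unfold vint; rewrite <- CInt_scal by (apply continuous_vline, Hf).
  apply (CInt_derive (fun y => P (x, y))).
  - intros y; rewrite Cmult_comm.
    apply (is_curve_derive_comp P (fun s => (x, s))); [apply HP|apply is_curve_derive_vline].
  - intros t; apply continuous_Cmult; [apply continuous_const|apply continuous_vline, Hf].
Qed.

Lemma rect_int_primitive P f x0 x1 y0 y1 :
  C_continuous f -> (forall z, is_cderive P z (f z)) -> rect_int f x0 x1 y0 y1 = RtoC 0.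
Proof.
  intros Hf HP; unfold rect_int.
  rewrite !(hint_primitive P), !(vint_primitive P) by assumption; ring.
Qed.

Lemma rect_int_minus f g x0 x1 y0 y1 : C_continuous f -> C_continuous g ->
  rect_int (fun z => f z - g z)%C x0 x1 y0 y1 = (rect_int f x0 x1 y0 y1 - rect_int g x0 x1 y0 y1)%C.
Proof.
  intros Hf Hg; unfold rect_int, hint, vint.
  pose proof (continuous_hline f Hf) as A1; pose proof (continuous_vline f Hf) as A2.
  pose proof (continuous_hline g Hg) as B1; pose proof (continuous_vline g Hg) as B2.
  rewrite (CInt_minus _ _ x0 x1 (A1 y0) (B1 y0)), (CInt_minus _ _ x0 x1 (A1 y1) (B1 y1)).
  rewrite (CInt_minus _ _ y0 y1 (A2 x0) (B2 x0)), (CInt_minus _ _ y0 y1 (A2 x1) (B2 x1)); ring.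
Qed.

(** An affine function has a quadratic primitive. *)
Lemma rect_int_affine c d p x0 x1 y0 y1 :
  rect_int (fun z => c + d * (z - p))%C x0 x1 y0 y1 = RtoC 0.
Proof.
  apply (rect_int_primitive (fun z => c * z + d / 2 * ((z - p) * (z - p)))%C).
  - intros z; apply continuous_Cplus; [apply continuous_const|].
    apply continuous_Cmult; [apply continuous_const|].
    apply continuous_Cminus; [apply continuous_id|apply continuous_const].
  - intros z; exists (fun w => c + d / 2 * (w - p + (z - p)))%C; split; [|split].
    + apply continuous_Cplus; [apply continuous_const|].
      apply continuous_Cmult; [apply continuous_const|].
      apply continuous_Cplus; [|apply continuous_const].
      apply continuous_Cminus; [apply continuous_id|apply continuous_const].
    + field; intros E; apply RtoC_inj in E; lra.
    + intros w; ring.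
Qed.

Lemma Rabs_between a w u s p x :
  u <= p <= u + s -> Rmin (a + u * w) (a + (u + s) * w) <= x <= Rmax (a + u * w) (a + (u + s) * w) ->
  Rabs (x - (a + p * w)) <= s * Rabs w.
Proof.
  intros Hp Hx; unfold Rmin, Rmax in Hx.
  destruct (Rle_dec _ _); unfold Rabs; destruct (Rcase_abs (x - (a + p * w)));
    destruct (Rcase_abs w); nra.
Qed.

(** In the coordinates of the rectangle, the bound [e * s^2] on the integral around a
    square of side [s] passes from the quarters to the whole, and near a point of
    differentiability it holds because the affine part of [f] integrates to zero and the
    remainder is small compared with [s]. *)
Lemma goursat f x0 y0 w h : C_continuous f ->
  (forall u v, 0 <= u <= 1 -> 0 <= v <= 1 ->
     exists d, is_cderive f (x0 + u * w, y0 + v * h) d) ->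
  rect_int f x0 (x0 + w) y0 (y0 + h) = RtoC 0.
Proof.
  intros Hf Hd.
  set (D := Rabs w + Rabs h).
  assert (HD : 0 <= D) by (unfold D; pose proof (Rabs_pos w); pose proof (Rabs_pos h); lra).
  assert (main : forall e, 0 < e -> Cmod (rect_int f x0 (x0 + w) y0 (y0 + h)) <= e).
  { intros e He.
    pose (P := fun u v s => Cmod (rect_int f (x0 + u * w) (x0 + (u + s) * w)
       (y0 + v * h) (y0 + (v + s) * h)) <= e * s ^ 2).
    assert (HP : P 0 0 1).
    { apply cousin_square; unfold P; clear P.
      - intros u v s.
        replace (u + s / 2 + s / 2) with (u + s) by field.
        replace (v + s / 2 + s / 2) with (v + s) by field.
        intros P1 P2 P3 P4.
        rewrite <- (rect_int_split_x f Hf _ (x0 + (u + s / 2) * w)).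
        do 2 rewrite <- (rect_int_split_y f Hf _ _ (y0 + v * h) (y0 + (v + s / 2) * h)
                           (y0 + (v + s) * h)).
        eapply Rle_trans; [apply Cmod_triangle|].
        eapply Rle_trans; [apply Rplus_le_compat; apply Cmod_triangle|].
        replace (e * s ^ 2) with (4 * (e * (s / 2) ^ 2)) by field; lra.
      - intros p q Hp Hq; destruct (Hd p q Hp Hq) as [d Hder].
        set (z := (x0 + p * w, y0 + q * h) : C) in *.
        destruct Hder as [k [Hk [<- E]]].
        (* The remainder is at most [e' s D] on a contour of length [2 s D]. *)
        set (e' := e / (2 * D ^ 2 + 1)).
        assert (He' : 0 < e') by (apply Rdiv_lt_0_compat; [lra|]; nra).
        apply (fun H => proj1 (continuous_Cmod k z) H e' He') in Hk.
        apply locally_disc in Hk; destruct Hk as [r [Hr Hk]].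
        exists (r / (D + 1)); split; [apply Rdiv_lt_0_compat; lra|].
        intros u v s Hu Hv [Hs Hs'] _ _ _ _.
        assert (Hsr : s * D < r).
        { apply Rle_lt_trans with (s * (D + 1)); [nra|].
          apply Rmult_lt_reg_r with (/ (D + 1)); [apply Rinv_0_lt_compat; lra|].
          rewrite Rmult_assoc, Rinv_r by lra; unfold Rdiv in Hs'; lra. }
        pose (A := fun zz : C => (f z + k z * (zz - z))%C).
        assert (HA : C_continuous A).
        { intros t; apply continuous_Cplus; [apply continuous_const|].
          apply continuous_Cmult; [apply continuous_const|].
          apply continuous_Cminus; [apply continuous_id|apply continuous_const]. }
        assert (EI : rect_int f (x0 + u * w) (x0 + (u + s) * w) (y0 + v * h) (y0 + (v + s) * h)
          = rect_int (fun zz => f zz - A zz)%C (x0 + u * w) (x0 + (u + s) * w)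
              (y0 + v * h) (y0 + (v + s) * h)).
        { rewrite rect_int_minus by assumption; unfold A; rewrite rect_int_affine; ring. }
        rewrite EI.
        apply Rle_trans with (2 * (e' * (s * D)) *
          (Rabs (x0 + (u + s) * w - (x0 + u * w)) + Rabs (y0 + (v + s) * h - (y0 + v * h)))).
        + apply rect_int_bound.
          { intros t; apply continuous_Cminus; [apply Hf|apply HA]. }
          intros x y Hx Hy.
          pose proof (Rabs_between _ _ _ _ _ _ Hu Hx) as Bx.
          pose proof (Rabs_between _ _ _ _ _ _ Hv Hy) as By.
          assert (Bz : Cmod ((x, y) - z) <= s * D).
          { eapply Rle_trans; [apply Cmod_le_Rabs|]; unfold D; simpl;
            unfold Rminus in Bx, By; lra. }
          unfold A; replace (f (x, y) - (f z + k z * ((x, y) - z)))%C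
            with ((f (x, y) - f z) - k z * ((x, y) - z))%C by ring.
          rewrite E; replace (k (x, y) * ((x, y) - z) - k z * ((x, y) - z))%C
            with ((k (x, y) - k z) * ((x, y) - z))%C by ring.
          rewrite Cmod_mult; apply Rmult_le_compat; try apply Cmod_ge_0; [|exact Bz].
          apply Rlt_le, Hk; lra.
        + replace (x0 + (u + s) * w - (x0 + u * w)) with (s * w) by ring.
          replace (y0 + (v + s) * h - (y0 + v * h)) with (s * h) by ring.
          rewrite !Rabs_mult, (Rabs_pos_eq s), <- Rmult_plus_distr_l by lra; fold D.
          assert (Ee : e' * (2 * D ^ 2) <= e).
          { unfold e'; apply Rle_trans with (e / (2 * D ^ 2 + 1) * (2 * D ^ 2 + 1)).
            - apply Rmult_le_compat_l; [fold e'; lra|lra].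
            - right; field; nra. }
          replace (2 * (e' * (s * D)) * (s * D)) with (e' * (2 * D ^ 2) * s ^ 2) by ring.
          apply Rmult_le_compat_r; [nra|exact Ee]. }
    unfold P in HP; rewrite !Rmult_0_l, !Rplus_0_r, !Rplus_0_l, !Rmult_1_l in HP.
    rewrite pow1, Rmult_1_r in HP; exact HP. }
  apply Cmod_eq_0; apply Rle_antisym; [|apply Cmod_ge_0].
  apply Rnot_lt_le; intros Hp; specialize (main (Cmod (rect_int f x0 (x0 + w) y0 (y0 + h)) / 2)); lra.
Qed.

(** * Primitives on a square *)

Definition in_square (r : R) (z : C) : Prop := Rabs (fst z) < r /\ Rabs (snd z) < r.

Lemma Rabs_ratio_lt x k r : 0 <= k <= 1 -> Rabs x < r -> Rabs (k * x) < r.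
Proof.
  intros Hk Hx; rewrite Rabs_mult, (Rabs_pos_eq k) by lra.
  pose proof (Rabs_pos x); nra.
Qed.

Lemma Cpair_minus (x y x' y' : R) :
  ((x', y') - (x, y))%C = (RtoC (x' - x) + Ci * RtoC (y' - y))%C.
Proof. unfold RtoC, Ci, Cplus, Cminus, Cmult, Copp; simpl; apply injective_projections; simpl; ring. Qed.

(** The integral along the path from the centre that runs horizontally first. *)
Definition square_primitive (f : C -> C) (z : C) : C :=
  (hint f 0 0 (fst z) + Ci * vint f (fst z) 0 (snd z))%C.

(* At the centre only continuity is assumed, so that the results cover the difference
   quotient of a holomorphic function at a point. *)
Section Primitive.
Variables (f : C -> C) (r : R).
Hypothesis f_cont : C_continuous f.
Hypothesis f_diff : forall z, in_square r z -> z <> RtoC 0 -> exists d, is_cderive f z d.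

(** Away from the corner Goursat's lemma applies, so the integral equals the one around
    an arbitrarily small rectangle at the corner, where [f] is merely bounded. *)
Lemma rect_int_corner x y : Rabs x < r -> Rabs y < r -> rect_int f 0 x 0 y = RtoC 0.
Proof.
  intros Hx Hy.
  destruct (Req_dec x 0) as [->|Nx].
  { unfold rect_int, hint; rewrite !CInt_point; ring. }
  destruct (Req_dec y 0) as [->|Ny].
  { unfold rect_int, vint; rewrite !CInt_point; ring. }
  (* The two strips that are cut off avoid the centre. *)
  assert (Hsub : forall s, 0 < s <= 1 -> rect_int f 0 x 0 y = rect_int f 0 (s * x) 0 (s * y)).
  { intros s Hs.
    rewrite <- (rect_int_split_x f f_cont 0 (s * x)).
    rewrite <- (rect_int_split_y f f_cont 0 (s * x) 0 (s * y) y).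
    replace (rect_int f (s * x) x 0 y)
      with (rect_int f (s * x) (s * x + (1 - s) * x) 0 (0 + y)) by (f_equal; ring).
    replace (rect_int f 0 (s * x) (s * y) y)
      with (rect_int f 0 (0 + s * x) (s * y) (s * y + (1 - s) * y)) by (f_equal; ring).
    rewrite !goursat; [ring|exact f_cont| |exact f_cont|].
    - intros u v Hu Hv; apply f_diff.
      + split; simpl.
        * replace (s * x + u * ((1 - s) * x)) with ((s + u * (1 - s)) * x) by ring.
          apply Rabs_ratio_lt; [split; nra|exact Hx].
        * rewrite Rplus_0_l; apply Rabs_ratio_lt; assumption.
      + intros E; apply (f_equal fst) in E; simpl in E.
        replace (s * x + u * ((1 - s) * x)) with ((s + u * (1 - s)) * x) in E by ring.
        apply Rmult_integral in E; destruct E as [E|E]; [nra|contradiction].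
    - intros u v Hu Hv; apply f_diff.
      + split; simpl.
        * rewrite Rplus_0_l, <- Rmult_assoc; apply Rabs_ratio_lt; [split; nra|exact Hx].
        * replace (s * y + v * ((1 - s) * y)) with ((s + v * (1 - s)) * y) by ring.
          apply Rabs_ratio_lt; [split; nra|exact Hy].
      + intros E; apply (f_equal snd) in E; simpl in E.
        replace (s * y + v * ((1 - s) * y)) with ((s + v * (1 - s)) * y) in E by ring.
        apply Rmult_integral in E; destruct E as [E|E]; [nra|contradiction]. }
  pose proof (proj1 (continuous_Cmod _ _) (f_cont (RtoC 0)) 1 Rlt_0_1) as HM.
  apply locally_disc in HM; destruct HM as [d [Hd HM]].
  set (D := Rabs x + Rabs y).
  assert (HD : 0 < D) by (unfold D; pose proof (Rabs_pos_lt x Nx); pose proof (Rabs_pos y); lra).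
  set (M := Cmod (f (RtoC 0)) + 1).
  assert (HM1 : 0 < M) by (unfold M; pose proof (Cmod_ge_0 (f (RtoC 0))); lra).
  assert (small : forall s, 0 < s <= 1 -> s * D < d ->
     Cmod (rect_int f 0 x 0 y) <= 2 * M * (s * D)).
  { intros s Hs Hsd; rewrite (Hsub s Hs).
    replace (s * D) with (Rabs (s * x - 0) + Rabs (s * y - 0)).
    2:{ rewrite !Rminus_0_r, !Rabs_mult, (Rabs_pos_eq s) by lra; unfold D; ring. }
    apply rect_int_bound; [exact f_cont|].
    intros a b Ha Hb.
    replace (f (a, b)) with (f (a, b) - f (RtoC 0) + f (RtoC 0))%C by ring.
    eapply Rle_trans; [apply Cmod_triangle|]; unfold M; rewrite Rplus_comm.
    apply Rplus_le_compat_l, Rlt_le, HM.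
    replace ((a, b) - RtoC 0)%C with ((a, b) : C) by exact (eq_sym (Cminus_0_r (a, b))).
    eapply Rle_lt_trans; [apply Cmod_le_Rabs|]; simpl.
    assert (K : forall t z, Rmin 0 (s * z) <= t <= Rmax 0 (s * z) -> Rabs t <= s * Rabs z).
    { intros t z Ht; pose proof (Rabs_between 0 z 0 s 0 t) as B.
      rewrite !Rmult_0_l, !Rplus_0_l, Rminus_0_r in B; apply B; [lra|exact Ht]. }
    pose proof (K a x Ha); pose proof (K b y Hb); unfold D in Hsd; lra. }
  apply Cmod_eq_0; apply Rle_antisym; [|apply Cmod_ge_0].
  apply Rnot_lt_le; intros Hp; set (I := Cmod (rect_int f 0 x 0 y)) in *.
  set (s := Rmin 1 (Rmin (d / (2 * D)) (I / (4 * M * D)))).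
  assert (P1 : 0 < d / (2 * D)) by (apply Rdiv_lt_0_compat; lra).
  assert (P2 : 0 < I / (4 * M * D)) by (apply Rdiv_lt_0_compat; [lra|nra]).
  assert (B1 : 0 < s <= 1) by (split; [repeat apply Rmin_glb_lt; lra|apply Rmin_l]).
  assert (B2 : s <= d / (2 * D)) by (eapply Rle_trans; [apply Rmin_r|apply Rmin_l]).
  assert (B3 : s <= I / (4 * M * D)) by (eapply Rle_trans; [apply Rmin_r|apply Rmin_r]).
  assert (C2 : s * D <= d / 2).
  { apply Rle_trans with (d / (2 * D) * D); [nra|right; field; lra]. }
  assert (C3 : 2 * M * (s * D) <= I / 2).
  { apply Rle_trans with (2 * M * (I / (4 * M * D) * D)); [|right; field; split; lra].
    apply Rmult_le_compat_l; [lra|]; apply Rmult_le_compat_r; lra. }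
  specialize (small s B1 ltac:(lra)); lra.
Qed.

(** By the vanishing around rectangles with a corner at the centre, the path that runs
    vertically first gives the same value; so the increment is an integral along two sides
    starting at the given point. *)
Lemma square_primitive_step x y x' y' :
  Rabs x < r -> Rabs y < r -> Rabs x' < r ->
  (square_primitive f (x', y') - square_primitive f (x, y))%C
  = (hint f y x x' + Ci * vint f x' y y')%C.
Proof.
  intros Hx Hy Hx'; unfold square_primitive; simpl.
  pose proof (rect_int_corner x y Hx Hy) as E.
  pose proof (rect_int_corner x' y Hx' Hy) as E'.
  unfold rect_int in E, E'; unfold hint, vint in *.
  pose proof (CInt_Chasles _ 0 y y' (continuous_vline f f_cont x')) as V.
  pose proof (CInt_Chasles _ 0 x x' (continuous_hline f f_cont y)) as H.
  rewrite <- V.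
  set (a := CInt (fun x => f (x, 0)) 0 x') in *.
  set (b := CInt (fun x => f (x, 0)) 0 x) in *.
  set (c := CInt (fun y => f (x', y)) 0 y) in *.
  set (d := CInt (fun y => f (x', y)) y y') in *.
  set (e := CInt (fun y => f (x, y)) 0 y) in *.
  set (g := CInt (fun x => f (x, y)) 0 x) in *.
  set (h := CInt (fun y => f (0, y)) 0 y) in *.
  set (k := CInt (fun x => f (x, y)) x x') in *.
  set (l := CInt (fun x => f (x, y)) 0 x') in *.
  transitivity ((a + Ci * c - l - Ci * h) - (b + Ci * e - g - Ci * h) + (l - g) + Ci * d)%C;
    [ring|].
  rewrite E, E', <- H; ring.
Qed.

(** Along two short sides, [f] differs little from its value at the given point. *)
Theorem is_cderive_square_primitive z :
  in_square r z -> is_cderive (square_primitive f) z (f z).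
Proof.
  intros [Hx Hy]; apply is_cderive_of_estimate; intros e He.
  pose proof (proj1 (continuous_Cmod _ _) (f_cont z) (e / 2) ltac:(lra)) as Hc.
  apply locally_disc in Hc; destruct Hc as [d [Hd Hc]].
  apply locally_disc; exists (Rmin (d / 2) (r - Rabs (fst z))); split.
  { apply Rmin_glb_lt; lra. }
  intros w Hw.
  assert (Hw1 : Cmod (w - z) < d / 2) by (eapply Rlt_le_trans; [exact Hw|apply Rmin_l]).
  assert (Hw2 : Cmod (w - z) < r - Rabs (fst z)) by (eapply Rlt_le_trans; [exact Hw|apply Rmin_r]).
  clear Hw.
  pose proof (Rabs_fst_le_Cmod (w - z)) as Dx; pose proof (Rabs_snd_le_Cmod (w - z)) as Dy.
  destruct z as [x y], w as [x' y']; simpl in *.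
  change (x' + - x) with (x' - x) in Dx; change (y' + - y) with (y' - y) in Dy.
  assert (Hx' : Rabs x' < r).
  { replace x' with (x' - x + x) by ring.
    eapply Rle_lt_trans; [apply Rabs_triang|]; lra. }
  set (A := f (x, y)) in *.
  assert (E : (square_primitive f (x', y') - square_primitive f (x, y)
     - A * ((x', y') - (x, y)))%C
    = (hint (fun u => f u - A) y x x' + Ci * vint (fun u => f u - A) x' y y')%C).
  { rewrite square_primitive_step by assumption.
    pose proof (continuous_hline f f_cont y) as Ch.
    pose proof (continuous_vline f f_cont x') as Cv.
    assert (Cc : curve_continuous (fun _ => A)) by (intros t; apply continuous_const).
    unfold hint, vint; rewrite (CInt_minus _ _ x x' Ch Cc), (CInt_minus _ _ y y' Cv Cc).
    rewrite !CInt_const, Cpair_minus.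
    ring. }
  rewrite E; clear E.
  assert (Hg : C_continuous (fun u => f u - A)%C).
  { intros t; apply continuous_Cminus; [apply f_cont|apply continuous_const]. }
  assert (near : forall a b, Rabs (a - x) <= Rabs (x' - x) -> Rabs (b - y) <= Rabs (y' - y) ->
     Cmod (f (a, b) - A) <= e / 2).
  { intros a b Ha Hb; apply Rlt_le, Hc.
    eapply Rle_lt_trans; [apply Cmod_le_Rabs|]; simpl.
    change (a + - x) with (a - x); change (b + - y) with (b - y); lra. }
  assert (btw : forall p q t, Rmin p q <= t <= Rmax p q -> Rabs (t - p) <= Rabs (q - p)).
  { intros p q t; unfold Rmin, Rmax, Rabs; destruct (Rle_dec p q);
    destruct (Rcase_abs (t - p)), (Rcase_abs (q - p)); lra. }
  assert (B1 : Cmod (hint (fun u => f u - A)%C y x x') <= e / 2 * Rabs (x' - x)).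
  { apply Cmod_CInt_le; [apply (continuous_hline _ Hg)|].
    intros t Ht; apply near; [apply btw, Ht|rewrite Rminus_diag, Rabs_R0; apply Rabs_pos]. }
  assert (B2 : Cmod (vint (fun u => f u - A)%C x' y y') <= e / 2 * Rabs (y' - y)).
  { apply Cmod_CInt_le; [apply (continuous_vline _ Hg)|].
    intros t Ht; apply near; [lra|apply btw, Ht]. }
  eapply Rle_trans; [apply Cmod_triangle|]; rewrite Cmod_mult, Cmod_Ci; nra.
Qed.

End Primitive.

(** * Cauchy's formula *)

Lemma is_curve_derive_pair (f g : R -> R) t a b :
  is_derive f t a -> is_derive g t b -> is_curve_derive (fun s => (f s, g s)) t (a, b).
Proof.
  intros [_ Hf] [_ Hg]; split; [apply is_linear_scal_l|].
  intros x Hx [e He].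
  assert (He2 : 0 < e / 2) by lra.
  generalize (filter_and _ _ (Hf x Hx (mkposreal _ He2)) (Hg x Hx (mkposreal _ He2))).
  apply filter_imp; intros s [A B]; rewrite norm_C_R.
  eapply Rle_trans; [apply Cmod_le_Rabs|].
  match goal with |- _ <= pos _ * ?n =>
    replace (pos (mkposreal e He) * n) with (e / 2 * n + e / 2 * n) by (simpl; field) end.
  apply Rplus_le_compat; [exact A|exact B].
Qed.

Definition circ (r t : R) : C := (r * cos t, r * sin t).

Lemma circ_derive r t : is_curve_derive (circ r) t (Ci * circ r t)%C.
Proof.
  replace (Ci * circ r t)%C with ((r * - sin t, r * cos t) : C)
    by (unfold Ci, circ, Cmult; simpl; apply injective_projections; simpl; ring).
  apply is_curve_derive_pair; auto_derive; trivial; ring.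
Qed.

Lemma circ_continuous r : curve_continuous (circ r).
Proof. intros t; eapply is_curve_derive_continuous, circ_derive. Qed.

Lemma circ_2PI r : circ r (2 * PI) = circ r 0.
Proof. unfold circ; rewrite cos_2PI, sin_2PI, cos_0, sin_0; reflexivity. Qed.

Lemma Cmod_circ r t : 0 < r -> Cmod (circ r t) = r.
Proof.
  intros Hr; unfold Cmod, circ; simpl fst; simpl snd.
  replace ((r * cos t) ^ 2 + (r * sin t) ^ 2) with (r ^ 2 * (Rsqr (sin t) + Rsqr (cos t)))
    by (unfold Rsqr; ring).
  rewrite sin2_cos2, Rmult_1_r; apply sqrt_pow2; lra.
Qed.

(** The Cauchy transform of a density [phi] on the circle of radius [r]; Cauchy's formula
    makes an entire function one of these, and its Taylor remainders too. *)
Definition cauchy_transform (r : R) (phi : R -> C) (w : C) : C :=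
  CInt (fun t => phi t / (circ r t - w))%C 0 (2 * PI).

Section CauchyTransform.
Variable r : R.
Hypothesis r_pos : 0 < r.
Implicit Types (phi : R -> C) (w : C).

Lemma circ_minus_ge t w : r - Cmod w <= Cmod (circ r t - w).
Proof.
  pose proof (Cmod_triangle_minus (circ r t) w) as T; rewrite Cmod_circ in T by exact r_pos.
  exact T.
Qed.

Lemma circ_minus_neq0 t w : Cmod w < r -> (circ r t - w)%C <> RtoC 0.
Proof. intros H; apply Cmod_gt_0; pose proof (circ_minus_ge t w); lra. Qed.

Lemma circ_neq0 t : circ r t <> RtoC 0.
Proof. apply Cmod_gt_0; rewrite Cmod_circ; lra. Qed.

Lemma continuous_circ_div phi w : Cmod w < r -> curve_continuous phi ->
  curve_continuous (fun t => phi t / (circ r t - w))%C.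
Proof.
  intros Hw H t; apply continuous_Cdiv; [apply H| |apply circ_minus_neq0, Hw].
  apply continuous_Cminus; [apply circ_continuous|apply continuous_const].
Qed.

Lemma curve_bounded phi : curve_continuous phi ->
  exists M, 0 < M /\ forall t, 0 <= t <= 2 * PI -> Cmod (phi t) <= M.
Proof.
  intros H; destruct (bounded_continuity (V := C_R_NormedModule) phi 0 (2 * PI)) as [M HM].
  - intros t _; apply H.
  - exists (Rabs M + 1); split; [pose proof (Rabs_pos M); lra|].
    intros t Ht; specialize (HM t Ht); rewrite norm_C_R in HM.
    pose proof (Rle_abs M); lra.
Qed.

Lemma cauchy_transform_bound phi w M : curve_continuous phi -> Cmod w < r ->
  (forall t, 0 <= t <= 2 * PI -> Cmod (phi t) <= M) ->
  Cmod (cauchy_transform r phi w) <= M / (r - Cmod w) * (2 * PI).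
Proof.
  intros Hphi Hw HM; pose proof PI_RGT_0 as Hpi.
  pose proof (Cmod_CInt_le (fun t => phi t / (circ r t - w))%C 0 (2 * PI) (M / (r - Cmod w)))
    as B.
  rewrite Rminus_0_r, (Rabs_pos_eq (2 * PI)) in B by lra.
  apply B; [apply continuous_circ_div; assumption|].
  rewrite Rmin_left, Rmax_right by lra; intros t Ht.
  rewrite Cmod_div by (apply circ_minus_neq0, Hw).
  assert (0 <= M) by (eapply Rle_trans; [apply Cmod_ge_0|apply (HM t Ht)]).
  apply Rmult_le_compat.
  - apply Cmod_ge_0.
  - apply Rlt_le, Rinv_0_lt_compat, Cmod_gt_0, circ_minus_neq0, Hw.
  - apply HM, Ht.
  - apply Rinv_le_contravar; [lra|apply circ_minus_ge].
Qed.

(** The difference quotient of a transform is the transform of another density; continuity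
    and differentiability follow. *)
Lemma cauchy_transform_sub phi w v : curve_continuous phi -> Cmod w < r -> Cmod v < r ->
  (cauchy_transform r phi w - cauchy_transform r phi v =
   (w - v) * cauchy_transform r (fun t => phi t / (circ r t - v)) w)%C.
Proof.
  intros Hphi Hw Hv; unfold cauchy_transform.
  rewrite <- CInt_minus by (apply continuous_circ_div; assumption).
  rewrite <- CInt_scal
    by (apply (continuous_circ_div (fun t => phi t / (circ r t - v))%C);
        [assumption|apply continuous_circ_div; assumption]).
  apply CInt_ext; intros t; field; split; apply circ_minus_neq0; assumption.
Qed.

Lemma cauchy_transform_continuous phi w : curve_continuous phi -> Cmod w < r ->
  continuous (T := C_UniformSpace) (U := C_UniformSpace) (cauchy_transform r phi) w.
Proof.
  intros Hphi Hw; pose proof PI_RGT_0 as Hpi.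
  assert (Hpsi : curve_continuous (fun t => phi t / (circ r t - w))%C)
    by (apply continuous_circ_div; assumption).
  destruct (curve_bounded _ Hpsi) as [M [HM0 HM]].
  set (k := (r - Cmod w) / 2); assert (Hk : 0 < k) by (unfold k; lra).
  set (L := M / k * (2 * PI)).
  assert (HL : 0 < L) by (unfold L; apply Rmult_lt_0_compat; [apply Rdiv_lt_0_compat|]; lra).
  apply continuous_Cmod; intros e He; apply locally_disc.
  exists (Rmin k (e / L)); split; [apply Rmin_glb_lt; [lra|apply Rdiv_lt_0_compat; lra]|].
  intros v Hv.
  assert (Hv1 : Cmod (v - w) < k) by (eapply Rlt_le_trans; [exact Hv|apply Rmin_l]).
  assert (Hv2 : Cmod (v - w) < e / L) by (eapply Rlt_le_trans; [exact Hv|apply Rmin_r]).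
  pose proof (Cmod_triangle_minus v w) as Tr.
  assert (Hvr : Cmod v <= r - k) by (unfold k in *; lra).
  rewrite cauchy_transform_sub by (assumption || lra).
  rewrite Cmod_mult.
  apply Rle_lt_trans with (Cmod (v - w) * L).
  - apply Rmult_le_compat_l; [apply Cmod_ge_0|].
    eapply Rle_trans; [apply (cauchy_transform_bound _ v M Hpsi ltac:(lra) HM)|].
    unfold L; apply Rmult_le_compat_r; [lra|].
    apply Rmult_le_compat_l; [lra|]; apply Rinv_le_contravar; lra.
  - apply Rlt_le_trans with (e / L * L); [apply Rmult_lt_compat_r; lra|].
    right; field; lra.
Qed.

Lemma cauchy_transform_derive phi w : curve_continuous phi -> Cmod w < r ->
  exists d, is_cderive (cauchy_transform r phi) w d.
Proof.
  intros Hphi Hw.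
  assert (Hpsi : curve_continuous (fun t => phi t / (circ r t - w))%C)
    by (apply continuous_circ_div; assumption).
  set (q := cauchy_transform r (fun t => phi t / (circ r t - w))%C).
  exists (q w); apply is_cderive_of_estimate; intros e He.
  pose proof (proj1 (continuous_Cmod _ _) (cauchy_transform_continuous _ w Hpsi Hw) e He) as Hq.
  fold q in Hq; apply locally_disc in Hq; destruct Hq as [d [Hd Hq]].
  apply locally_disc; exists (Rmin d (r - Cmod w)); split; [apply Rmin_glb_lt; lra|].
  intros v Hv.
  assert (Hv1 : Cmod (v - w) < d) by (eapply Rlt_le_trans; [exact Hv|apply Rmin_l]).
  assert (Hv2 : Cmod (v - w) < r - Cmod w) by (eapply Rlt_le_trans; [exact Hv|apply Rmin_r]).
  pose proof (Cmod_triangle_minus v w) as Tr.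
  rewrite cauchy_transform_sub by (assumption || lra); fold q.
  replace ((v - w) * q v - q w * (v - w))%C with ((q v - q w) * (v - w))%C by ring.
  rewrite Cmod_mult; apply Rmult_le_compat_r; [apply Cmod_ge_0|apply Rlt_le, Hq, Hv1].
Qed.

(** With this density the transform at [0] is the Taylor coefficient of order [n], and the
    transform as a function is the Taylor remainder of that order divided by [w ^ n]. *)
Definition circ_shift phi (n : nat) (t : R) : C := (phi t / circ r t ^ n)%C.

Lemma circ_shift_continuous phi n : curve_continuous phi -> curve_continuous (circ_shift phi n).
Proof.
  intros H t; apply continuous_Cdiv; [apply H|apply continuous_Cpow, circ_continuous|].
  apply Cpow_nz, circ_neq0.
Qed.

Lemma cauchy_transform_taylor phi n w : curve_continuous phi -> Cmod w < r ->
  cauchy_transform r (circ_shift phi n) w =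
  (cauchy_transform r (circ_shift phi n) 0 + w * cauchy_transform r (circ_shift phi (S n)) w)%C.
Proof.
  intros Hphi Hw.
  assert (H0 : Cmod 0 < r) by (rewrite Cmod_0; exact r_pos).
  pose proof (cauchy_transform_sub _ w 0 (circ_shift_continuous phi n Hphi) Hw H0) as E.
  rewrite Cminus_0_r in E.
  replace (cauchy_transform r (circ_shift phi (S n)) w)
    with (cauchy_transform r (fun t => circ_shift phi n t / (circ r t - 0))%C w).
  - rewrite <- E; ring.
  - apply CInt_ext; intros t; f_equal; unfold circ_shift; simpl.
    rewrite Cminus_0_r; field; split; [apply Cpow_nz|]; apply circ_neq0.
Qed.

Lemma cauchy_transform_factor phi n w : curve_continuous phi -> Cmod w < r ->
  (forall k, (k < n)%nat -> cauchy_transform r (circ_shift phi k) 0 = RtoC 0) ->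
  cauchy_transform r phi w = (w ^ n * cauchy_transform r (circ_shift phi n) w)%C.
Proof.
  intros Hphi Hw; induction n as [|n IH]; intros H.
  - simpl; rewrite Cmult_1_l; apply CInt_ext; intros t; f_equal.
    unfold circ_shift; simpl; field; apply C1_nz.
  - rewrite IH by (intros k Hk; apply H; lia).
    rewrite cauchy_transform_taylor, H by (assumption || lia); simpl; ring.
Qed.

(** All Taylor coefficients vanish, so the transform equals its remainder of every order,
    and the remainder of order [n] is of size [(|w| / r) ^ n]. *)
Lemma cauchy_transform_vanish phi w : curve_continuous phi -> Cmod w < r ->
  (forall k, cauchy_transform r (circ_shift phi k) 0 = RtoC 0) ->
  cauchy_transform r phi w = RtoC 0.
Proof.
  intros Hphi Hw H; pose proof PI_RGT_0 as Hpi.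
  destruct (curve_bounded _ Hphi) as [M [HM0 HM]].
  set (B := M / (r - Cmod w) * (2 * PI)).
  assert (HB : 0 < B) by (apply Rmult_lt_0_compat; [apply Rdiv_lt_0_compat|]; lra).
  set (x := Cmod w / r).
  assert (Hx : 0 <= x < 1).
  { unfold x; split; [apply Rmult_le_pos; [apply Cmod_ge_0|apply Rlt_le, Rinv_0_lt_compat, r_pos]|].
    apply Rmult_lt_reg_r with r; [exact r_pos|]; unfold Rdiv; rewrite Rmult_assoc, Rinv_l; lra. }
  assert (E : forall n, Cmod (cauchy_transform r phi w) <= x ^ n * B).
  { intros n; rewrite (cauchy_transform_factor phi n w Hphi Hw) by (intros; apply H).
    rewrite Cmod_mult, Cmod_pow.
    pose proof (cauchy_transform_bound (circ_shift phi n) w (M / r ^ n)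
      (circ_shift_continuous phi n Hphi) Hw) as Bn.
    assert (Hrn : 0 < r ^ n) by (apply pow_lt, r_pos).
    assert (Hc : forall t, 0 <= t <= 2 * PI -> Cmod (circ_shift phi n t) <= M / r ^ n).
    { intros t Ht; unfold circ_shift; rewrite Cmod_div by (apply Cpow_nz, circ_neq0).
      rewrite Cmod_pow, Cmod_circ by exact r_pos.
      apply Rmult_le_compat_r; [apply Rlt_le, Rinv_0_lt_compat, Hrn|apply HM, Ht]. }
    specialize (Bn Hc).
    apply Rle_trans with (Cmod w ^ n * (M / r ^ n / (r - Cmod w) * (2 * PI))).
    - apply Rmult_le_compat_l; [apply pow_le, Cmod_ge_0|exact Bn].
    - right; unfold x, B, Rdiv; rewrite Rpow_mult_distr, pow_inv; field; lra. }
  apply Cmod_eq_0; apply Rle_antisym; [|apply Cmod_ge_0].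
  apply Rnot_lt_le; intros Hp.
  destruct (pow_lt_1_zero x) with (y := Cmod (cauchy_transform r phi w) / B) as [N HN].
  - rewrite Rabs_pos_eq; lra.
  - apply Rdiv_lt_0_compat; lra.
  - specialize (HN N (Nat.le_refl N)); specialize (E N).
    rewrite Rabs_pos_eq in HN by (apply pow_le; lra).
    apply (Rmult_lt_compat_r B) in HN; [|exact HB].
    unfold Rdiv in HN; rewrite Rmult_assoc, Rinv_l in HN; lra.
Qed.

(** A negative power of the point on the circle is, up to a constant, its own derivative
    with respect to the angle, and it is periodic. *)
Lemma CInt_circ_inv_pow n : CInt (fun t => / circ r t ^ S n)%C 0 (2 * PI) = RtoC 0.
Proof.
  set (c := RtoC (INR (S n))).
  assert (Hc : c <> RtoC 0) by (intros E; apply RtoC_inj in E; revert E; apply not_0_INR; lia).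
  rewrite (CInt_derive (fun t => Ci / c * / circ r t ^ S n)%C).
  - rewrite circ_2PI; ring.
  - intros t.
    assert (Hz := circ_neq0 t).
    replace (/ circ r t ^ S n)%C with
      (Ci / c * (- / (circ r t ^ S n * circ r t ^ S n) * (c * circ r t ^ n)) * (Ci * circ r t))%C.
    + apply (is_curve_derive_comp (fun z => Ci / c * / z ^ S n)%C); [|apply circ_derive].
      pose proof (is_cderive_mult (fun _ => Ci / c)%C (fun z => / z ^ S n)%C (circ r t) 0
       (- / (circ r t ^ S n * circ r t ^ S n) * (c * circ r t ^ n)) (is_cderive_const _ _)) as P.
      rewrite Cmult_0_l, Cplus_0_l in P; apply P.
      apply (is_cderive_comp Cinv (fun z => z ^ S n)%C); [apply is_cderive_inv, Cpow_nz, Hz|].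
      apply is_cderive_pow.
    + rewrite Cpow_S.
      assert (Hzn : (circ r t ^ n)%C <> RtoC 0) by (apply Cpow_nz, Hz).
      transitivity (- (Ci * Ci) * / (circ r t * circ r t ^ n))%C.
      * field; split; [assumption|split; assumption].
      * replace (Ci * Ci)%C with (- (1))%C
          by (unfold Ci, Cmult, Copp, RtoC; simpl; apply injective_projections; simpl; ring).
        ring.
  - intros t; apply continuous_Cinv; [apply continuous_Cpow, circ_continuous|].
    apply Cpow_nz, circ_neq0.
Qed.

(** By [z / (z - w) = 1 + w / (z - w)] it remains to treat the density [1], whose Taylor
    coefficients are integrals of negative powers. *)
Lemma cauchy_transform_circ w : Cmod w < r ->
  cauchy_transform r (circ r) w = RtoC (2 * PI).
Proof.
  intros Hw.
  assert (H1 : curve_continuous (fun _ => RtoC 1)) by (intros t; apply continuous_const).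
  assert (V : cauchy_transform r (fun _ => RtoC 1) w = RtoC 0).
  { apply cauchy_transform_vanish; [exact H1|exact Hw|].
    intros k; etransitivity; [|apply (CInt_circ_inv_pow k)]; apply CInt_ext; intros t.
    unfold circ_shift; rewrite Cminus_0_r; simpl; field; split; (apply circ_neq0 || apply Cpow_nz, circ_neq0). }
  unfold cauchy_transform at 1.
  rewrite (CInt_ext _ (fun t => RtoC 1 + w * (RtoC 1 / (circ r t - w)))%C)
    by (intros t; field; apply circ_minus_neq0, Hw).
  assert (H2 : curve_continuous (fun t => RtoC 1 / (circ r t - w))%C)
    by (apply continuous_circ_div; assumption).
  rewrite CInt_plus, CInt_const, CInt_scal; try assumption.
  - fold (cauchy_transform r (fun _ => RtoC 1) w); rewrite V, Rminus_0_r; ring.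
  - intros t; apply continuous_Cmult; [apply continuous_const|apply H2].
Qed.

End CauchyTransform.

Definition holomorphic (F : C -> C) : Prop := forall z, exists d, is_cderive F z d.

Lemma entire_holomorphic F : entire F -> holomorphic F.
Proof. intros H z; destruct (H z) as [d Hd]; exists d; apply is_cderive_of_is_derive, Hd. Qed.

Lemma holomorphic_continuous F : holomorphic F -> C_continuous F.
Proof. intros H z; destruct (H z) as [d Hd]; eapply is_cderive_continuous, Hd. Qed.

Definition cauchy_density (F : C -> C) (r t : R) : C :=
  (F (circ r t) * circ r t / RtoC (2 * PI))%C.

Lemma RtoC_2PI_neq0 : RtoC (2 * PI) <> RtoC 0.
Proof. intros E; apply RtoC_inj in E; pose proof PI_RGT_0; lra. Qed.

Lemma cauchy_density_continuous F r : holomorphic F -> curve_continuous (cauchy_density F r).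
Proof.
  intros HF t; apply continuous_Cdiv; [|apply continuous_const|apply RtoC_2PI_neq0].
  apply continuous_Cmult; [|apply circ_continuous].
  apply (continuous_comp (circ r) F); [apply circ_continuous|apply holomorphic_continuous, HF].
Qed.

(** The difference quotient [q] of [F] at [w] is continuous, and differentiable away from
    [w], so it has a primitive and integrates to zero along the circle. *)
Theorem cauchy_formula F r w : holomorphic F -> 0 < r -> Cmod w < r ->
  F w = cauchy_transform r (cauchy_density F r) w.
Proof.
  intros HF Hr Hw.
  destruct (HF w) as [d [q [Hq [_ E]]]].
  assert (Hqd : forall z, z <> w -> exists e, is_cderive q z e).
  { intros z Hz; destruct (HF z) as [dz Hdz]; eexists.
    apply (is_cderive_ext_loc (fun v => (F v + - F w) * / (v - w))%C).
    - generalize (continuous_neq0 (fun v : C_UniformSpace => v - w)%C z); intros N.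
      eapply filter_imp; [|apply N].
      + intros v Nv; simpl in Nv.
        replace (F v + - F w)%C with (q v * (v - w))%C by (rewrite <- E; ring).
        field; exact Nv.
      + apply continuous_Cminus; [apply continuous_id|apply continuous_const].
      + apply Cminus_eq_contra, Hz.
    - apply is_cderive_mult.
      + apply is_cderive_plus; [exact Hdz|apply is_cderive_const].
      + apply (is_cderive_comp Cinv (fun v => v - w)%C).
        * apply is_cderive_inv, Cminus_eq_contra, Hz.
        * apply is_cderive_plus; [apply is_cderive_id|apply is_cderive_const]. }
  assert (Hqc : C_continuous q).
  { intros z; destruct (Ceq_dec z w) as [->|N]; [exact Hq|].
    destruct (Hqd z N) as [e He]; eapply is_cderive_continuous, He. }
  pose (f := fun z => q (w + z)%C).
  assert (Hfc : C_continuous f).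
  { intros z; apply (continuous_comp (fun z : C_UniformSpace => w + z : C_UniformSpace)%C q);
      [|apply Hqc].
    apply continuous_Cplus; [apply continuous_const|apply continuous_id]. }
  assert (Hfd : forall z, z <> RtoC 0 -> exists e, is_cderive f z e).
  { intros z Hz; destruct (Hqd (w + z)%C) as [e He].
    - intros E0; apply Hz; replace z with (w + z - w)%C by ring; rewrite E0; ring.
    - eexists; apply (is_cderive_comp q (fun z => w + z)%C); [exact He|].
      apply is_cderive_plus; [apply is_cderive_const|apply is_cderive_id]. }
  assert (HP : forall z, is_cderive (square_primitive f) z (f z)).
  { intros z; apply (is_cderive_square_primitive f (Rabs (fst z) + Rabs (snd z) + 1)).
    - exact Hfc.
    - intros v _ Nv; apply Hfd, Nv.
    - split; pose proof (Rabs_pos (fst z)); pose proof (Rabs_pos (snd z)); lra. }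
  assert (Hcc : curve_continuous (fun t => f (circ r t - w) * (Ci * circ r t))%C).
  { intros t; apply continuous_Cmult.
    - apply (continuous_comp (fun t => circ r t - w : C_UniformSpace)%C f); [|apply Hfc].
      apply continuous_Cminus; [apply circ_continuous|apply continuous_const].
    - apply continuous_Cmult; [apply continuous_const|apply circ_continuous]. }
  assert (I0 : CInt (fun t => f (circ r t - w) * (Ci * circ r t))%C 0 (2 * PI) = RtoC 0).
  { rewrite (CInt_derive (fun t => square_primitive f (circ r t - w))).
    - rewrite circ_2PI; ring.
    - intros t; apply (is_curve_derive_comp (fun z => square_primitive f (z - w)) (circ r));
        [|apply circ_derive].
      rewrite <- (Cmult_1_r (f _)), <- (Cplus_0_r 1).
      apply (is_cderive_comp (square_primitive f) (fun z => z - w)%C); [apply HP|].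
      apply is_cderive_plus; [apply is_cderive_id|apply is_cderive_const].
    - exact Hcc. }
  assert (Hcirc : curve_continuous (circ r)) by apply circ_continuous.
  assert (K1 : curve_continuous (fun t => cauchy_density F r t / (circ r t - w))%C)
    by (apply continuous_circ_div; [exact Hr|exact Hw|apply cauchy_density_continuous, HF]).
  assert (K2 : curve_continuous (fun t => circ r t / (circ r t - w))%C)
    by (apply continuous_circ_div; assumption).
  assert (K3 : curve_continuous (fun t => F w / RtoC (2 * PI) * (circ r t / (circ r t - w)))%C)
    by (intros t; apply continuous_Cmult; [apply continuous_const|apply K2]).
  assert (J0 : (cauchy_transform r (cauchy_density F r) w
     - F w / RtoC (2 * PI) * cauchy_transform r (circ r) w)%C = RtoC 0).
  { unfold cauchy_transform at 1 2.
    rewrite <- CInt_scal, <- CInt_minus by assumption.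
    rewrite (CInt_ext _ (fun t => (/ (Ci * RtoC (2 * PI))) * (f (circ r t - w) * (Ci * circ r t)))%C).
    - rewrite CInt_scal, I0 by exact Hcc; ring.
    - intros t; unfold f, cauchy_density.
      replace (w + (circ r t - w))%C with (circ r t) by ring.
      pose proof (E (circ r t)) as Et.
      assert (N := circ_minus_neq0 r Hr t w Hw).
      replace (F (circ r t)) with (F w + q (circ r t) * (circ r t - w))%C by (rewrite <- Et; ring).
      field; repeat split; (exact N || apply RtoC_2PI_neq0 || apply Ci_nz). }
  rewrite cauchy_transform_circ in J0 by assumption.
  apply Ceq_minus in J0; rewrite J0; field; apply RtoC_2PI_neq0.
Qed.

(** * Consequences of Cauchy's formula *)

(** The difference quotient is a Cauchy transform over a larger circle. *)
Lemma holomorphic_lipschitz F p : holomorphic F -> 0 < p ->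
  exists L, 0 < L /\ forall z w, Cmod z <= p -> Cmod w <= p ->
    Cmod (F z - F w) <= L * Cmod (z - w).
Proof.
  intros HF Hp; pose proof PI_RGT_0 as Hpi.
  set (r := p + 1); assert (Hr : 0 < r) by (unfold r; lra).
  assert (Hphi := cauchy_density_continuous F r HF).
  destruct (curve_bounded _ Hphi) as [M [HM0 HM]].
  exists (M * (2 * PI)); split; [nra|]; intros z w Hz Hw.
  assert (Hzr : Cmod z < r) by (unfold r; lra).
  assert (Hwr : Cmod w < r) by (unfold r; lra).
  rewrite (cauchy_formula F r z), (cauchy_formula F r w) by assumption.
  rewrite cauchy_transform_sub by assumption.
  rewrite Cmod_mult, Rmult_comm; apply Rmult_le_compat_r; [apply Cmod_ge_0|].
  assert (Hinv : forall v, Cmod v <= p -> / (r - Cmod v) <= 1).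
  { intros v Hv; rewrite <- Rinv_1; apply Rinv_le_contravar; unfold r; lra. }
  eapply Rle_trans.
  - apply (cauchy_transform_bound r Hr _ z M).
    + apply continuous_circ_div; assumption.
    + exact Hzr.
    + intros t Ht; rewrite Cmod_div by (apply circ_minus_neq0; assumption).
      rewrite <- (Rmult_1_r M); apply Rmult_le_compat.
      * apply Cmod_ge_0.
      * apply Rlt_le, Rinv_0_lt_compat, Cmod_gt_0, circ_minus_neq0; assumption.
      * apply HM, Ht.
      * eapply Rle_trans; [|apply (Hinv w Hw)].
        apply Rinv_le_contravar; [lra|apply circ_minus_ge, Hr].
  - apply Rmult_le_compat_r; [lra|].
    rewrite <- (Rmult_1_r M) at 2; apply Rmult_le_compat_l; [lra|apply Hinv, Hz].
Qed.

(** Take a circle around [a] that encloses a point where [F] does not vanish.  Then some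
    Taylor coefficient is non-zero, the first such gives the order of the zero, and [g] and
    [g1] are the Taylor remainders of that order and of the next one, holomorphic as Cauchy
    transforms. *)
Lemma zero_factorization F a : holomorphic F -> (exists z, F z <> RtoC 0) -> F a = RtoC 0 ->
  exists r n g g1, 0 < r /\ g (RtoC 0) <> RtoC 0 /\
    forall w, Cmod w < r ->
      F (a + w)%C = (w ^ S n * g w)%C /\ g w = (g (RtoC 0) + w * g1 w)%C /\
      (exists d, is_cderive g w d) /\ (exists d, is_cderive g1 w d).
Proof.
  intros HF [z0 Hz0] Ha.
  set (G := fun w => F (a + w)%C).
  assert (HG : holomorphic G).
  { intros z; destruct (HF (a + z)%C) as [d Hd]; eexists.
    apply (is_cderive_comp F (fun w => a + w)%C); [exact Hd|].
    apply is_cderive_plus; [apply is_cderive_const|apply is_cderive_id]. }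
  set (r := Cmod (z0 - a) + 1).
  assert (Hr : 0 < r) by (unfold r; pose proof (Cmod_ge_0 (z0 - a)); lra).
  set (phi := cauchy_density G r).
  assert (Hphi : curve_continuous phi) by (apply cauchy_density_continuous, HG).
  set (c := fun k => cauchy_transform r (circ_shift r phi k)).
  assert (HGc : forall w, Cmod w < r -> G w = cauchy_transform r phi w)
    by (intros w Hw; apply cauchy_formula; assumption).
  assert (Hmin : exists m, c m 0 <> RtoC 0 /\ forall k, (k < m)%nat -> c k 0 = RtoC 0).
  { assert (Hex : exists k, c k 0 <> RtoC 0).
    { apply NNPP; intros N; apply Hz0.
      replace (F z0) with (G (z0 - a)%C) by (unfold G; f_equal; ring).
      assert (Hw : Cmod (z0 - a) < r) by (unfold r; lra).
      rewrite HGc by exact Hw; apply cauchy_transform_vanish; try assumption.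
      intros k; apply NNPP; intros Nk; apply N; exists k; exact Nk. }
    destruct Hex as [k0 Hk0].
    apply NNPP; intros N.
    assert (All : forall n k, (k < n)%nat -> c k 0 = RtoC 0).
    { induction n as [|n IH]; [lia|]; intros k Hk.
      apply NNPP; intros Nk; apply N; exists k; split; [exact Nk|].
      intros j Hj; apply IH; lia. }
    apply Hk0, (All (S k0)); lia. }
  destruct Hmin as [m [Hm Hlt]].
  assert (Hfac : forall w, Cmod w < r -> G w = (w ^ m * c m w)%C).
  { intros w Hw; rewrite HGc by exact Hw; apply cauchy_transform_factor; assumption. }
  destruct m as [|n].
  { exfalso; apply Hm.
    assert (E0 : G (RtoC 0) = RtoC 0) by (unfold G; rewrite Cplus_0_r; exact Ha).
    rewrite Hfac in E0 by (rewrite Cmod_0; exact Hr); simpl in E0.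
    rewrite Cmult_1_l in E0; exact E0. }
  exists r, n, (c (S n)), (c (S (S n))); split; [exact Hr|split; [exact Hm|]].
  intros w Hw; split; [apply Hfac, Hw|split; [|split]].
  - exact (cauchy_transform_taylor r Hr phi (S n) w Hphi Hw).
  - exact (cauchy_transform_derive r Hr _ w (circ_shift_continuous r Hr phi _ Hphi) Hw).
  - exact (cauchy_transform_derive r Hr _ w (circ_shift_continuous r Hr phi _ Hphi) Hw).
Qed.

(** * Gronwall estimates *)

Lemma nondecreasing_of_derive (f f' : R -> R) s t :
  s <= t -> (forall u, s <= u <= t -> is_derive f u (f' u)) ->
  (forall u, s <= u <= t -> 0 <= f' u) -> f s <= f t.
Proof.
  intros Hst Hd Hpos.
  destruct (MVT_gen f s t f') as [c [Hc E]].
  - rewrite Rmin_left, Rmax_right by lra; intros u Hu; apply Hd; lra.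
  - rewrite Rmin_left, Rmax_right by lra; intros u Hu.
    apply continuity_pt_filterlim, (ex_derive_continuous (V := R_NormedModule)).
    exists (f' u); apply Hd, Hu.
  - rewrite Rmin_left, Rmax_right in Hc by lra.
    specialize (Hpos c Hc); nra.
Qed.

(** The functions [- N exp (- K u)] and [N exp (K u)] are non-decreasing. *)
Lemma gronwall (N N' : R -> R) K s t :
  s <= t -> (forall u, s <= u <= t -> is_derive N u (N' u)) ->
  (forall u, s <= u <= t -> Rabs (N' u) <= K * N u) ->
  N t <= N s * exp (K * (t - s)) /\ N s <= N t * exp (K * (t - s)).
Proof.
  intros Hst Hd Hb.
  assert (Hexp : forall (f f' : R -> R) c, (forall u, s <= u <= t -> is_derive f u (f' u)) ->
     (forall u, s <= u <= t -> 0 <= f' u + c * f u) -> f s * exp (c * s) <= f t * exp (c * t)).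
  { intros f f' c Hf Hc.
    apply (nondecreasing_of_derive (fun u => f u * exp (c * u))
      (fun u => f' u * exp (c * u) + f u * (c * exp (c * u)))); [exact Hst| |].
    - intros u Hu; apply (is_derive_mult f (fun u => exp (c * u))); [apply Hf, Hu| |].
      + auto_derive; [trivial|ring].
      + intros; apply Rmult_comm.
    - intros u Hu; specialize (Hc u Hu); pose proof (exp_pos (c * u)); nra. }
  assert (Hb' : forall u, s <= u <= t -> - (K * N u) <= N' u <= K * N u).
  { intros u Hu; apply Rabs_le_between, Hb, Hu. }
  split.
  - assert (M : - N s * exp (- K * s) <= - N t * exp (- K * t)).
    { apply (Hexp (fun u => - N u) (fun u => - N' u)).
      - intros u Hu; apply (is_derive_opp (V := R_NormedModule) N), Hd, Hu.
      - intros u Hu; specialize (Hb' u Hu); lra. }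
    replace (K * (t - s)) with (- K * s + K * t) by ring; rewrite exp_plus.
    apply Rmult_le_reg_r with (exp (- K * t)); [apply exp_pos|].
    replace (N s * (exp (- K * s) * exp (K * t)) * exp (- K * t))
      with (N s * exp (- K * s) * (exp (K * t) * exp (- K * t))) by ring.
    rewrite <- exp_plus; replace (K * t + - K * t) with 0 by ring; rewrite exp_0; lra.
  - assert (M : N s * exp (K * s) <= N t * exp (K * t)).
    { apply (Hexp N N'); [exact Hd|].
      intros u Hu; specialize (Hb' u Hu); lra. }
    replace (K * (t - s)) with (K * t + - K * s) by ring; rewrite exp_plus.
    apply Rmult_le_reg_r with (exp (K * s)); [apply exp_pos|].
    replace (N t * (exp (K * t) * exp (- K * s)) * exp (K * s))
      with (N t * exp (K * t) * (exp (- K * s) * exp (K * s))) by ring.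
    rewrite <- exp_plus; replace (- K * s + K * s) with 0 by ring; rewrite exp_0; lra.
Qed.

Lemma is_derive_sqr_dist (g h : R -> C) t v w :
  is_curve_derive g t v -> is_curve_derive h t w ->
  is_derive (fun s => Cmod (g s - h s) * Cmod (g s - h s)) t
    (2 * (fst (g t - h t)%C * fst (v - w)%C + snd (g t - h t)%C * snd (v - w)%C)).
Proof.
  intros Hg Hh.
  apply (is_derive_ext (fun s => (fst (g s) - fst (h s)) * (fst (g s) - fst (h s))
     + (snd (g s) - snd (h s)) * (snd (g s) - snd (h s)))).
  { intros s; symmetry; exact (Cmod_sqr (g s - h s)). }
  pose proof (is_derive_minus (V := R_NormedModule) _ _ _ _ _
    (is_curve_derive_fst _ _ _ Hg) (is_curve_derive_fst _ _ _ Hh)) as D1.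
  pose proof (is_derive_minus (V := R_NormedModule) _ _ _ _ _
    (is_curve_derive_snd _ _ _ Hg) (is_curve_derive_snd _ _ _ Hh)) as D2.
  pose proof (is_derive_plus (V := R_NormedModule) _ _ _ _ _
    (is_derive_mult _ _ _ _ _ D1 D1 Rmult_comm) (is_derive_mult _ _ _ _ _ D2 D2 Rmult_comm)) as D.
  match type of D with is_derive _ _ ?l =>
    replace (2 * (fst (g t - h t)%C * fst (v - w)%C + snd (g t - h t)%C * snd (v - w)%C)) with l end.
  - exact D.
  - unfold plus, minus, mult, plus, opp; simpl; ring.
Qed.

Lemma Rabs_dot_le (a b : C) : Rabs (fst a * fst b + snd a * snd b) <= Cmod a * Cmod b.
Proof.
  apply Rsqr_incr_0_var.
  - rewrite <- Rsqr_abs; unfold Rsqr.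
    replace (Cmod a * Cmod b * (Cmod a * Cmod b)) with ((Cmod a * Cmod a) * (Cmod b * Cmod b)) by ring.
    rewrite !Cmod_sqr; pose proof (Rle_0_sqr (fst a * snd b - snd a * fst b)) as S.
    unfold Rsqr in S; lra.
  - apply Rmult_le_pos; apply Cmod_ge_0.
Qed.

(** Gronwall's estimates for the squared distance.  The first half gives continuous
    dependence on the initial value, the second one says that distinct solutions do not
    meet; together they give uniqueness in both time directions. *)
Lemma dist_growth (g h : R -> C) (v w : R -> C) L s t :
  s <= t -> 0 <= L ->
  (forall u, s <= u <= t -> is_curve_derive g u (v u) /\ is_curve_derive h u (w u) /\
     Cmod (v u - w u) <= L * Cmod (g u - h u)) ->
  Cmod (g t - h t) <= Cmod (g s - h s) * exp (L * (t - s)) /\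
  Cmod (g s - h s) <= Cmod (g t - h t) * exp (L * (t - s)).
Proof.
  intros Hst HL H.
  destruct (gronwall (fun u => Cmod (g u - h u) * Cmod (g u - h u))
    (fun u => 2 * (fst (g u - h u)%C * fst (v u - w u)%C + snd (g u - h u)%C * snd (v u - w u)%C))
    (2 * L) s t Hst) as [A B].
  - intros u Hu; destruct (H u Hu) as [Hg [Hh _]]; apply is_derive_sqr_dist; assumption.
  - intros u Hu; destruct (H u Hu) as [_ [_ Hl]].
    rewrite Rabs_mult, (Rabs_pos_eq 2) by lra.
    pose proof (Rabs_dot_le (g u - h u) (v u - w u)) as D.
    pose proof (Cmod_ge_0 (g u - h u)); nra.
  - replace (2 * L * (t - s)) with (L * (t - s) + L * (t - s)) in A, B by ring.
    rewrite exp_plus in A, B; pose proof (exp_pos (L * (t - s))) as E.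
    split; apply Rsqr_incr_0_var; unfold Rsqr.
    + nra.
    + apply Rmult_le_pos; [apply Cmod_ge_0|lra].
    + nra.
    + apply Rmult_le_pos; [apply Cmod_ge_0|lra].
Qed.

(** * Global solutions of a bounded Lipschitz field *)

Lemma le_0_of_geometric x K : (forall n, x <= K * (/ 2) ^ n) -> x <= 0.
Proof.
  intros H; apply Rnot_lt_le; intros Hx.
  assert (HK : 0 < K) by (specialize (H 0%nat); simpl in H; lra).
  destruct (pow_lt_1_zero (/ 2)) with (y := x / K) as [N HN];
    [rewrite Rabs_pos_eq; lra|apply Rdiv_lt_0_compat; lra|].
  specialize (HN N (Nat.le_refl N)); specialize (H N).
  rewrite Rabs_pos_eq in HN by (apply pow_le; lra).
  apply (Rmult_lt_compat_l K) in HN; [|exact HK].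
  replace (K * (x / K)) with x in HN by (field; lra); lra.
Qed.

Lemma geometric_limit (u : nat -> R) K :
  (forall n, Rabs (u (S n) - u n) <= K * (/ 2) ^ n) ->
  exists l, forall n, Rabs (l - u n) <= 2 * K * (/ 2) ^ n.
Proof.
  intros H.
  assert (HK : 0 <= K) by (specialize (H 0%nat); simpl in H; pose proof (Rabs_pos (u 1%nat - u 0%nat)); lra).
  assert (Hk : forall n k, Rabs (u (n + k)%nat - u n) <= 2 * K * ((/ 2) ^ n - (/ 2) ^ (n + k))).
  { intros n; induction k as [|k IH].
    - rewrite Nat.add_0_r, !Rminus_diag, Rabs_R0; lra.
    - rewrite Nat.add_succ_r; specialize (H (n + k)%nat).
      replace (u (S (n + k)) - u n) with (u (S (n + k)) - u (n + k)%nat + (u (n + k)%nat - u n)) by ring.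
      eapply Rle_trans; [apply Rabs_triang|]; simpl; nra. }
  assert (Hk' : forall n m, (n <= m)%nat -> Rabs (u m - u n) <= 2 * K * (/ 2) ^ n).
  { intros n m L; replace m with (n + (m - n))%nat by lia.
    eapply Rle_trans; [apply Hk|].
    assert (0 < (/ 2) ^ (n + (m - n))) by (apply pow_lt; lra); nra. }
  destruct (Rcomplete.R_complete u) as [l Hl].
  - intros e He.
    destruct (pow_lt_1_zero (/ 2)) with (y := e / (4 * K + 1)) as [N HN];
      [rewrite Rabs_pos_eq; lra|apply Rdiv_lt_0_compat; lra|].
    specialize (HN N (Nat.le_refl N)); rewrite Rabs_pos_eq in HN by (apply pow_le; lra).
    exists N; intros n m Hn Hm; unfold Rdist.
    replace (u n - u m) with (u n - u N - (u m - u N)) by ring.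
    eapply Rle_lt_trans; [apply Rabs_triang|]; rewrite Rabs_Ropp.
    pose proof (Hk' N n Hn); pose proof (Hk' N m Hm).
    assert (4 * K * (/ 2) ^ N < e); [|lra].
    assert (0 < (/ 2) ^ N) by (apply pow_lt; lra).
    apply Rlt_le_trans with ((4 * K + 1) * (/ 2) ^ N); [nra|].
    apply Rle_trans with ((4 * K + 1) * (e / (4 * K + 1))); [nra|right; field; lra].
  - exists l; intros n; apply Rnot_lt_le; intros Hn.
    destruct (Hl (Rabs (l - u n) - 2 * K * (/ 2) ^ n)) as [N HN]; [lra|].
    specialize (HN (N + n)%nat ltac:(lia)); unfold Rdist in HN.
    pose proof (Hk' n (N + n)%nat ltac:(lia)) as B.
    pose proof (Rabs_triang (l - u (N + n)%nat) (u (N + n)%nat - u n)) as T.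
    replace (l - u (N + n)%nat + (u (N + n)%nat - u n)) with (l - u n) in T by ring.
    rewrite (Rabs_minus_sym l (u (N + n)%nat)) in T; lra.
Qed.

Lemma Cgeometric_limit (u : nat -> C) K :
  (forall n, Cmod (u (S n) - u n) <= K * (/ 2) ^ n) ->
  exists l : C, forall n, Cmod (l - u n) <= 4 * K * (/ 2) ^ n.
Proof.
  intros H.
  destruct (geometric_limit (fun n => fst (u n)) K) as [a Ha].
  { intros n; eapply Rle_trans; [apply (Rabs_fst_le_Cmod (u (S n) - u n))|apply H]. }
  destruct (geometric_limit (fun n => snd (u n)) K) as [b Hb].
  { intros n; eapply Rle_trans; [apply (Rabs_snd_le_Cmod (u (S n) - u n))|apply H]. }
  exists (a, b); intros n; eapply Rle_trans; [apply Cmod_le_Rabs|]; simpl.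
  specialize (Ha n); specialize (Hb n); unfold Rminus in Ha, Hb; lra.
Qed.

(** In the sup norm weighted by the inverse of this function the Picard operator contracts
    by [1/2] on the whole line at once, which yields the global solution directly. *)
Definition weight (L t : R) : R := exp (2 * L * Rabs t).

Lemma Cmod_CInt_weight g D L t : 0 < L -> curve_continuous g ->
  (forall s, Cmod (g s) <= D * weight L s) ->
  Cmod (CInt g 0 t) <= D / (2 * L) * weight L t.
Proof.
  intros HL.
  assert (pos : forall g t, 0 <= t -> curve_continuous g ->
    (forall s, Cmod (g s) <= D * weight L s) ->
    Cmod (CInt g 0 t) <= D / (2 * L) * weight L t).
  { clear g t; intros g t Ht Hg H.
    assert (HD : 0 <= D).
    { specialize (H 0); pose proof (Cmod_ge_0 (g 0)); pose proof (exp_pos (2 * L * Rabs 0)).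
      unfold weight in H; nra. }
    apply Rle_trans with (D / (2 * L) * exp (2 * L * t) - D / (2 * L) * exp (2 * L * 0)).
    - rewrite <- norm_C_R.
      apply (norm_RInt_le (V := C_R_NormedModule) g (fun s => D * exp (2 * L * s)) 0 t); [exact Ht| | |].
      + intros s Hs; rewrite norm_C_R; specialize (H s); unfold weight in H.
        rewrite Rabs_pos_eq in H by lra; exact H.
      + apply (RInt_correct (V := C_R_CompleteNormedModule)), ex_CInt, Hg.
      + apply (is_RInt_derive (V := R_CompleteNormedModule) (fun s => D / (2 * L) * exp (2 * L * s))).
        * intros s _; auto_derive; [trivial|field; lra].
        * intros s _; apply (ex_derive_continuous (V := R_NormedModule)); auto_derive; trivial.
    - unfold weight; rewrite (Rabs_pos_eq t) by exact Ht.
      rewrite Rmult_0_r, exp_0.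
      assert (0 <= D / (2 * L)) by (apply Rmult_le_pos; [lra|apply Rlt_le, Rinv_0_lt_compat; lra]).
      lra. }
  intros Hg H; destruct (Rle_dec 0 t) as [Ht|Ht]; [apply pos; assumption|].
  assert (Hg' : curve_continuous (fun s => - g (- s)%R)%C).
  { intros s; apply continuous_Copp.
    apply (continuous_comp (fun s => - s) g); [|apply Hg].
    apply (continuous_opp (V := R_NormedModule)), continuous_id. }
  replace (CInt g 0 t) with (CInt (fun s => - g (- s)%R)%C 0 (- t)).
  - replace (weight L t) with (weight L (- t)) by (unfold weight; rewrite Rabs_Ropp; reflexivity).
    apply pos; [lra|exact Hg'|].
    intros s; rewrite Cmod_opp; specialize (H (- s)); unfold weight in *.
    rewrite Rabs_Ropp in H; exact H.
  - rewrite (CInt_derive (fun s => CInt g 0 (0 + - (1) * s))).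
    + rewrite Rmult_0_r, Rplus_0_r, CInt_point.
      replace (0 + - (1) * - t) with t by ring; ring.
    + intros s; replace (- g (- s)%R)%C with (RtoC (- (1)) * g (0 + - (1) * s)%R)%C.
      * apply (is_curve_derive_affine (fun s => CInt g 0 s) 0 (- (1)) s), CInt_primitive, Hg.
      * replace (0 + - (1) * s) with (- s) by ring; rewrite RtoC_opp; ring.
    + exact Hg'.
Qed.

Section Picard.
Variables (G : C -> C) (L B : R) (y : C).
Hypothesis L_pos : 0 < L.
Hypothesis B_pos : 0 < B.
Hypothesis G_lip : forall z w, Cmod (G z - G w) <= L * Cmod (z - w).
Hypothesis G_bound : forall z, Cmod (G z) <= B.

Fixpoint picard (n : nat) (t : R) : C :=
  match n with
  | O => y
  | S k => (y + CInt (fun s => G (picard k s)) 0 t)%C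
  end.

Lemma lipschitz_continuous : C_continuous G.
Proof.
  intros z; apply continuous_Cmod; intros e He; apply locally_disc.
  exists (e / L); split; [apply Rdiv_lt_0_compat; lra|]; intros w Hw.
  eapply Rle_lt_trans; [apply G_lip|].
  apply (Rmult_lt_compat_l L) in Hw; [|exact L_pos].
  replace (L * (e / L)) with e in Hw by (field; lra); exact Hw.
Qed.

Lemma continuous_G_comp g : curve_continuous g -> curve_continuous (fun s => G (g s)).
Proof. intros H t; apply (continuous_comp g G); [apply H|apply lipschitz_continuous]. Qed.

Lemma lipschitz_curve_continuous g K :
  (forall s t, Cmod (g t - g s) <= K * Rabs (t - s)) -> curve_continuous g.
Proof.
  intros H t; apply continuous_Cmod; intros e He; apply locally_R.
  exists (e / (Rabs K + 1)); pose proof (Rabs_pos K); split; [apply Rdiv_lt_0_compat; lra|].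
  intros s Hs; eapply Rle_lt_trans; [apply H|].
  pose proof (Rle_abs K); pose proof (Rabs_pos (s - t)).
  apply Rle_lt_trans with ((Rabs K + 1) * Rabs (s - t)); [nra|].
  apply Rlt_le_trans with ((Rabs K + 1) * (e / (Rabs K + 1))); [nra|right; field; lra].
Qed.

(** The bound does not depend on [n], so it passes to a pointwise limit of the iterates,
    which is then continuous. *)
Lemma picard_lipschitz n s t : Cmod (picard n t - picard n s) <= B * Rabs (t - s).
Proof.
  revert s t; induction n as [|n IH]; intros s t; simpl.
  - replace (y - y)%C with (RtoC 0) by ring; rewrite Cmod_0.
    apply Rmult_le_pos; [lra|apply Rabs_pos].
  - assert (Hc : curve_continuous (fun u => G (picard n u)))
      by (apply continuous_G_comp, (lipschitz_curve_continuous _ B), IH).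
    rewrite <- (CInt_Chasles _ 0 s t Hc).
    replace (y + (CInt (fun u => G (picard n u)) 0 s + CInt (fun u => G (picard n u)) s t)
       - (y + CInt (fun u => G (picard n u)) 0 s))%C
      with (CInt (fun u => G (picard n u)) s t) by ring.
    apply Cmod_CInt_le; [exact Hc|]; intros; apply G_bound.
Qed.

Lemma picard_continuous n : curve_continuous (picard n).
Proof. apply (lipschitz_curve_continuous _ B); intros; apply picard_lipschitz. Qed.

Lemma picard_cauchy n t :
  Cmod (picard (S n) t - picard n t) <= B / (2 * L) * (/ 2) ^ n * weight L t.
Proof.
  revert t; induction n as [|n IH]; intros t.
  - simpl; rewrite Rmult_1_r.
    replace (y + CInt (fun _ => G y) 0 t - y)%C with (CInt (fun _ => G y) 0 t) by ring.
    apply Cmod_CInt_weight; [exact L_pos|intros s; apply continuous_const|].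
    intros s; eapply Rle_trans; [apply G_bound|].
    rewrite <- (Rmult_1_r B) at 1; apply Rmult_le_compat_l; [lra|].
    unfold weight; rewrite <- exp_0; 
    destruct (Req_dec s 0) as [->|Ns]; [rewrite Rabs_R0, Rmult_0_r; lra|].
    apply Rlt_le, exp_increasing.
    pose proof (Rabs_pos_lt s Ns); nra.
  - change (picard (S (S n)) t) with (y + CInt (fun s => G (picard (S n) s)) 0 t)%C.
    change (picard (S n) t) with (y + CInt (fun s => G (picard n s)) 0 t)%C at 1.
    replace (y + CInt (fun s => G (picard (S n) s)) 0 t - (y + CInt (fun s => G (picard n s)) 0 t))%C
      with (CInt (fun s => G (picard (S n) s)) 0 t - CInt (fun s => G (picard n s)) 0 t)%C by ring.
    assert (C1 : curve_continuous (fun s => G (picard (S n) s)))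
      by (apply continuous_G_comp, picard_continuous).
    assert (C2 : curve_continuous (fun s => G (picard n s)))
      by (apply continuous_G_comp, picard_continuous).
    rewrite <- CInt_minus by assumption.
    replace (B / (2 * L) * (/ 2) ^ S n) with (L * (B / (2 * L) * (/ 2) ^ n) / (2 * L))
      by (simpl; field; lra).
    apply Cmod_CInt_weight; [exact L_pos| |].
    + intros s; apply continuous_Cminus; [apply C1|apply C2].
    + intros s; eapply Rle_trans; [apply G_lip|].
      rewrite Rmult_assoc; apply Rmult_le_compat_l; [lra|apply IH].
Qed.

Theorem lipschitz_global_solution :
  exists g : R -> C, g 0 = y /\ forall t, is_curve_derive g t (G (g t)).
Proof.
  set (K := B / (2 * L)).
  assert (lim : forall t, exists l : C,
     forall n, Cmod (l - picard n t) <= 4 * (K * weight L t) * (/ 2) ^ n).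
  { intros t; apply Cgeometric_limit; intros n.
    eapply Rle_trans; [apply picard_cauchy|]; right; unfold K; ring. }
  pose (g := fun t => proj1_sig (constructive_indefinite_description _ (lim t))).
  assert (Hg : forall t n, Cmod (g t - picard n t) <= 4 * (K * weight L t) * (/ 2) ^ n).
  { intros t; exact (proj2_sig (constructive_indefinite_description _ (lim t))). }
  clearbody g.
  assert (Hlip : forall s t, Cmod (g t - g s) <= B * Rabs (t - s)).
  { intros s t; apply Rminus_le.
    apply (le_0_of_geometric _ (4 * (K * weight L t) + 4 * (K * weight L s))); intros n.
    pose proof (Hg t n) as Ht; pose proof (Hg s n) as Hs.
    pose proof (picard_lipschitz n s t) as Hp.
    replace (g t - g s)%C with (g t - picard n t + (picard n t - picard n s) + - (g s - picard n s))%C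
      by ring.
    pose proof (Cmod_triangle (g t - picard n t + (picard n t - picard n s)) (- (g s - picard n s))) as T1.
    pose proof (Cmod_triangle (g t - picard n t) (picard n t - picard n s)) as T2.
    rewrite Cmod_opp in T1; lra. }
  assert (Hgc : curve_continuous g) by (apply (lipschitz_curve_continuous _ B), Hlip).
  assert (HGc : curve_continuous (fun s => G (g s))) by (apply continuous_G_comp, Hgc).
  assert (E : forall t, g t = (y + CInt (fun s => G (g s)) 0 t)%C).
  { intros t; apply Ceq_minus, Cmod_eq_0, Rle_antisym; [|apply Cmod_ge_0].
    apply (le_0_of_geometric _ (4 * (K * weight L t))); intros n.
    pose proof (Hg t (S n)) as Ht.
    assert (Cn : curve_continuous (fun s => G (picard n s)))
      by (apply continuous_G_comp, picard_continuous).
    assert (HI : Cmod (CInt (fun s => G (picard n s) - G (g s))%C 0 t)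
       <= L * (4 * K * (/ 2) ^ n) / (2 * L) * weight L t).
    { apply Cmod_CInt_weight; [exact L_pos| |].
      - intros s; apply continuous_Cminus; [apply Cn|apply HGc].
      - intros s; eapply Rle_trans; [apply G_lip|].
        rewrite Rmult_assoc; apply Rmult_le_compat_l; [lra|].
        rewrite Cmod_minus_sym; eapply Rle_trans; [apply Hg|right; ring]. }
    rewrite CInt_minus in HI by assumption.
    replace (g t - (y + CInt (fun s => G (g s)) 0 t))%C
      with ((g t - picard (S n) t)
        + (CInt (fun s => G (picard n s)) 0 t - CInt (fun s => G (g s)) 0 t))%C by (simpl; ring).
    eapply Rle_trans; [apply Cmod_triangle|].
    replace (L * (4 * K * (/ 2) ^ n) / (2 * L) * weight L t)
      with (2 * (K * weight L t) * (/ 2) ^ n) in HI by (field; lra).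
    rewrite <- tech_pow_Rmult in Ht; lra. }
  exists g; split.
  - rewrite E, CInt_point; ring.
  - intros t.
    apply (is_derive_ext (V := C_R_NormedModule) (fun t => y + CInt (fun s => G (g s)) 0 t)%C).
    { intros s; symmetry; apply E. }
    replace (G (g t)) with (RtoC 1 * G (g t))%C by ring.
    apply (is_curve_derive_comp (fun z => y + z)%C (fun t => CInt (fun s => G (g s)) 0 t)).
    + rewrite <- (Cplus_0_l 1); apply is_cderive_plus; [apply is_cderive_const|apply is_cderive_id].
    + exact (CInt_primitive (fun s => G (g s)) 0 t HGc).
Qed.

End Picard.

(** * Truncated fields and uniqueness *)

Definition clampR (r x : R) : R := Rmax (- r) (Rmin r x).
Definition clamp (r : R) (z : C) : C := (clampR r (fst z), clampR r (snd z)).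

Lemma clampR_lipschitz r x y : Rabs (clampR r x - clampR r y) <= Rabs (x - y).
Proof.
  unfold clampR, Rmax, Rmin.
  destruct (Rle_dec r x), (Rle_dec r y); repeat destruct Rle_dec;
    unfold Rabs; repeat destruct Rcase_abs; lra.
Qed.

Lemma clampR_bound r x : 0 <= r -> Rabs (clampR r x) <= r.
Proof.
  intros Hr; unfold clampR, Rmax, Rmin; repeat destruct Rle_dec;
    unfold Rabs; destruct Rcase_abs; lra.
Qed.

Lemma clamp_lipschitz r z w : Cmod (clamp r z - clamp r w) <= 2 * Cmod (z - w).
Proof.
  eapply Rle_trans; [apply Cmod_le_Rabs|]; simpl.
  pose proof (clampR_lipschitz r (fst z) (fst w)) as A.
  pose proof (clampR_lipschitz r (snd z) (snd w)) as B.
  pose proof (Rabs_fst_le_Cmod (z - w)) as D; pose proof (Rabs_snd_le_Cmod (z - w)) as E.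
  simpl in D, E; unfold Rminus in A, B; lra.
Qed.

Lemma clamp_bound r z : 0 <= r -> Cmod (clamp r z) <= 2 * r.
Proof.
  intros Hr; eapply Rle_trans; [apply Cmod_le_Rabs|]; simpl.
  pose proof (clampR_bound r (fst z) Hr); pose proof (clampR_bound r (snd z) Hr); lra.
Qed.

Lemma clamp_id r z : in_square r z -> clamp r z = z.
Proof.
  intros [H1 H2]; apply Rabs_def2 in H1, H2.
  unfold clamp, clampR; apply injective_projections; simpl;
    rewrite Rmin_right, Rmax_right by lra; reflexivity.
Qed.

Lemma in_square_Cmod r z : Cmod z < r -> in_square r z.
Proof.
  intros H; split; [pose proof (Rabs_fst_le_Cmod z)|pose proof (Rabs_snd_le_Cmod z)]; lra.
Qed.

Lemma clamp_continuous r : C_continuous (clamp r).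
Proof.
  intros z; apply continuous_Cmod; intros e He; apply locally_disc.
  exists (e / 2); split; [lra|]; intros w Hw; pose proof (clamp_lipschitz r w z); lra.
Qed.

Lemma truncation_lipschitz F r : holomorphic F -> 0 < r ->
  exists L, 0 < L /\ forall z w, Cmod (F (clamp r z) - F (clamp r w)) <= L * Cmod (z - w).
Proof.
  intros HF Hr; destruct (holomorphic_lipschitz F (2 * r) HF ltac:(lra)) as [L [HL H]].
  exists (L * 2); split; [lra|]; intros z w.
  eapply Rle_trans; [apply H; apply clamp_bound; lra|].
  rewrite Rmult_assoc; apply Rmult_le_compat_l; [lra|apply clamp_lipschitz].
Qed.

Lemma truncation_bounded F r : holomorphic F -> 0 < r ->
  exists B, 0 < B /\ forall z, Cmod (F (clamp r z)) <= B.
Proof.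
  intros HF Hr.
  destruct (holomorphic_lipschitz F (2 * r) HF ltac:(lra)) as [K [HK HB]].
  exists (K * (2 * r) + Cmod (F (RtoC 0)) + 1); split.
  - pose proof (Cmod_ge_0 (F (RtoC 0))); nra.
  - intros z; specialize (HB (clamp r z) (RtoC 0) (clamp_bound r z ltac:(lra))
      ltac:(rewrite Cmod_0; lra)).
    rewrite Cminus_0_r in HB; pose proof (clamp_bound r z ltac:(lra)) as Hz.
    pose proof (Cmod_triangle_minus (F (clamp r z)) (F (RtoC 0))); nra.
Qed.

Lemma curve_bounded_on (g : R -> C) s t :
  (forall u, s <= u <= t -> continuous (T := R_UniformSpace) (U := C_UniformSpace) g u) ->
  exists M, 0 < M /\ forall u, s <= u <= t -> Cmod (g u) <= M.
Proof.
  intros H; destruct (bounded_continuity (V := C_R_NormedModule) g s t) as [M HM].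
  - intros u Hu; apply H, Hu.
  - exists (Rabs M + 1); split; [pose proof (Rabs_pos M); lra|].
    intros u Hu; specialize (HM u Hu); rewrite norm_C_R in HM.
    pose proof (Rle_abs M); lra.
Qed.

Lemma solutions_agree F (g h : R -> C) s t : holomorphic F -> s <= t ->
  (forall u, s <= u <= t -> is_curve_derive g u (F (g u))) ->
  (forall u, s <= u <= t -> is_curve_derive h u (F (h u))) ->
  (g s = h s <-> g t = h t).
Proof.
  intros HF Hst Hg Hh.
  destruct (curve_bounded_on g s t) as [M [HM BM]].
  { intros u Hu; eapply is_curve_derive_continuous, Hg, Hu. }
  destruct (curve_bounded_on h s t) as [N [HN BN]].
  { intros u Hu; eapply is_curve_derive_continuous, Hh, Hu. }
  destruct (holomorphic_lipschitz F (M + N) HF ltac:(lra)) as [L [HL Lip]].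
  destruct (dist_growth g h (fun u => F (g u)) (fun u => F (h u)) L s t Hst ltac:(lra)) as [A B].
  { intros u Hu; split; [apply Hg, Hu|split; [apply Hh, Hu|]].
    apply Lip; [specialize (BM u Hu)|specialize (BN u Hu)]; lra. }
  pose proof (Cmod_ge_0 (g s - h s)); pose proof (Cmod_ge_0 (g t - h t)).
  split; intros E; apply Ceq_minus, Cmod_eq_0.
  - rewrite E in A; replace (h s - h s)%C with (RtoC 0) in A by ring; rewrite Cmod_0 in A; lra.
  - rewrite E in B; replace (h t - h t)%C with (RtoC 0) in B by ring; rewrite Cmod_0 in B; lra.
Qed.

(** * Lyapunov functions *)

Definition tends_to (g : R -> C) (a : C) : Prop :=
  forall e, 0 < e -> exists T, forall t, T <= t -> Cmod (g t - a) < e.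

(** Here [V] stands in for the time coordinate near an attracting equilibrium.  Its domain is
    the whole punctured plane, so that the set where [V] is large needs no intersection with
    a disc: it lies near [a] by itself. *)
Definition lyapunov (F : C -> C) (a : C) (V : C -> R) (k p : R) : Prop :=
  0 < k /\ 0 < p /\
  (forall z, z <> a -> continuous (T := C_UniformSpace) (U := R_UniformSpace) V z) /\
  (forall e, 0 < e -> exists N, forall z, z <> a -> N < V z -> Cmod (z - a) < e) /\
  (forall (g : R -> C) t, g t <> a -> Cmod (g t - a) < p -> is_curve_derive g t (F (g t)) ->
     exists l, k <= l /\ is_derive (fun s => V (g s)) t l).

(** The function [W = -1 / ((n + 1) c (z - a) ^ (n + 1))] is a primitive of
    [1 / (c (z - a) ^ (n + 2))], so [W] has derivative [g / c] along solutions, which is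
    close to [1]; no residue of [1 / F] enters. *)
Lemma lyapunov_multiple F a r n g : 0 < r -> g (RtoC 0) <> RtoC 0 ->
  continuous (T := C_UniformSpace) (U := C_UniformSpace) g (RtoC 0) ->
  (forall w, Cmod w < r -> F (a + w)%C = (w ^ S (S n) * g w)%C) ->
  exists V k p, lyapunov F a V k p.
Proof.
  intros Hr Hc Hg HF.
  set (c := g (RtoC 0)) in *.
  set (m := RtoC (INR (S n))).
  assert (Hm : m <> RtoC 0) by (intros E; apply RtoC_inj in E; revert E; apply not_0_INR; lia).
  assert (Hcp : 0 < Cmod c) by (apply Cmod_gt_0, Hc).
  set (W := fun z => (- / (m * c) * / (z - a) ^ S n)%C).
  assert (HW : forall z, z <> a -> is_cderive W z (/ (c * (z - a) ^ S (S n)))%C).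
  { intros z Hz; assert (Hza : (z - a)%C <> RtoC 0) by (apply Cminus_eq_contra, Hz).
    assert (Hzn : ((z - a) ^ n)%C <> RtoC 0) by (apply Cpow_nz, Hza).
    assert (Hzn1 : ((z - a) ^ S n)%C <> RtoC 0) by (apply Cpow_nz, Hza).
    pose proof (is_cderive_mult (fun _ => - / (m * c))%C (fun z => / (z - a) ^ S n)%C z 0
      (- / ((z - a) ^ S n * (z - a) ^ S n) * (m * (z - a) ^ n * (1 + 0)))
      (is_cderive_const _ _)) as D.
    replace (/ (c * (z - a) ^ S (S n)))%C with
      (0 * / (z - a) ^ S n + - / (m * c) *
        (- / ((z - a) ^ S n * (z - a) ^ S n) * (m * (z - a) ^ n * (1 + 0))))%C.
    - apply D, (is_cderive_comp Cinv (fun z => (z - a) ^ S n)%C).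
      + apply is_cderive_inv, Hzn1.
      + apply (is_cderive_comp (fun z => z ^ S n)%C (fun z => z - a)%C); [apply is_cderive_pow|].
        apply is_cderive_plus; [apply is_cderive_id|apply is_cderive_const].
    - rewrite !Cpow_S; field; repeat split; assumption. }
  destruct (proj1 (locally_disc _ _) (proj1 (continuous_Cmod _ _) Hg (Cmod c / 2) ltac:(lra)))
    as [d [Hd Hgd]].
  exists (fun z => fst (W z)), (1 / 2), (Rmin r d).
  split; [lra|]; split; [apply Rmin_glb_lt; assumption|]; split; [|split].
  - intros z Hz; apply continuous_Cfst; eapply is_cderive_continuous, HW, Hz.
  - intros e He; exists (/ (INR (S n) * Cmod c * e ^ S n)); intros z Hz HN.
    assert (Hza : (z - a)%C <> RtoC 0) by (apply Cminus_eq_contra, Hz).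
    assert (Hzp : 0 < Cmod (z - a)) by (apply Cmod_gt_0, Hza).
    apply Rnot_le_lt; intros Hle.
    assert (Hnp : 0 < INR (S n)) by (apply lt_0_INR; lia).
    assert (Hep : 0 < e ^ S n) by (apply pow_lt, He).
    assert (Hpw : e ^ S n <= Cmod (z - a) ^ S n) by (apply pow_incr; lra).
    assert (HWz : Cmod (W z) = / (INR (S n) * Cmod c * Cmod (z - a) ^ S n)).
    { unfold W; rewrite Cmod_mult, Cmod_opp, !Cmod_inv, Cmod_mult, Cmod_pow.
      - unfold m; rewrite Cmod_R, Rabs_pos_eq by lra.
        field; repeat split; try lra; apply pow_nonzero; lra.
      - apply Cpow_nz, Hza.
      - apply Cmult_neq_0; assumption. }
    pose proof (Rabs_fst_le_Cmod (W z)) as B; rewrite HWz in B.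
    pose proof (Rle_abs (fst (W z))).
    assert (Hpp : 0 < INR (S n) * Cmod c) by (apply Rmult_lt_0_compat; assumption).
    assert (/ (INR (S n) * Cmod c * Cmod (z - a) ^ S n) <= / (INR (S n) * Cmod c * e ^ S n)).
    { apply Rinv_le_contravar; [apply Rmult_lt_0_compat; assumption|].
      apply Rmult_le_compat_l; lra. }
    lra.
  - intros h t Ht Hp Hh.
    assert (Hpr : Cmod (h t - a) < r) by (eapply Rlt_le_trans; [exact Hp|apply Rmin_l]).
    assert (Hpd : Cmod (h t - a) < d) by (eapply Rlt_le_trans; [exact Hp|apply Rmin_r]).
    assert (Hza : (h t - a)%C <> RtoC 0) by (apply Cminus_eq_contra, Ht).
    exists (fst (g (h t - a) / c)%C); split.
    + specialize (Hgd (h t - a)%C); rewrite Cminus_0_r in Hgd; specialize (Hgd Hpd).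
      fold c in Hgd.
      replace (g (h t - a) / c)%C with (RtoC 1 + (g (h t - a)%C - c) / c)%C by (field; exact Hc).
      pose proof (Rabs_fst_le_Cmod ((g (h t - a) - c) / c)%C) as B.
      rewrite Cmod_div in B by exact Hc.
      assert (Cmod (g (h t - a)%C - c) / Cmod c <= 1 / 2).
      { apply Rmult_le_reg_r with (Cmod c); [exact Hcp|].
        unfold Rdiv at 1; rewrite Rmult_assoc, Rinv_l by lra; lra. }
      pose proof (Rabs_le_between (fst ((g (h t - a)%C - c) / c)%C) (1 / 2)) as [A _].
      specialize (A ltac:(lra)).
      change (1 / 2 <= 1 + fst ((g (h t - a)%C - c) / c)%C); lra.
    + apply is_curve_derive_fst.
      replace (g (h t - a) / c)%C with (/ (c * (h t - a) ^ S (S n)) * F (h t))%C.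
      * apply (is_curve_derive_comp W h); [apply HW, Ht|exact Hh].
      * replace (F (h t)) with (F (a + (h t - a)))%C by (f_equal; ring).
        rewrite HF by exact Hpr; field; split; [exact Hc|apply Cpow_nz, Hza].
Qed.

Lemma is_derive_ln_dist F a r g (h : R -> C) t :
  (forall w, Cmod w < r -> F (a + w)%C = (w * g w)%C) ->
  h t <> a -> Cmod (h t - a) < r -> is_curve_derive h t (F (h t)) ->
  is_derive (fun s => ln (Cmod (h s - a) * Cmod (h s - a))) t (2 * fst (g (h t - a)%C)).
Proof.
  intros HF Ht Hr Hh.
  assert (Hp : 0 < Cmod (h t - a)) by (apply Cmod_gt_0, Cminus_eq_contra, Ht).
  assert (Hpp : 0 < Cmod (h t - a) * Cmod (h t - a)) by nra.
  assert (Ha : is_curve_derive (fun _ => a) t (RtoC 0))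
    by (apply (is_derive_const (V := C_R_NormedModule))).
  pose proof (is_derive_sqr_dist h (fun _ => a) t _ _ Hh Ha) as D.
  assert (Dln : is_derive ln (Cmod (h t - a) * Cmod (h t - a)) (/ (Cmod (h t - a) * Cmod (h t - a))))
    by (apply is_derive_Reals, derivable_pt_lim_ln, Hpp).
  pose proof (is_derive_comp ln _ t _ _ Dln D) as E.
  rewrite Cminus_0_r in E.
  replace (F (h t)) with ((h t - a) * g (h t - a))%C in E
    by (rewrite <- HF by exact Hr; f_equal; ring).
  set (x := (h t - a)%C) in *; set (y := g x) in *.
  replace (2 * fst y) with (2 * (fst x * fst (x * y)%C + snd x * snd (x * y)%C) * / (Cmod x * Cmod x)).
  - exact E.
  - rewrite Cmod_sqr in Hpp |- *; simpl; field; simpl in Hpp; lra.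
Qed.

Lemma lyapunov_sink F a r g : 0 < r -> fst (g (RtoC 0)) < 0 ->
  continuous (T := C_UniformSpace) (U := C_UniformSpace) g (RtoC 0) ->
  (forall w, Cmod w < r -> F (a + w)%C = (w * g w)%C) ->
  exists V k p, lyapunov F a V k p.
Proof.
  intros Hr Hl Hg HF.
  set (l := fst (g (RtoC 0))) in *.
  destruct (proj1 (locally_disc _ _) (proj1 (continuous_Cmod _ _) Hg (- l / 2) ltac:(lra)))
    as [d [Hd Hgd]].
  exists (fun z => - ln (Cmod (z - a) * Cmod (z - a))), (- l), (Rmin r d).
  split; [lra|]; split; [apply Rmin_glb_lt; assumption|]; split; [|split].
  - intros z Hz.
    assert (Hp : 0 < Cmod (z - a)) by (apply Cmod_gt_0, Cminus_eq_contra, Hz).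
    assert (Hc : continuous (fun z : C_UniformSpace => Cmod (z - a)) z).
    { apply continuous_Cmod_comp, continuous_Cminus; [apply continuous_id|apply continuous_const]. }
    apply (continuous_opp (V := R_NormedModule)).
    apply (continuous_comp (fun z : C_UniformSpace => Cmod (z - a) * Cmod (z - a)) ln).
    + apply (continuous_mult (K := R_AbsRing)); exact Hc.
    + apply (ex_derive_continuous (V := R_NormedModule)); eexists.
      apply is_derive_Reals, derivable_pt_lim_ln; nra.
  - intros e He; exists (- ln (e * e)); intros z Hz HN.
    assert (Hp : 0 < Cmod (z - a)) by (apply Cmod_gt_0, Cminus_eq_contra, Hz).
    assert (L : ln (Cmod (z - a) * Cmod (z - a)) < ln (e * e)) by lra.
    apply ln_lt_inv in L; nra.
  - intros h t Ht Hp Hh.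
    assert (Hpr : Cmod (h t - a) < r) by (eapply Rlt_le_trans; [exact Hp|apply Rmin_l]).
    assert (Hpd : Cmod (h t - a) < d) by (eapply Rlt_le_trans; [exact Hp|apply Rmin_r]).
    exists (- (2 * fst (g (h t - a)%C))); split.
    + specialize (Hgd (h t - a)%C); rewrite Cminus_0_r in Hgd; specialize (Hgd Hpd).
      pose proof (Rabs_fst_le_Cmod (g (h t - a)%C - g (RtoC 0))%C) as B.
      pose proof (Rabs_le_between (fst (g (h t - a)%C - g (RtoC 0))%C) (- l / 2)) as [A _].
      specialize (A ltac:(lra)); simpl in A; fold l in A; lra.
    + apply (is_derive_opp (V := R_NormedModule)).
      apply (is_derive_ln_dist F a r g); assumption.
Qed.

(** Composition with the retraction [clamp] extends the restriction of the quotient to a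
    small square continuously to the whole plane, as integration along sides asks for. *)
Lemma local_primitive_quotient g g1 r : 0 < r -> g (RtoC 0) <> RtoC 0 ->
  (forall w, Cmod w < r -> exists d, is_cderive g w d) ->
  (forall w, Cmod w < r -> exists d, is_cderive g1 w d) ->
  exists K s, 0 < s /\ forall w, Cmod w < s -> is_cderive K w (g1 w / g w)%C.
Proof.
  intros Hr Hg0 Hg Hg1.
  assert (Cg : forall w, Cmod w < r -> continuous (T := C_UniformSpace) (U := C_UniformSpace) g w).
  { intros w Hw; destruct (Hg w Hw) as [d Hd]; eapply is_cderive_continuous, Hd. }
  assert (Cg1 : forall w, Cmod w < r -> continuous (T := C_UniformSpace) (U := C_UniformSpace) g1 w).
  { intros w Hw; destruct (Hg1 w Hw) as [d Hd]; eapply is_cderive_continuous, Hd. }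
  assert (N : locally (T := C_UniformSpace) (RtoC 0) (fun w => g w <> RtoC 0)).
  { apply continuous_neq0; [apply Cg; rewrite Cmod_0; exact Hr|exact Hg0]. }
  apply locally_disc in N; destruct N as [d [Hd N]].
  set (s := Rmin r d / 3).
  assert (Hm : 0 < Rmin r d) by (apply Rmin_glb_lt; assumption).
  pose proof (Rmin_l r d) as Ml; pose proof (Rmin_r r d) as Mr.
  assert (Hs : 0 < s) by (unfold s; lra).
  assert (Hc : forall w, Cmod (clamp s w) < r /\ g (clamp s w) <> RtoC 0).
  { intros w; pose proof (clamp_bound s w ltac:(lra)) as B; split.
    - unfold s in *; lra.
    - apply N; rewrite Cminus_0_r; unfold s in *; lra. }
  set (k := fun w => (g1 (clamp s w) * / g (clamp s w))%C).
  exists (square_primitive k), s; split; [exact Hs|]; intros w Hw.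
  assert (Hsq := in_square_Cmod s w Hw).
  replace (g1 w / g w)%C with (k w) by (unfold k; rewrite clamp_id by exact Hsq; reflexivity).
  apply (is_cderive_square_primitive k s); [| |exact Hsq].
  - intros z; destruct (Hc z) as [H1 H2].
    apply continuous_Cdiv; [| |exact H2].
    + apply (continuous_comp (clamp s) g1); [apply clamp_continuous|apply Cg1, H1].
    + apply (continuous_comp (clamp s) g); [apply clamp_continuous|apply Cg, H1].
  - intros z Hz _; destruct (Hc z) as [H1 H2]; rewrite clamp_id in H1, H2 by exact Hz.
    destruct (Hg z H1) as [dg Hdg], (Hg1 z H1) as [dg1 Hdg1]; eexists.
    apply (is_cderive_ext_loc (fun w => g1 w * / g w)%C).
    + destruct Hz as [Hx Hy].
      apply locally_disc; exists (Rmin (s - Rabs (fst z)) (s - Rabs (snd z))).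
      split; [apply Rmin_glb_lt; lra|]; intros v Hv.
      unfold k; rewrite clamp_id; [reflexivity|].
      pose proof (Rabs_fst_le_Cmod (v - z)) as Dx; pose proof (Rabs_snd_le_Cmod (v - z)) as Dy.
      simpl in Dx, Dy.
      pose proof (Rmin_l (s - Rabs (fst z)) (s - Rabs (snd z))).
      pose proof (Rmin_r (s - Rabs (fst z)) (s - Rabs (snd z))).
      pose proof (Rabs_triang_inv (fst v) (fst z)); pose proof (Rabs_triang_inv (snd v) (snd z)).
      unfold Rminus in *; split; lra.
    + apply is_cderive_mult; [exact Hdg1|].
      apply (is_cderive_comp Cinv g); [apply is_cderive_inv, H2|exact Hdg].
Qed.

(** Write [F (a + w) = w g(w)] and [g w = l + w g1(w)], and let [K] be a primitive of
    [g1 / g].  The function [ln |w|^2 - 2 Re K(w)] has derivative [2 Re l >= 0] along solutions; this is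
    the logarithm of the squared modulus of a linearizing coordinate, and on the approach
    to [a] it would tend to minus infinity. *)
Lemma no_convergence_to_source_or_center F a r g g1 (h : R -> C) : 0 < r ->
  g (RtoC 0) <> RtoC 0 -> 0 <= fst (g (RtoC 0)) ->
  (forall w, Cmod w < r -> F (a + w)%C = (w * g w)%C /\ g w = (g (RtoC 0) + w * g1 w)%C /\
     (exists d, is_cderive g w d) /\ (exists d, is_cderive g1 w d)) ->
  (forall t, 0 <= t -> is_curve_derive h t (F (h t))) ->
  (forall t, 0 <= t -> h t <> a) -> ~ tends_to h a.
Proof.
  intros Hr Hg0 Hl H Hh Hne Hlim.
  destruct (local_primitive_quotient g g1 r Hr Hg0) as [K [s [Hs HK]]];
    [intros; apply H; assumption|intros; apply H; assumption|].
  assert (CK : continuous (T := C_UniformSpace) (U := C_UniformSpace) K (RtoC 0)).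
  { eapply is_cderive_continuous, HK; rewrite Cmod_0; exact Hs. }
  destruct (proj1 (locally_disc _ _) (proj1 (continuous_Cmod _ _) CK 1 Rlt_0_1)) as [d [Hd HKd]].
  assert (Ng : locally (T := C_UniformSpace) (RtoC 0) (fun w => g w <> RtoC 0)).
  { apply continuous_neq0; [|exact Hg0].
    destruct (H (RtoC 0)) as [_ [_ [[dg Hdg] _]]]; [rewrite Cmod_0; exact Hr|].
    eapply is_cderive_continuous, Hdg. }
  apply locally_disc in Ng; destruct Ng as [d2 [Hd2 Ng]].
  set (p := Rmin (Rmin r s) (Rmin d d2)).
  assert (Hp : 0 < p) by (unfold p; repeat apply Rmin_glb_lt; assumption).
  assert (Pr : p <= r) by (eapply Rle_trans; [apply Rmin_l|apply Rmin_l]).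
  assert (Ps : p <= s) by (eapply Rle_trans; [apply Rmin_l|apply Rmin_r]).
  assert (Pd : p <= d) by (eapply Rle_trans; [apply Rmin_r|apply Rmin_l]).
  assert (Pd2 : p <= d2) by (eapply Rle_trans; [apply Rmin_r|apply Rmin_r]).
  destruct (Hlim p Hp) as [T0 HT0].
  set (T := Rmax 0 T0).
  assert (HT : 0 <= T) by apply Rmax_l.
  assert (Hin : forall t, T <= t -> Cmod (h t - a) < p).
  { intros t Ht; apply HT0; eapply Rle_trans; [apply Rmax_r|exact Ht]. }
  set (u := fun t => ln (Cmod (h t - a) * Cmod (h t - a)) - 2 * fst (K (h t - a)%C)).
  assert (Hu : forall t, T <= t -> is_derive u t (2 * fst (g (RtoC 0)))).
  { intros t Ht; specialize (Hin t Ht).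
    assert (Hw : Cmod (h t - a) < r) by lra.
    destruct (H _ Hw) as [EF [Eg _]].
    assert (Hgw : g (h t - a)%C <> RtoC 0) by (apply Ng; rewrite Cminus_0_r; lra).
    assert (D1 : is_derive (fun s => ln (Cmod (h s - a) * Cmod (h s - a))) t (2 * fst (g (h t - a)%C))).
    { apply (is_derive_ln_dist F a r g); [intros w Hw'; apply H, Hw'|apply Hne; lra|exact Hw|].
      apply Hh; lra. }
    assert (D2 : is_curve_derive (fun s => K (h s - a)%C) t ((h t - a) * g1 (h t - a))%C).
    { replace ((h t - a) * g1 (h t - a))%C
        with (g1 (h t - a) / g (h t - a) * (1 + 0) * F (h t))%C.
      - apply (is_curve_derive_comp (fun z => K (z - a)%C) h); [|apply Hh; lra].
        apply (is_cderive_comp K (fun z => z - a)%C); [apply HK; lra|].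
        apply is_cderive_plus; [apply is_cderive_id|apply is_cderive_const].
      - replace (F (h t)) with (F (a + (h t - a)))%C by (f_equal; ring).
        rewrite EF; field; exact Hgw. }
    apply is_curve_derive_fst in D2.
    apply (is_derive_scal _ _ 2) in D2.
    pose proof (is_derive_minus (V := R_NormedModule) _ _ _ _ _ D1 D2) as D.
    replace (2 * fst (g (RtoC 0)))
      with (2 * fst (g (h t - a)%C) - 2 * fst ((h t - a) * g1 (h t - a))%C).
    - exact D.
    - apply (f_equal fst) in Eg.
      change (fst (g (h t - a)%C) = fst (g (RtoC 0)) + fst ((h t - a) * g1 (h t - a))%C) in Eg.
      rewrite Eg; ring. }
  assert (Hmono : forall t, T <= t -> u T <= u t).
  { intros t Ht; apply (nondecreasing_of_derive u (fun _ => 2 * fst (g (RtoC 0)))); [exact Ht| |].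
    - intros v Hv; apply Hu; lra.
    - intros; lra. }
  (* A lower bound for [ln |h t - a|^2]: [u] is at least [u T], and [Re K] is at least
     [Re K(0) - 1] on the disc. *)
  set (c := u T + 2 * fst (K (RtoC 0)) - 2).
  destruct (Hlim (Rmin 1 (exp c))) as [T1 HT1].
  { apply Rmin_glb_lt; [lra|apply exp_pos]. }
  set (t := Rmax T T1).
  assert (Ht : T <= t) by apply Rmax_l.
  specialize (HT1 t (Rmax_r T T1)); specialize (Hmono t Ht); specialize (Hin t Ht).
  assert (Hz : 0 < Cmod (h t - a)) by (apply Cmod_gt_0, Cminus_eq_contra, Hne; lra).
  assert (HKt : Cmod (K (h t - a)%C - K (RtoC 0)) < 1) by (apply HKd; rewrite Cminus_0_r; lra).
  pose proof (Rabs_fst_le_Cmod (K (h t - a)%C - K (RtoC 0))) as B; cbn [fst Cminus Cplus Copp] in B.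
  assert (Blow : Rabs (fst (K (h t - a)%C) + - fst (K (RtoC 0))) < 1) by (eapply Rle_lt_trans; [exact B|exact HKt]).
  apply Rabs_def2 in Blow.
  assert (L : c < ln (Cmod (h t - a) * Cmod (h t - a))) by (unfold c, u in *; lra).
  rewrite <- (ln_exp c) in L; apply ln_lt_inv in L; [|apply exp_pos|nra].
  assert (Cmod (h t - a) < 1) by (eapply Rlt_le_trans; [exact HT1|apply Rmin_l]).
  assert (Cmod (h t - a) < exp c) by (eapply Rlt_le_trans; [exact HT1|apply Rmin_r]).
  nra.
Qed.

Theorem lyapunov_exists F a (h : R -> C) : holomorphic F ->
  (exists z, F z <> RtoC 0) -> F a = RtoC 0 ->
  (forall t, 0 <= t -> is_curve_derive h t (F (h t))) ->
  (forall t, 0 <= t -> h t <> a) -> tends_to h a ->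
  exists V k p, lyapunov F a V k p.
Proof.
  intros HF Hnz Ha Hh Hne Hlim.
  destruct (zero_factorization F a HF Hnz Ha) as [r [n [g [g1 [Hr [Hg0 H]]]]]].
  assert (Cg : continuous (T := C_UniformSpace) (U := C_UniformSpace) g (RtoC 0)).
  { destruct (H (RtoC 0)) as [_ [_ [[d Hd] _]]]; [rewrite Cmod_0; exact Hr|].
    eapply is_cderive_continuous, Hd. }
  destruct n as [|n].
  - assert (H' : forall w, Cmod w < r -> F (a + w)%C = (w * g w)%C).
    { intros w Hw; destruct (H w Hw) as [E _]; rewrite E; simpl; ring. }
    destruct (Rlt_dec (fst (g (RtoC 0))) 0) as [Hl|Hl].
    + apply (lyapunov_sink F a r g); assumption.
    + exfalso; apply (no_convergence_to_source_or_center F a r g g1 h); try assumption; [lra|].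
      intros w Hw; split; [apply H', Hw|apply (H w Hw)].
  - apply (lyapunov_multiple F a r n g); try assumption; intros w Hw; apply H, Hw.
Qed.

(** * The basin of an attracting equilibrium *)

Lemma is_derive_nondecreasing (f : R -> R) s t :
  s <= t -> (forall u, s <= u <= t -> exists l, 0 <= l /\ is_derive f u l) -> f s <= f t.
Proof.
  intros Hst H; apply (nondecreasing_of_derive f (Derive f)); [exact Hst| |];
    intros u Hu; destruct (H u Hu) as [l [Hl Hd]].
  - rewrite (is_derive_unique _ _ _ Hd); exact Hd.
  - rewrite (is_derive_unique _ _ _ Hd); exact Hl.
Qed.

(** At the first return to the level [M] the function would have increased since [t1], so
    there is no return. *)
Lemma growth_above_level (w : R -> R) t1 M k : 0 <= k ->
  (forall t, t1 <= t -> continuous w t) ->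
  (forall t, t1 <= t -> M < w t -> exists l, k <= l /\ is_derive w t l) ->
  M < w t1 -> forall t, t1 <= t -> w t1 + k * (t - t1) <= w t.
Proof.
  intros Hk Hc Hd H1.
  assert (grow : forall t, t1 <= t -> (forall u, t1 <= u <= t -> M < w u) ->
     w t1 + k * (t - t1) <= w t).
  { intros t Ht Hu.
    assert (A : w t1 - k * t1 <= w t - k * t); [|lra].
    apply (is_derive_nondecreasing (fun s => w s - k * s)); [exact Ht|].
    intros u Hu'; destruct (Hd u ltac:(lra) (Hu u Hu')) as [l [Hl D]].
    exists (l - k); split; [lra|].
    apply (is_derive_minus (V := R_NormedModule) w (fun s => k * s)); [exact D|].
    auto_derive; [trivial|ring]. }
  assert (near : forall t e, t1 <= t -> 0 < e -> exists d, 0 < d /\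
     forall s, Rabs (s - t) < d -> Rabs (w s - w t) < e).
  { intros t e Ht He.
    apply locally_R. apply (proj1 (filterlim_locally w (w t)) (Hc t Ht) (mkposreal _ He)). }
  intros t Ht; apply grow; [exact Ht|].
  apply NNPP; intros Hbad; apply not_all_ex_not in Hbad; destruct Hbad as [b Hb].
  apply imply_to_and in Hb; destruct Hb as [Hb Hwb]; apply Rnot_lt_le in Hwb.
  set (E := fun s => t1 <= s <= b /\ forall u, t1 <= u <= s -> M < w u).
  assert (E1 : E t1).
  { split; [lra|]; intros u Hu; replace u with t1 by lra; exact H1. }
  destruct (completeness E) as [T [HT1 HT2]].
  { exists b; intros s [Hs _]; lra. }
  { exists t1; exact E1. }
  assert (HTb : T <= b) by (apply HT2; intros s [Hs _]; lra).
  assert (Ht1T : t1 <= T) by (apply HT1, E1).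
  assert (Hbelow : forall u, t1 <= u < T -> M < w u).
  { intros u Hu; apply NNPP; intros N.
    assert (T <= u); [|lra].
    apply HT2; intros s [Hs Hs']; apply Rnot_lt_le; intros Hus; apply N, Hs'; lra. }
  assert (HwT : M < w T).
  { apply Rnot_le_lt; intros HwT.
    assert (t1 < T) by (destruct (Req_dec t1 T) as [->|]; lra).
    destruct (near T (w t1 - w T) Ht1T ltac:(lra)) as [d [Hdp Hdd]].
    set (u := Rmax t1 (T - d / 2)).
    assert (Hu : t1 <= u < T) by (split; [apply Rmax_l|apply Rmax_lub_lt; lra]).
    assert (Hu2 : T - d / 2 <= u) by apply Rmax_r.
    assert (G : w t1 + k * (u - t1) <= w u).
    { apply grow; [lra|]; intros v Hv; apply Hbelow; lra. }
    specialize (Hdd u ltac:(apply Rabs_def1; lra)); apply Rabs_def2 in Hdd; nra. }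
  assert (HTlt : T < b) by (destruct (Req_dec T b) as [Eb|]; [rewrite Eb in HwT|]; lra).
  destruct (near T (w T - M) Ht1T ltac:(lra)) as [d [Hdp Hdd]].
  set (s := Rmin b (T + d / 2)).
  assert (HsT : T < s) by (apply Rmin_glb_lt; lra).
  assert (Hs1 : s <= b) by apply Rmin_l.
  assert (Hs2 : s <= T + d / 2) by apply Rmin_r.
  assert (s <= T); [|lra].
  apply HT1; split; [lra|]; intros u Hu.
  destruct (Rlt_dec u T) as [Hl|Hl]; [apply Hbelow; lra|].
  specialize (Hdd u ltac:(apply Rabs_def1; lra)); apply Rabs_def2 in Hdd; lra.
Qed.

(** Once a solution has entered a high superlevel set of a Lyapunov function, so have the
    nearby ones; these sets are open, positively invariant and contained in the basin. *)
Theorem basin F a (h : R -> C) : holomorphic F ->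
  (exists z, F z <> RtoC 0) -> F a = RtoC 0 ->
  (forall t, 0 <= t -> is_curve_derive h t (F (h t))) ->
  (forall t, 0 <= t -> h t <> a) -> tends_to h a ->
  exists t1 d, 0 <= t1 /\ 0 < d /\ forall f : R -> C,
    (forall t, t1 <= t -> continuous (T := R_UniformSpace) (U := C_UniformSpace) f t) ->
    (forall t, t1 <= t -> f t <> a) ->
    (forall t, t1 <= t -> Cmod (f t - a) < 1 -> is_curve_derive f t (F (f t))) ->
    Cmod (f t1 - h t1) < d ->
    (forall t, t1 <= t -> Cmod (f t - a) < 1) /\ tends_to f a.
Proof.
  intros HF Hnz Ha Hh Hne Hlim.
  destruct (lyapunov_exists F a h HF Hnz Ha Hh Hne Hlim) as [V [k [p [Hk [Hp [HVc [HVs HVd]]]]]]].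
  set (q := Rmin p 1).
  assert (Hq : 0 < q) by (apply Rmin_glb_lt; lra).
  assert (Hqp : q <= p) by apply Rmin_l.
  assert (Hq1 : q <= 1) by apply Rmin_r.
  destruct (HVs q Hq) as [M HM].
  assert (CVf : forall (f : R -> C) t, continuous (T := R_UniformSpace) (U := C_UniformSpace) f t ->
     f t <> a -> continuous (fun s => V (f s)) t).
  { intros f t Hc Hn; apply (continuous_comp f V); [exact Hc|apply HVc, Hn]. }
  destruct (Hlim p Hp) as [T0 HT0].
  set (T := Rmax 0 T0).
  assert (HT : 0 <= T) by apply Rmax_l.
  assert (HTT : T0 <= T) by apply Rmax_r.
  (* Growth at rate [k] from time [T] on brings [V] above [M] by this time. *)
  set (t1 := T + (Rabs M + Rabs (V (h T)) + 1) / k).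
  assert (Ht1 : T <= t1).
  { unfold t1; assert (0 <= (Rabs M + Rabs (V (h T)) + 1) / k); [|lra].
    apply Rmult_le_pos; [|apply Rlt_le, Rinv_0_lt_compat, Hk].
    pose proof (Rabs_pos M); pose proof (Rabs_pos (V (h T))); lra. }
  assert (HV1 : M < V (h t1)).
  { assert (G : V (h T) + k * (t1 - T) <= V (h t1)).
    { apply (growth_above_level (fun t => V (h t)) T (V (h T) - 1) k); [lra| | |lra|exact Ht1].
      - intros t Ht; apply CVf; [|apply Hne; lra].
        eapply is_curve_derive_continuous, Hh; lra.
      - intros t Ht _; apply HVd; [apply Hne; lra|apply HT0; lra|apply Hh; lra]. }
    replace (k * (t1 - T)) with (Rabs M + Rabs (V (h T)) + 1) in G by (unfold t1; field; lra).
    pose proof (Rle_abs M); pose proof (Rle_abs (- V (h T))) as Q; rewrite Rabs_Ropp in Q; lra. }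
  assert (Hopen : locally (T := C_UniformSpace) (h t1) (fun z => M < V z)).
  { assert (He : 0 < V (h t1) - M) by lra.
    assert (Hn1 : h t1 <> a) by (apply Hne; lra).
    pose proof (proj1 (filterlim_locally _ _) (HVc (h t1) Hn1) (mkposreal _ He)) as L.
    revert L; apply filter_imp; intros z Hz.
    change (Rabs (V z - V (h t1)) < V (h t1) - M) in Hz; apply Rabs_def2 in Hz; lra. }
  apply locally_disc in Hopen; destruct Hopen as [d [Hd Hopen]].
  exists t1, d; split; [lra|split; [exact Hd|]].
  intros f Hfc Hfn Hfd Hf1.
  assert (G : forall t, t1 <= t -> V (f t1) + k * (t - t1) <= V (f t)).
  { apply (growth_above_level (fun t => V (f t)) t1 M k); [lra| | |apply Hopen, Hf1].
    - intros t Ht; apply CVf; [apply Hfc|apply Hfn]; exact Ht.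
    - intros t Ht Hv; specialize (HM (f t) (Hfn t Ht) Hv).
      apply HVd; [apply Hfn, Ht|lra|apply Hfd; [exact Ht|lra]]. }
  assert (HMf : M < V (f t1)) by (apply Hopen, Hf1).
  split.
  - intros t Ht; specialize (G t Ht).
    assert (Cmod (f t - a) < q); [|lra].
    apply HM; [apply Hfn, Ht|].
    assert (0 <= k * (t - t1)) by (apply Rmult_le_pos; lra); lra.
  - intros e He; destruct (HVs e He) as [N HN].
    exists (t1 + (Rabs N + Rabs (V (f t1)) + 1) / k); intros t Ht.
    assert (Hpos : 0 <= Rabs N + Rabs (V (f t1)) + 1)
      by (pose proof (Rabs_pos N); pose proof (Rabs_pos (V (f t1))); lra).
    assert (Hq2 : 0 <= (Rabs N + Rabs (V (f t1)) + 1) / k).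
    { apply Rmult_le_pos; [lra|apply Rlt_le, Rinv_0_lt_compat, Hk]. }
    apply HN; [apply Hfn; lra|].
    specialize (G t ltac:(lra)).
    assert (k * ((Rabs N + Rabs (V (f t1)) + 1) / k) <= k * (t - t1))
      by (apply Rmult_le_compat_l; lra).
    replace (k * ((Rabs N + Rabs (V (f t1)) + 1) / k)) with (Rabs N + Rabs (V (f t1)) + 1) in *
      by (field; lra).
    pose proof (Rle_abs N); pose proof (Rle_abs (- V (f t1))) as Q; rewrite Rabs_Ropp in Q; lra.
Qed.

(** Up to the time at which the given solution has entered the basin, continuous dependence
    keeps its neighbours within distance [1]; later they stay within distance [1] of [a].
    The bound [R0] makes every larger square contain both regions. *)
Theorem basin_of_truncation F a (h : R -> C) : holomorphic F ->
  (exists z, F z <> RtoC 0) -> F a = RtoC 0 ->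
  (forall t, 0 <= t -> is_curve_derive h t (F (h t))) ->
  (forall t, 0 <= t -> h t <> a) -> tends_to h a ->
  exists R0, 0 < R0 /\ forall r, R0 <= r -> exists d, 0 < d /\
    forall f : R -> C, Cmod (f 0 - h 0) < d ->
      (forall t, is_curve_derive f t (F (clamp r (f t)))) ->
      (forall t, 0 <= t -> in_square r (f t)) /\ tends_to f a.
Proof.
  intros HF Hnz Ha Hh Hne Hlim.
  destruct (basin F a h HF Hnz Ha Hh Hne Hlim) as [t1 [p [Ht1 [Hp H]]]].
  destruct (curve_bounded_on h 0 t1) as [M [HM BM]].
  { intros u Hu; eapply is_curve_derive_continuous, Hh; lra. }
  pose proof (Cmod_ge_0 a) as Ha0.
  exists (M + Cmod a + 2); split; [lra|]; intros r Hr.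
  destruct (truncation_lipschitz F r HF ltac:(lra)) as [L [HL Lip]].
  set (e := exp (L * t1)).
  assert (He : 0 < e) by apply exp_pos.
  assert (Hh0 : 0 < Cmod (h 0 - a)) by (apply Cmod_gt_0, Cminus_eq_contra, Hne; lra).
  exists (Rmin (Cmod (h 0 - a)) (Rmin p 1 / e)).
  assert (Hp1 : 0 < Rmin p 1) by (apply Rmin_glb_lt; lra).
  split; [apply Rmin_glb_lt; [exact Hh0|apply Rdiv_lt_0_compat; assumption]|].
  intros f Hf0 Hf.
  assert (Hf01 : Cmod (f 0 - h 0) < Cmod (h 0 - a)) by (eapply Rlt_le_trans; [exact Hf0|apply Rmin_l]).
  assert (Hf02 : Cmod (f 0 - h 0) * e < Rmin p 1).
  { apply Rlt_le_trans with (Rmin p 1 / e * e).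
    - apply Rmult_lt_compat_r; [exact He|]; eapply Rlt_le_trans; [exact Hf0|apply Rmin_r].
    - right; field; lra. }
  assert (Hclose : forall t, 0 <= t <= t1 -> Cmod (f t - h t) < Rmin p 1).
  { intros t Ht.
    destruct (dist_growth f h (fun u => F (clamp r (f u))) (fun u => F (clamp r (h u))) L 0 t)
      as [A _]; [lra|lra| |].
    - intros u Hu; split; [apply Hf|split; [|apply Lip]].
      rewrite clamp_id; [apply Hh; lra|].
      apply in_square_Cmod; specialize (BM u ltac:(lra)); lra.
    - eapply Rle_lt_trans; [exact A|]; eapply Rle_lt_trans; [|exact Hf02].
      apply Rmult_le_compat_l; [apply Cmod_ge_0|]; rewrite Rminus_0_r; unfold e.
      destruct (Req_dec t t1) as [->|Nt]; [lra|].
      apply Rlt_le, exp_increasing, Rmult_lt_compat_l; lra. }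
  assert (Hfne : forall t, 0 <= t -> f t <> a).
  { intros t Ht Et.
    assert (Ca : in_square r a) by (apply in_square_Cmod; lra).
    destruct (dist_growth f (fun _ => a) (fun u => F (clamp r (f u)))
      (fun _ => F (clamp r a)) L 0 t Ht ltac:(lra)) as [_ B].
    - intros u Hu; split; [apply Hf|split; [|apply Lip]].
      rewrite clamp_id, Ha by exact Ca; apply (is_derive_const (V := C_R_NormedModule)).
    - rewrite Et in B; replace (a - a)%C with (RtoC 0) in B by ring; rewrite Cmod_0, Rmult_0_l in B.
      assert (E0 : f 0 = a)
        by (apply Ceq_minus, Cmod_eq_0, Rle_antisym; [exact B|apply Cmod_ge_0]).
      rewrite E0, Cmod_minus_sym in Hf01; lra. }
  assert (Hnear : forall z, Cmod (z - a) < 1 -> in_square r z).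
  { intros z Hz; apply in_square_Cmod; pose proof (Cmod_triangle_minus z a); lra. }
  destruct (H f) as [H1 H2].
  - intros t _; eapply is_curve_derive_continuous, Hf.
  - intros t Ht; apply Hfne; lra.
  - intros t Ht Hz; specialize (Hf t); rewrite clamp_id in Hf; [exact Hf|apply Hnear, Hz].
  - eapply Rlt_le_trans; [apply Hclose; lra|apply Rmin_l].
  - split; [|exact H2].
    intros t Ht; destruct (Rle_dec t t1) as [Hle|Hle].
    + apply in_square_Cmod; specialize (BM t ltac:(lra)); specialize (Hclose t ltac:(lra)).
      pose proof (Cmod_triangle_minus (f t) (h t)); pose proof (Rmin_r p 1); lra.
    + apply Hnear, H1; lra.
Qed.

(** * Limit points *)

(** If no point were a cluster point, each point would have a neighbourhood that the sequence
    leaves for good, and by subdivision it would leave the whole square containing it. *)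
Lemma bolzano_weierstrass_C (u : nat -> C) K : (forall n, Cmod (u n) <= K) ->
  exists p (phi : nat -> nat), (forall n, (n <= phi n)%nat) /\
    filterlim (fun n => u (phi n)) eventually (locally (T := C_UniformSpace) p).
Proof.
  intros HK.
  assert (Hcl : exists p : C, forall e, 0 < e -> forall N, exists n, (N <= n)%nat /\ Cmod (u n - p) < e).
  { apply NNPP; intros N0.
    assert (Hfar : forall p : C, exists e N, 0 < e /\ forall n, (N <= n)%nat -> e <= Cmod (u n - p)).
    { intros p; apply NNPP; intros N1; apply N0; exists p; intros e He N.
      apply NNPP; intros N2; apply N1; exists e, N; split; [exact He|].
      intros n Hn; apply Rnot_lt_le; intros Hlt; apply N2; exists n; split; assumption. }
    assert (K0 : 0 <= K) by (eapply Rle_trans; [apply Cmod_ge_0|apply (HK 0%nat)]).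
    pose (P := fun x y s : R => exists N, forall n, (N <= n)%nat ->
      ~ ((- K + 2 * K * x <= fst (u n) <= - K + 2 * K * (x + s)) /\
         (- K + 2 * K * y <= snd (u n) <= - K + 2 * K * (y + s)))).
    assert (HP : P 0 0 1).
    { apply cousin_square; unfold P; clear P.
      - intros x y s [N1 H1] [N2 H2] [N3 H3] [N4 H4].
        exists (N1 + N2 + N3 + N4)%nat; intros n Hn [Hx Hy].
        specialize (H1 n ltac:(lia)); specialize (H2 n ltac:(lia)).
        specialize (H3 n ltac:(lia)); specialize (H4 n ltac:(lia)).
        replace (x + s / 2 + s / 2) with (x + s) in * by field.
        replace (y + s / 2 + s / 2) with (y + s) in * by field.
        destruct (Rle_dec (fst (u n)) (- K + 2 * K * (x + s / 2))),
          (Rle_dec (snd (u n)) (- K + 2 * K * (y + s / 2)));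
        [apply H1|apply H3|apply H2|apply H4]; lra.
      - intros p q Hp Hq.
        destruct (Hfar (- K + 2 * K * p, - K + 2 * K * q)) as [e [N [He H]]].
        exists (e / (4 * K + 1)); split; [apply Rdiv_lt_0_compat; lra|].
        intros x y s Hx Hy [Hs Hse] _ _ _ _; exists N; intros n Hn [Bx By].
        specialize (H n Hn).
        assert (Hse' : 4 * K * s < e).
        { apply (Rmult_lt_compat_r (4 * K + 1)) in Hse; [|lra].
          unfold Rdiv in Hse; rewrite Rmult_assoc, Rinv_l in Hse by lra; nra. }
        assert (B : Cmod (u n - (- K + 2 * K * p, - K + 2 * K * q)) <= 2 * (2 * K * s)).
        { eapply Rle_trans; [apply Cmod_le_Rabs|]; simpl.
          assert (Rabs (fst (u n) + - (- K + 2 * K * p)) <= 2 * K * s)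
            by (apply Rabs_le; split; nra).
          assert (Rabs (snd (u n) + - (- K + 2 * K * q)) <= 2 * K * s)
            by (apply Rabs_le; split; nra).
          lra. }
        lra. }
    destruct HP as [N HN]; apply (HN N (Nat.le_refl N)).
    pose proof (Rabs_fst_le_Cmod (u N)) as B1; pose proof (Rabs_snd_le_Cmod (u N)) as B2.
    specialize (HK N).
    assert (C1 : Rabs (fst (u N)) <= K) by lra; assert (C2 : Rabs (snd (u N)) <= K) by lra.
    apply Rabs_le_between in C1, C2; lra. }
  destruct Hcl as [p Hp].
  assert (Hch : forall n, exists m, (n <= m)%nat /\ Cmod (u m - p) < / (INR n + 1)).
  { intros n; apply Hp, Rinv_0_lt_compat; pose proof (pos_INR n); lra. }
  exists p, (fun n => proj1_sig (constructive_indefinite_description _ (Hch n))).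
  split.
  - intros n; apply (proj2_sig (constructive_indefinite_description _ (Hch n))).
  - apply filterlim_Cmod; [typeclasses eauto|]; intros e He.
    destruct (archimed_cor1 e He) as [N [HN HN0]].
    exists N; intros n Hn.
    eapply Rlt_trans; [apply (proj2_sig (constructive_indefinite_description _ (Hch n)))|].
    eapply Rle_lt_trans; [|exact HN].
    apply Rinv_le_contravar; [apply lt_0_INR; lia|].
    apply le_INR in Hn; lra.
Qed.

Lemma lim_seq_below (u : nat -> R) (b : Rbar) (T : R) :
  is_lim_seq u b -> Rbar_lt T b -> exists N, forall n, (N <= n)%nat -> T < u n.
Proof.
  intros H HT; apply H, (open_Rbar_gt' b (Finite T) HT).
Qed.

Lemma lim_seq_of_below (u : nat -> R) (a b : Rbar) : Rbar_lt a b ->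
  (forall n, Rbar_lt (u n) b) ->
  (forall T : R, Rbar_lt a T -> Rbar_lt T b -> exists N, forall n, (N <= n)%nat -> T < u n) ->
  is_lim_seq u b.
Proof.
  intros Hab Hu H; apply is_lim_seq_spec; destruct b as [b| |]; simpl in *.
  - intros [e He]; simpl.
    assert (HT : exists T : R, Rbar_lt a T /\ T < b /\ b - e <= T).
    { destruct a as [a| |]; simpl in Hab; try easy.
      - exists (Rmax ((a + b) / 2) (b - e)); simpl; pose proof (Rmax_l ((a + b) / 2) (b - e));
        split; [lra|split; [apply Rmax_lub_lt; lra|apply Rmax_r]].
      - exists (b - e); simpl; split; [trivial|split; lra]. }
    destruct HT as [T [H1 [H2 H3]]]; destruct (H T H1 H2) as [N HN].
    exists N; intros n Hn; specialize (HN n Hn); specialize (Hu n).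
    apply Rabs_def1; lra.
  - intros M.
    assert (HT : exists T : R, Rbar_lt a T /\ M <= T).
    { destruct a as [a| |]; simpl in Hab; try easy.
      - exists (Rmax (a + 1) M); simpl; split; [pose proof (Rmax_l (a + 1) M); lra|apply Rmax_r].
      - exists M; simpl; split; [trivial|lra]. }
    destruct HT as [T [H1 H2]]; destruct (H T H1 I) as [N HN].
    exists N; intros n Hn; specialize (HN n Hn); lra.
  - destruct (Hu 0%nat).
Qed.

Section LimitPoint.
Variables (a b : Rbar) (g : R -> C) (p : C).
Hypothesis g_cont : forall t, in_interval a b t ->
  continuous (T := R_UniformSpace) (U := C_UniformSpace) g t.
Hypothesis p_limit : is_limit_point a b b g p.
Hypothesis p_unique : forall q, is_limit_point a b b g q -> q = p.

(** A curve that returns close to its only limit point without converging to it crosses a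
    fixed circle around it at times tending to the end, and the crossing points have a
    cluster point on the circle, which is a second limit point. *)
Lemma unique_limit_point_converges e : 0 < e ->
  exists T, in_interval a b T /\ forall t, T < t -> Rbar_lt t b -> Cmod (g t - p) < e.
Proof.
  intros He; apply NNPP; intros Hbad.
  destruct p_limit as [tau [Hin [Hlim Hg]]].
  assert (Hge := proj1 (filterlim_Cmod _ _ _) Hg).
  assert (Hab : Rbar_lt a b) by (destruct (Hin 0%nat); eapply Rbar_lt_trans; eassumption).
  assert (Hcross : forall n, exists u, tau n <= u /\ Rbar_lt u b /\ Cmod (g u - p) = e).
  { intros n; destruct (Hin n) as [Ha Hb].
    assert (Hfar : exists t, tau n < t /\ Rbar_lt t b /\ e <= Cmod (g t - p)).
    { apply NNPP; intros N; apply Hbad; exists (tau n); split; [split; assumption|].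
      intros t Ht Htb; apply Rnot_le_lt; intros Hle; apply N; exists t; repeat split; assumption. }
    destruct Hfar as [t1 [Ht1 [Ht1b Hd1]]].
    destruct (lim_seq_below tau b t1 Hlim Ht1b) as [N1 HN1].
    destruct (Hge e He) as [N2 HN2].
    specialize (HN1 (N1 + N2)%nat ltac:(lia)); specialize (HN2 (N1 + N2)%nat ltac:(lia)).
    set (t2 := tau (N1 + N2)%nat) in *.
    assert (Ht2b : Rbar_lt t2 b) by apply (Hin (N1 + N2)%nat).
    assert (Hint : forall t, t1 <= t <= t2 -> in_interval a b t).
    { intros t Ht; split.
      - eapply Rbar_lt_le_trans; [exact Ha|simpl; lra].
      - eapply Rbar_le_lt_trans; [|exact Ht2b]; simpl; lra. }
    destruct Hd1 as [Hd1|Hd1]; [|exists t1; repeat split; [lra|exact Ht1b|symmetry; exact Hd1]].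
    destruct (IVT_interv (fun t => e - Cmod (g t - p)) t1 t2) as [u [Hu Eu]].
    - intros t Ht; apply continuity_pt_filterlim.
      apply (continuous_minus (V := R_NormedModule) (fun _ => e) (fun t => Cmod (g t - p)));
        [apply continuous_const|].
      apply continuous_Cmod_comp, continuous_Cminus; [apply g_cont, Hint, Ht|apply continuous_const].
    - exact HN1.
    - lra.
    - lra.
    - exists u; repeat split; [lra|apply Hint, Hu|lra]. }
  pose (u := fun n => proj1_sig (constructive_indefinite_description _ (Hcross n))).
  assert (Hu : forall n, tau n <= u n /\ Rbar_lt (u n) b /\ Cmod (g (u n) - p) = e).
  { intros n; exact (proj2_sig (constructive_indefinite_description _ (Hcross n))). }
  clearbody u.
  destruct (bolzano_weierstrass_C (fun n => g (u n)) (e + Cmod p)) as [q [phi [Hphi Hq]]].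
  { intros n; destruct (Hu n) as [_ [_ E]].
    pose proof (Cmod_triangle_minus (g (u n)) p); lra. }
  assert (E : q = p).
  { apply p_unique; exists (fun n => u (phi n)); split; [|split; [|exact Hq]].
    - intros n; destruct (Hu (phi n)) as [H1 [H2 _]]; split; [|exact H2].
      eapply Rbar_lt_le_trans; [apply (Hin (phi n))|exact H1].
    - apply (lim_seq_of_below _ a b Hab); [intros n; apply Hu|].
      intros T _ HT; destruct (lim_seq_below tau b T Hlim HT) as [N HN].
      exists N; intros n Hn; eapply Rlt_le_trans; [|apply Hu].
      apply HN; specialize (Hphi n); lia. }
  subst q.
  destruct (proj1 (filterlim_Cmod _ _ _) Hq e He) as [N HN].
  specialize (HN N (Nat.le_refl N)); simpl in HN.
  destruct (Hu (phi N)) as [_ [_ E]]; lra.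
Qed.

End LimitPoint.

Lemma in_interval_between a b s t u :
  in_interval a b s -> in_interval a b t -> s <= u <= t -> in_interval a b u.
Proof.
  intros [H1 _] [_ H2] [H3 H4]; split.
  - eapply Rbar_lt_le_trans; [exact H1|exact H3].
  - eapply Rbar_le_lt_trans; [|exact H2]; exact H4.
Qed.

Lemma solutions_agree_on F (a b : Rbar) (g h : R -> C) s t : holomorphic F ->
  is_solution F a b g -> is_solution F a b h ->
  in_interval a b s -> in_interval a b t -> g s = h s -> g t = h t.
Proof.
  intros HF Hg Hh Hs Ht E.
  destruct (Rle_dec s t) as [L|L].
  - apply (solutions_agree F g h s t HF L); [| |exact E];
      intros u Hu; [apply Hg|apply Hh]; apply (in_interval_between a b s t); assumption.
  - apply (solutions_agree F g h t s HF); [lra| | |exact E];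
      intros u Hu; [apply Hg|apply Hh]; apply (in_interval_between a b t s); assumption.
Qed.

Lemma constant_solution F a b c : F c = RtoC 0 -> is_solution F a b (fun _ => c).
Proof. intros E t _; rewrite E; apply (is_derive_const (V := C_R_NormedModule)). Qed.

(** Gronwall's lower bound keeps a solution away from an equilibrium on bounded time
    intervals, so a solution converging to one exists for all later times. *)
Lemma forward_solution F (a b : Rbar) (g : R -> C) p s : holomorphic F -> F p = RtoC 0 ->
  is_solution F a b g -> in_interval a b s -> g s <> p ->
  is_limit_point a b b g p -> (forall q, is_limit_point a b b g q -> q = p) ->
  (forall t, 0 <= t -> is_curve_derive (fun t => g (s + t)) t (F (g (s + t)))) /\
  (forall t, 0 <= t -> g (s + t) <> p) /\ tends_to (fun t => g (s + t)) p.
Proof.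
  intros HF Hp Hg Hs Hsp Hl Hu.
  assert (Hc : forall t, in_interval a b t -> continuous (T := R_UniformSpace) (U := C_UniformSpace) g t).
  { intros t Ht; eapply is_curve_derive_continuous, Hg, Ht. }
  assert (Hne : forall t, in_interval a b t -> g t <> p).
  { intros t Ht E; apply Hsp.
    apply (solutions_agree_on F a b g (fun _ => p) t s HF Hg); try assumption.
    apply constant_solution, Hp. }
  assert (Hb : b = p_infty).
  { destruct b as [b| |]; [exfalso|reflexivity|destruct Hs as [_ []]].
    destruct (unique_limit_point_converges a b g p Hc Hl Hu 1 Rlt_0_1) as [T [HT HT1]].
    set (T1 := (T + b) / 2).
    assert (HTb : T < b) by apply HT.
    assert (HT1' : in_interval a b T1).
    { destruct HT as [H1 H2]; split; [|unfold T1; simpl; lra].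
      eapply Rbar_lt_trans; [exact H1|]; unfold T1; simpl; lra. }
    pose proof (Cmod_ge_0 p) as Hp0.
    destruct (holomorphic_lipschitz F (Cmod p + 1) HF ltac:(lra)) as [L [HL Lip]].
    assert (Hd : 0 < Cmod (g T1 - p)) by (apply Cmod_gt_0, Cminus_eq_contra, Hne, HT1').
    assert (Hex : 0 < exp (L * (b - T1))) by apply exp_pos.
    destruct (unique_limit_point_converges a b g p Hc Hl Hu (Cmod (g T1 - p) / exp (L * (b - T1))))
      as [T2 [HT2 HT2']]; [apply Rdiv_lt_0_compat; assumption|].
    set (t := (Rmax T1 T2 + b) / 2).
    assert (HM : Rmax T1 T2 < b) by (apply Rmax_lub_lt; [unfold T1; lra|apply HT2]).
    pose proof (Rmax_l T1 T2); pose proof (Rmax_r T1 T2).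
    assert (Ht1 : T1 <= t < b) by (unfold t; split; lra).
    assert (Ht2 : T2 < t) by (unfold t; lra).
    specialize (HT2' t Ht2 (proj2 Ht1)).
    destruct (dist_growth g (fun _ => p) (fun u => F (g u)) (fun _ => F p) L T1 t) as [_ B].
    - lra.
    - lra.
    - intros u Hu'; split; [|split].
      + apply Hg; split; [|simpl; lra].
        eapply Rbar_lt_le_trans; [apply HT1'|simpl; lra].
      + rewrite Hp; apply (is_derive_const (V := C_R_NormedModule)).
      + apply Lip; [|lra].
        specialize (HT1 u ltac:(unfold T1 in *; lra) ltac:(simpl; lra)).
        pose proof (Cmod_triangle_minus (g u) p); lra.
    - assert (Hle : exp (L * (t - T1)) <= exp (L * (b - T1))).
      { apply Rlt_le, exp_increasing, Rmult_lt_compat_l; lra. }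
      apply (Rmult_lt_compat_r (exp (L * (b - T1)))) in HT2'; [|exact Hex].
      replace (Cmod (g T1 - p) / exp (L * (b - T1)) * exp (L * (b - T1))) with (Cmod (g T1 - p))
        in HT2' by (field; lra).
      pose proof (Cmod_ge_0 (g t - p)); nra. }
  subst b.
  assert (Hin : forall t, 0 <= t -> in_interval a p_infty (s + t)).
  { intros t Ht; split; [|exact I]; eapply Rbar_lt_le_trans; [apply Hs|simpl; lra]. }
  split; [|split].
  - intros t Ht.
    apply (is_derive_ext (V := C_R_NormedModule) (fun t => g (s + 1 * t)));
      [intros; f_equal; ring|].
    replace (F (g (s + t))) with (RtoC 1 * F (g (s + 1 * t)%R))%C
      by (rewrite Rmult_1_l; ring).
    apply is_curve_derive_affine, Hg; rewrite Rmult_1_l; apply Hin, Ht.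
  - intros t Ht; apply Hne, Hin, Ht.
  - intros e He.
    destruct (unique_limit_point_converges a p_infty g p Hc Hl Hu e He) as [T [HT HTe]].
    exists (T - s + 1); intros t Ht; apply HTe; [lra|exact I].
Qed.

(** * Time reversal *)

Definition reverse_field (F : C -> C) (z : C) : C := (- F z)%C.

Lemma reverse_field_holomorphic F : holomorphic F -> holomorphic (reverse_field F).
Proof.
  intros HF z; destruct (HF z) as [d Hd]; exists (0 * F z + - (1) * d)%C.
  apply (is_cderive_ext_loc (fun w => - (1) * F w)%C).
  - apply filter_forall; intros w; unfold reverse_field; as_C; ring.
  - apply (is_cderive_mult (fun _ => - (1))%C F); [apply is_cderive_const|exact Hd].
Qed.

Lemma is_curve_derive_reverse (g : R -> C) t v :
  is_curve_derive g (- t) v -> is_curve_derive (fun s => g (- s)) t (- v)%C.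
Proof.
  intros H.
  apply (is_derive_ext (V := C_R_NormedModule) (fun s => g (0 + - (1) * s)));
    [intros; f_equal; ring|].
  replace (- v)%C with (RtoC (- (1)) * v)%C by (rewrite RtoC_opp; ring).
  apply is_curve_derive_affine; replace (0 + - (1) * t) with (- t) by ring; exact H.
Qed.

Lemma in_interval_opp a b t :
  in_interval a b t -> in_interval (Rbar_opp b) (Rbar_opp a) (- t).
Proof.
  intros [H1 H2]; split.
  - exact (proj2 (Rbar_opp_lt b (Finite t)) H2).
  - exact (proj2 (Rbar_opp_lt (Finite t) a) H1).
Qed.

Lemma is_solution_reverse F a b g :
  is_solution F a b g ->
  is_solution (reverse_field F) (Rbar_opp b) (Rbar_opp a) (fun t => g (- t)).
Proof.
  intros H t Ht; apply in_interval_opp in Ht; rewrite !Rbar_opp_involutive in Ht.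
  apply is_curve_derive_reverse, H, Ht.
Qed.

Lemma is_limit_point_reverse a b g p :
  is_limit_point a b a g p <->
  is_limit_point (Rbar_opp b) (Rbar_opp a) (Rbar_opp a) (fun t => g (- t)) p.
Proof.
  split; intros [t [Hin [Hlim Hg]]].
  - exists (fun n => - t n); split; [|split].
    + intros n; apply in_interval_opp, Hin.
    + apply (proj1 (is_lim_seq_opp t a)), Hlim.
    + revert Hg; apply filterlim_ext; intros n; f_equal; ring.
  - exists (fun n => - t n); split; [|split].
    + intros n; specialize (Hin n); apply in_interval_opp in Hin.
      rewrite !Rbar_opp_involutive in Hin; exact Hin.
    + apply (proj1 (is_lim_seq_opp t _)) in Hlim; rewrite Rbar_opp_involutive in Hlim; exact Hlim.
    + exact Hg.
Qed.

(** * Orbits of global solutions *)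

Definition global_solution (F : C -> C) (f : R -> C) : Prop :=
  forall t, is_curve_derive f t (F (f t)).

Lemma Cfilterlim_unique {T : Type} (F : (T -> Prop) -> Prop) {FF : ProperFilter F}
    (f : T -> C) (p q : C) :
  filterlim f F (locally (T := C_UniformSpace) p) ->
  filterlim f F (locally (T := C_UniformSpace) q) -> p = q.
Proof.
  intros Hp Hq; apply NNPP; intros N.
  assert (He : 0 < Cmod (p - q) / 2)
    by (apply Cminus_eq_contra, Cmod_gt_0 in N; lra).
  destruct (filter_ex _ (filter_and _ _ (proj1 (filterlim_Cmod F f p) Hp _ He)
    (proj1 (filterlim_Cmod F f q) Hq _ He))) as [t [H1 H2]].
  pose proof (Cmod_triangle (p - f t) (f t - q)) as T0.
  replace (p - f t + (f t - q))%C with (p - q)%C in T0 by ring.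
  rewrite (Cmod_minus_sym p (f t)) in T0; lra.
Qed.

Section GlobalSolution.
Variables (F : C -> C) (f : R -> C).
Hypothesis F_hol : holomorphic F.
Hypothesis f_sol : global_solution F f.

Lemma global_maximal : is_maximal_solution F m_infty p_infty f.
Proof.
  split; [exact I|split; [intros t _; apply f_sol|]].
  intros a b d Ha Hb _ _; split; [destruct a; easy|destruct b; easy].
Qed.

Lemma global_shift c : global_solution F (fun t => f (t + c)).
Proof.
  intros t.
  apply (is_derive_ext (V := C_R_NormedModule) (fun t => f (c + 1 * t)));
    [intros; f_equal; ring|].
  replace (F (f (t + c))) with (RtoC 1 * F (f (c + 1 * t)%R))%C
    by (replace (c + 1 * t) with (t + c) by ring; ring).
  apply is_curve_derive_affine, f_sol.
Qed.

(** A translate of [f] extends any solution that meets [f], so a maximal one is a translate. *)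
Lemma maximal_through_global a b g s u :
  is_maximal_solution F a b g -> in_interval a b s -> g s = f u ->
  a = m_infty /\ b = p_infty /\ forall t, g t = f (t + (u - s)).
Proof.
  intros [Hab [Hg Hmax]] Hs E.
  assert (Hd : forall a b, is_solution F a b (fun t => f (t + (u - s))))
    by (intros a' b' t _; apply global_shift).
  assert (Eq : forall t, in_interval a b t -> f (t + (u - s)) = g t).
  { intros t Ht; apply (solutions_agree_on F a b (fun t => f (t + (u - s))) g s t);
      try assumption; [apply Hd|].
    rewrite E; f_equal; ring. }
  destruct (Hmax m_infty p_infty (fun t => f (t + (u - s)))) as [Ea Eb].
  - exact I.
  - destruct b; exact I.
  - apply Hd.
  - exact Eq.
  - subst a b; split; [reflexivity|split; [reflexivity|]].
    intros t; symmetry; apply Eq; split; exact I.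
Qed.

Lemma orbit_global z : orbit F (f 0) z <-> exists t, f t = z.
Proof.
  split.
  - intros [t [a [b [g [Hmax [H0 [E0 [Ht Et]]]]]]]].
    destruct (maximal_through_global a b g 0 0 Hmax H0 E0) as [_ [_ E]].
    eexists; rewrite <- Et, E; reflexivity.
  - intros [t Et]; exists t, m_infty, p_infty, f.
    split; [apply global_maximal|]; split; [split; exact I|].
    split; [reflexivity|]; split; [split; exact I|exact Et].
Qed.

Lemma global_parametrizes : parametrizes F (orbit F (f 0)) m_infty p_infty f.
Proof.
  split; [apply global_maximal|]; intros z; rewrite orbit_global; split.
  - intros [t Et]; exists t; repeat split; exact Et.
  - intros [t [_ Et]]; exists t; exact Et.
Qed.

Lemma parametrization_global a b g :
  parametrizes F (orbit F (f 0)) a b g ->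
  a = m_infty /\ b = p_infty /\ exists c, forall t, g t = f (t + c).
Proof.
  intros [Hmax Htr].
  destruct (proj1 (Htr (f 0))) as [s [Hs Es]].
  { apply orbit_global; exists 0; reflexivity. }
  destruct (maximal_through_global a b g s 0 Hmax Hs Es) as [Ha [Hb E]].
  split; [exact Ha|split; [exact Hb|exists (0 - s); exact E]].
Qed.

Lemma global_limit_point (e : Rbar) p c q : e = p_infty \/ e = m_infty ->
  filterlim f (Rbar_locally e) (locally (T := C_UniformSpace) p) ->
  (is_limit_point m_infty p_infty e (fun t => f (t + c)) q <-> q = p).
Proof.
  intros He Hf.
  assert (Hlim : forall t : nat -> R, is_lim_seq t e ->
    filterlim (fun n => f (t n + c)) eventually (locally (T := C_UniformSpace) p)).
  { intros t Ht; apply (filterlim_comp _ _ _ (fun n => t n + c) f _ (Rbar_locally e)); [|exact Hf].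
    apply (is_lim_seq_plus t (fun _ => c) e c e Ht); [apply is_lim_seq_const|].
    destruct He as [-> | ->]; reflexivity. }
  split.
  - intros [t [_ [Ht Hq]]].
    exact (Cfilterlim_unique _ _ q p Hq (Hlim t Ht)).
  - intros ->.
    assert (Hseq : exists t : nat -> R, is_lim_seq t e).
    { destruct He as [-> | ->]; [exists INR; apply is_lim_seq_INR|].
      exists (fun n => - INR n); apply (proj1 (is_lim_seq_opp INR p_infty)), is_lim_seq_INR. }
    destruct Hseq as [t Ht]; exists t; split; [intros n; split; exact I|split; [exact Ht|]].
    apply Hlim, Ht.
Qed.

Lemma global_w_plus p :
  filterlim f (Rbar_locally p_infty) (locally (T := C_UniformSpace) p) -> H_plus F p (f 0).
Proof.
  intros Hf q; split.
  - intros [a [b [g [Hpar Hq]]]].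
    destruct (parametrization_global a b g Hpar) as [-> [-> [c E]]].
    apply (global_limit_point p_infty p c q (or_introl eq_refl) Hf).
    destruct Hq as [t [H1 [H2 H3]]]; exists t; split; [exact H1|split; [exact H2|]].
    revert H3; apply filterlim_ext; intros n; apply E.
  - intros ->; exists m_infty, p_infty, f; split; [apply global_parametrizes|].
    destruct (proj2 (global_limit_point p_infty p 0 p (or_introl eq_refl) Hf) eq_refl)
      as [t [H1 [H2 H3]]]; exists t; split; [exact H1|split; [exact H2|]].
    revert H3; apply filterlim_ext; intros n; rewrite Rplus_0_r; reflexivity.
Qed.

Lemma global_w_minus p :
  filterlim f (Rbar_locally m_infty) (locally (T := C_UniformSpace) p) -> H_minus F p (f 0).
Proof.
  intros Hf q; split.
  - intros [a [b [g [Hpar Hq]]]].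
    destruct (parametrization_global a b g Hpar) as [-> [-> [c E]]].
    apply (global_limit_point m_infty p c q (or_intror eq_refl) Hf).
    destruct Hq as [t [H1 [H2 H3]]]; exists t; split; [exact H1|split; [exact H2|]].
    revert H3; apply filterlim_ext; intros n; apply E.
  - intros ->; exists m_infty, p_infty, f; split; [apply global_parametrizes|].
    destruct (proj2 (global_limit_point m_infty p 0 p (or_intror eq_refl) Hf) eq_refl)
      as [t [H1 [H2 H3]]]; exists t; split; [exact H1|split; [exact H2|]].
    revert H3; apply filterlim_ext; intros n; rewrite Rplus_0_r; reflexivity.
Qed.

End GlobalSolution.

Lemma orbit_refl F (x : C) a b e g p :
  parametrizes F (orbit F x) a b g -> is_limit_point a b e g p -> orbit F x x.
Proof.
  intros [_ Htr] [t [Hin _]].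
  destruct (proj2 (Htr (g (t 0%nat)))) as [u [a' [b' [h [Hmax [H0 [E0 _]]]]]]].
  { exists (t 0%nat); split; [apply Hin|reflexivity]. }
  exists 0, a', b', h; exact (conj Hmax (conj H0 (conj E0 (conj H0 E0)))).
Qed.

Lemma limit_of_equilibrium F (a b e : Rbar) (g : R -> C) s p q : holomorphic F -> F p = RtoC 0 ->
  is_solution F a b g -> in_interval a b s -> g s = p -> is_limit_point a b e g q -> q = p.
Proof.
  intros HF Hp Hg Hs E [t [Hin [_ Hq]]].
  apply (Cfilterlim_unique _ _ _ _ Hq).
  apply (filterlim_ext (fun _ => p)); [|apply filterlim_const].
  intros n; symmetry.
  apply (solutions_agree_on F a b g (fun _ => p) s (t n)); try assumption; [|apply Hin].
  apply constant_solution, Hp.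
Qed.

(** * Openness of the heteroclinic region *)

Theorem theorem5p3 (F : C -> C) (a_plus a_minus : C)
    (F_entire : entire F)
    (F_nonzero : ~ (forall z : C, F z = 0%C))
    (a_neq : a_plus <> a_minus)
    (a_plus_eq : equilibrium F a_plus)
    (a_minus_eq : equilibrium F a_minus)
    (connected : exists Gamma : C -> Prop,
        heteroclinic_orbit F a_plus a_minus Gamma) :
  open (T := C_UniformSpace) (heteroclinic_region F a_plus a_minus).
Proof.
  assert (HF := entire_holomorphic F F_entire).
  assert (Hnz : exists z, F z <> RtoC 0) by (apply not_all_ex_not, F_nonzero).
  assert (HF' := reverse_field_holomorphic F HF).
  assert (Hnz' : exists z, reverse_field F z <> RtoC 0).
  { destruct Hnz as [z Hz]; exists z; intros E; apply Hz.
    unfold reverse_field in E; replace (F z) with (- - F z)%C by ring; rewrite E; ring. }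
  assert (am' : reverse_field F a_minus = RtoC 0).
  { unfold reverse_field; rewrite a_minus_eq; ring. }
  intros x [Hp Hm].
  destruct (proj2 (Hp a_plus) eq_refl) as [a [b [g [[Hgmax Hgtr] Hgl]]]].
  destruct (proj2 (Hm a_minus) eq_refl) as [a' [b' [h [[Hhmax Hhtr] Hhl]]]].
  assert (Hgu : forall q, is_limit_point a b b g q -> q = a_plus).
  { intros q Hq; apply Hp; exists a, b, g; split; [split; assumption|exact Hq]. }
  assert (Hhu : forall q, is_limit_point a' b' a' h q -> q = a_minus).
  { intros q Hq; apply Hm; exists a', b', h; split; [split; assumption|exact Hq]. }
  assert (Hxx : orbit F x x) by exact (orbit_refl F x a b b g a_plus (conj Hgmax Hgtr) Hgl).
  destruct (proj1 (Hgtr x) Hxx) as [s [Hs Es]].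
  destruct (proj1 (Hhtr x) Hxx) as [u [Hu Eu]].
  assert (Hgsol : is_solution F a b g) by apply Hgmax.
  assert (Hhsol : is_solution F a' b' h) by apply Hhmax.
  (* The limit sets at both ends of the orbit of an equilibrium are the same point. *)
  assert (Nxp : x <> a_plus).
  { intros E; apply a_neq; symmetry.
    apply (limit_of_equilibrium F a' b' a' h u); try assumption; rewrite Eu; exact E. }
  assert (Nxm : x <> a_minus).
  { intros E; apply a_neq.
    apply (limit_of_equilibrium F a b b g s); try assumption; rewrite Es; exact E. }
  destruct (forward_solution F a b g a_plus s) as [P1 [P2 P3]]; try assumption.
  { rewrite Es; exact Nxp. }
  destruct (forward_solution (reverse_field F) (Rbar_opp b') (Rbar_opp a') (fun t => h (- t))
    a_minus (- u)) as [M1 [M2 M3]]; try assumption.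
  { apply is_solution_reverse, Hhsol. }
  { apply in_interval_opp, Hu. }
  { rewrite Ropp_involutive, Eu; exact Nxm. }
  { apply is_limit_point_reverse, Hhl. }
  { intros q Hq; apply Hhu, is_limit_point_reverse, Hq. }
  destruct (basin_of_truncation F a_plus _ HF Hnz a_plus_eq P1 P2 P3) as [Rp [HRp Bp]].
  destruct (basin_of_truncation _ a_minus _ HF' Hnz' am' M1 M2 M3) as [Rm [HRm Bm]].
  set (r := Rp + Rm).
  destruct (Bp r ltac:(unfold r; lra)) as [dp [Hdp Kp]].
  destruct (Bm r ltac:(unfold r; lra)) as [dm [Hdm Km]].
  rewrite Rplus_0_r, Es in Kp.
  rewrite Rplus_0_r, Ropp_involutive, Eu in Km.
  apply locally_disc; exists (Rmin dp dm); split; [apply Rmin_glb_lt; assumption|].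
  intros y Hy.
  destruct (truncation_lipschitz F r HF ltac:(unfold r; lra)) as [L [HL Lip]].
  destruct (truncation_bounded F r HF ltac:(unfold r; lra)) as [B [HB Bd]].
  destruct (lipschitz_global_solution (fun z => F (clamp r z)) L B y HL HB Lip Bd) as [f [f0 Hf]].
  destruct (Kp f) as [Sp Tp].
  { rewrite f0; eapply Rlt_le_trans; [exact Hy|apply Rmin_l]. }
  { exact Hf. }
  destruct (Km (fun t => f (- t))) as [Sm Tm].
  { rewrite Ropp_0, f0; eapply Rlt_le_trans; [exact Hy|apply Rmin_r]. }
  { intros t; apply is_curve_derive_reverse, Hf. }
  (* On both half-lines [f] stays in the square, where the truncation changes nothing. *)
  assert (Hsol : global_solution F f).
  { intros t; specialize (Hf t); rewrite clamp_id in Hf; [exact Hf|].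
    destruct (Rle_dec 0 t) as [Ht|Ht]; [apply Sp, Ht|].
    rewrite <- (Ropp_involutive t); apply Sm; lra. }
  rewrite <- f0; split.
  - apply global_w_plus; [exact HF|exact Hsol|].
    apply filterlim_Cmod; [typeclasses eauto|]; intros e He; destruct (Tp e He) as [T HT].
    exists T; intros t Ht; apply HT; lra.
  - apply global_w_minus; [exact HF|exact Hsol|].
    apply filterlim_Cmod; [typeclasses eauto|]; intros e He; destruct (Tm e He) as [T HT].
    exists (- T); intros t Ht; rewrite <- (Ropp_involutive t); apply HT; lra.
Qed.
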